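(* For each $\varsigma\in\{-1,+1\}$, $$\lim_{n\to\infty}\frac{A^{\mathrm K}_{\varsigma}(n)}{n}=\frac12-\frac1\pi .$$
   Context: For $n\ge1$ and $0\le i,j\le n$, define $K_j^{(n)}(i)$ by $\sum_{j=0}^n K_j^{(n)}(i)z^j=(1+z)^{n-i}(1-z)^i$. For $u=(u_0,\dots,u_n)\in\mathbb R^{n+1}$ (a ''radial vector'') define the Krawtchouk transform $$(\mathcal K_nu)_k=2^{-n/2}\sum_{i=0}^nK_i^{(n)}(k)u_i\qquad(0\le k\le n).$$ $\mathcal K_n$ is an involution (orthogonal for the inner product $\langle u,v\rangle_w=\sum_i\binom ni u_iv_i$). Let $\mathcal E_n^{\varsigma}$ be its eigenspace with eigenvalue $\varsigma\in\{-1,+1\}$. Put $$r_n(u)=\min\{r\in\{0,\dots,n\}:u_i\ge0\text{ for every }i\ge r\},$$ with value $+\infty$ if the set is empty, and $$A^{\mathrm K}_{\varsigma}(n)=\inf\{r_n(u):0\ne u\in\mathcal E_n^{\varsigma},\ u_0=0\},$$ again with value $+\infty$ if there is no such vector with $r_n(u)<\infty$. *)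

(* Defs.v *)
From HB Require Import structures.
From mathcomp Require Import all_boot all_order all_algebra.
From mathcomp Require Import all_classical all_reals all_analysis.

Set Implicit Arguments.
Unset Strict Implicit.
Unset Printing Implicit Defensive.

Import Order.TTheory GRing.Theory Num.Theory.
Import numFieldNormedType.Exports.

Local Open Scope classical_set_scope.
Local Open Scope ring_scope.

Section Krawtchouk.
Variable R : realType.

(* K_j^{(n)}(i); meaningful for i <= n, where n - i is not truncated. *)
Definition krawtchouk (n j i : nat) : R :=
  ((1 + 'X) ^+ (n - i) * (1 - 'X) ^+ i : {poly R})`_j.

Definition krawtchouk_transform (n : nat) (u : 'rV[R]_n.+1) : 'rV[R]_n.+1 :=
  \row_(k < n.+1)
    (2 `^ (- (n%:R / 2)) * \sum_(i < n.+1) krawtchouk n i k * u 0 i).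

Definition krawtchouk_eigenspace (n : nat) (s : R) : set 'rV[R]_n.+1 :=
  [set u | krawtchouk_transform u = s *: u].

(* The value is +oo when no r in {0, ..., n} qualifies. *)
Definition last_sign_radius (n : nat) (u : 'rV[R]_n.+1) : \bar R :=
  \big[mine/+oo%E]_(r < n.+1 | [forall i : 'I_n.+1, (r <= i)%N ==> (0 <= u 0 i)])
    ((r : nat)%:R)%:E.

(* ereal_inf set0 = +oo, as is the infimum when last_sign_radius is +oo on the
   whole set. *)
Definition krawtchouk_uncertainty (s : R) (n : nat) : \bar R :=
  ereal_inf [set last_sign_radius u | u in
    [set u : 'rV[R]_n.+1 |
      [/\ u != 0, krawtchouk_eigenspace s u & u 0 ord0 = 0]]].

End Krawtchouk.

(* Main.v *)
(* Encode a radial vector u as U(y) = sum_i C(n,i) u_i y^i. Up to the factor 2^(n/2), the Krawtchouk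
   transform becomes U(y) -> (1+y)^n U((1-y)/(1+y)), which is multiplicative on forms. The quartic forms
   (1+y^2)^2 + 4 c y (1-y^2) are eigenvectors; with c running over the K positive Chebyshev nodes their
   product Q satisfies Q = (4 y^2)^K prod_j (S^2 + 2 c_j S + 1), S = (1-y^2)/(2y), and since the mean of the
   nodes tends to 2/pi, |Q| is of size 4^K rho^(4K(1/2-1/pi)) on circles |y| = rho slightly below 1, Re y >= 0.

   Lower bound: on the boundary of the half disc |y| <= 1, Re y >= 0, one has
   |U|^(4K) <= (L/2^(n/2))^(4K) |Q|^n with L = sum |U_i|. The maximum principle applied to U(y) and U(-y)
   gives |U_i| <= L rho^((1/2-1/pi-eps)n-i), so the coefficients with i < (1/2-1/pi-2eps)n carry less than
   half of L; but U(1) = 0 forces the negative coefficients to carry exactly half of L.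

   Upper bound: Q is a form in 1+y and y(1-y); truncating it and multiplying by linear eigenvectors gives
   an eigenvector, with constant term 1, whose coefficients beyond (1/2-1/pi+eps)n are far smaller than
   2^(-n/2) sum_(j >= i) C(n,j). Subtracting it from 1 +- 2^(-n/2)(1+y)^n and dividing by y(1-y) yields an
   eigenvector whose late coefficients are essentially 2^(-n/2) sum_(j >= i) C(n,j) > 0; its constant term is
   then removed by a second copy of the small eigenvector. *)
Require Import Defs.
From HB Require Import structures.
From mathcomp Require Import all_boot all_order all_algebra.
From mathcomp Require Import all_classical all_reals all_analysis.
From mathcomp Require Import complex ring lra zify.

Set Implicit Arguments.
Unset Strict Implicit.
Unset Printing Implicit Defensive.

Import Order.TTheory GRing.Theory Num.Theory.
Import numFieldNormedType.Exports.

Local Open Scope classical_set_scope.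
Local Open Scope ring_scope.

(** The choice of Q: it has no zero in the half disc, so log|Q| is harmonic there. On the whole
    boundary Re S = 0, and the product over the nodes collapses to 1 + |S|^(4K). Up to an error
    log(2)/2, log|Q| therefore equals K log 4 on the arc and 2K log(1 + t^2) at the point it of the
    segment, which is the shape of the bounds that an eigenvector obeys. Q is thus an explicit
    polynomial substitute for the best harmonic majorant. Its rate of decay inside the disc explains
    the constant: |4 y^2|^K contributes 1/2, and the linear terms 2 c_j S contribute -1/pi. The
    difficulty is that this rate must hold on a whole half circle, where no single estimate of the
    product over the nodes suffices: the arithmetic-geometric mean serves near the real axis, an
    exchange of roots in between, and a change of radius near the imaginary axis. For the upper
    bound the circle lies outside the disc; there a power of 1 + (sqrt 2 - 1) y, with exponent of
    order eps n, suppresses all points off the positive axis, so that a crude bound is enough for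
    them. *)

Local Notation normc := (@Normc.normc _).
Local Notation Re := complex.Re.
Local Notation Im := complex.Im.

(** * Complex norms and the maximum principle on a half disc *)

Section MaxModulus.
Variable R : realType.
Local Notation C := R[i].

Lemma normcM (x y : C) : normc (x * y) = normc x * normc y.
Proof. exact: Normc.normcM. Qed.

Lemma normc_sqr (x : C) : normc x ^+ 2 = Re x ^+ 2 + Im x ^+ 2.
Proof. by case: x => a b /=; rewrite sqr_sqrtr // addr_ge0 // sqr_ge0. Qed.

Lemma normc_ge0 (x : C) : 0 <= normc x.
Proof. by case: x => a b /=; rewrite sqrtr_ge0. Qed.

Lemma normc_eq0 (x : C) : (normc x == 0) = (x == 0).
Proof.
apply/eqP/eqP => [/Normc.eq0_normc //|->]; exact: (Normc.normc0 R).
Qed.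

Lemma normc_gt0 (x : C) : (0 < normc x) = (x != 0).
Proof. by rewrite lt_def normc_ge0 andbT normc_eq0. Qed.

Lemma normcX (x : C) n : normc (x ^+ n) = normc x ^+ n.
Proof.
elim: n => [|n IH]; first by rewrite !expr0 (Normc.normc1 R).
by rewrite !exprS normcM IH.
Qed.

Lemma normcR (x : R) : normc (x%:C)%C = `|x|.
Proof. by rewrite /= expr0n /= addr0 sqrtr_sqr. Qed.

Lemma continuous_horner_ReIm (p : {poly C}) :
  continuous (fun z : R * R => Re p.[(z.1 +i* z.2)%C]) /\
  continuous (fun z : R * R => Im p.[(z.1 +i* z.2)%C]).
Proof.
elim/poly_ind: p => [|p c [IHr IHi]].
  by split => z; under eq_fun do rewrite horner0; exact: cvg_cst.
have Er (z : R * R) : Re (p * 'X + c%:P).[(z.1 +i* z.2)%C] =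
   Re p.[(z.1 +i* z.2)%C] * z.1 - Im p.[(z.1 +i* z.2)%C] * z.2 + Re c.
  by rewrite hornerMXaddC; case: (p.[_]) => a b; case: (c) => ? ?.
have Ei (z : R * R) : Im (p * 'X + c%:P).[(z.1 +i* z.2)%C] =
   Re p.[(z.1 +i* z.2)%C] * z.2 + Im p.[(z.1 +i* z.2)%C] * z.1 + Im c.
  by rewrite hornerMXaddC; case: (p.[_]) => a b; case: (c) => ? ?.
split => z.
  under eq_fun do rewrite Er.
  apply: cvgD; last exact: cvg_cst.
  by apply: cvgB; apply: cvgM; (exact: IHr || exact: IHi || exact: cvg_fst || exact: cvg_snd).
under eq_fun do rewrite Ei.
apply: cvgD; last exact: cvg_cst.
by apply: cvgD; apply: cvgM; (exact: IHr || exact: IHi || exact: cvg_fst || exact: cvg_snd).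
Qed.

(** Open mapping argument in polynomial form. The combination [d] vanishes at [z0] to an order [m],
    with cofactor [f] nonzero at [z0]. Moving from [z0] in a direction [u] with [u ^+ m = A /
    f.[z0]] adds to [p.[z0] * q] a term of size [t ^+ m] that points almost the same way, so the
    modulus grows. *)
Lemma poly_quot_no_local_max (p q : {poly C}) (x y e : R) :
  p.[(x +i* y)%C] != 0 -> q.[(x +i* y)%C] != 0 ->
  q.[(x +i* y)%C] *: p != p.[(x +i* y)%C] *: q -> 0 < e ->
  exists a b, [/\ `|a - x| < e, `|b - y| < e &
    normc p.[(x +i* y)%C] * normc q.[(a +i* b)%C] <
    normc p.[(a +i* b)%C] * normc q.[(x +i* y)%C]].
Proof.
set z0 := (x +i* y)%C => p0 q0 dn0 e0.
pose d := q.[z0] *: p - p.[z0] *: q.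
have d0 : d != 0 by rewrite subr_eq0.
have rd : d.[z0] = 0 by rewrite /d !hornerE mulrC subrr.
have [m [f]] := multiplicity_XsubC d z0.
rewrite d0 /= => nrf Ed.
have m0 : (0 < m)%N.
  case: m Ed => // Ed; move: nrf; rewrite /root.
  by rewrite Ed expr0 mulr1 in rd; rewrite rd eqxx.
have f0 : f.[z0] != 0 by [].
pose A := p.[z0] * q.[z0].
have A0 : A != 0 by rewrite mulf_neq0.
pose u : C := m.-root (A / f.[z0]).
have um : u ^+ m = A / f.[z0] by rewrite rootCK.
pose Z (t : R) : R * R := (x + t * Re u, y + t * Im u).
have cZ : continuous Z.
  have cl (c v : R) : continuous (fun t : R => c + t * v).
    by move=> t; apply: cvgD; [exact: cvg_cst|apply: cvgM; [exact: cvg_id|exact: cvg_cst]].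
  by move=> t; exact: (cvg_pair (cl x (Re u) t) (cl y (Im u) t)).
have Z0 : Z 0 = (x, y) by rewrite /Z !mul0r !addr0.
pose B (t : R) := p.[z0] * q.[((Z t).1 +i* (Z t).2)%C].
pose W (t : R) := (A / f.[z0]) * f.[((Z t).1 +i* (Z t).2)%C].
have Zu (t : R) : ((Z t).1 +i* (Z t).2)%C - z0 = (t%:C)%C * u.
  by rewrite /Z /z0; case: (u) => a b /=; apply/eqP; rewrite eq_complex /=; apply/andP; split; apply/eqP; ring.
have key (t : R) : q.[z0] * p.[((Z t).1 +i* (Z t).2)%C] = B t + (t ^+ m)%:C%C * W t.
  have : d.[((Z t).1 +i* (Z t).2)%C] = (t ^+ m)%:C%C * W t.
    rewrite Ed hornerM horner_exp !hornerE Zu exprMn um /W -rmorphXn. by rewrite /= mulrCA [f.[_] * _]mulrC !mulrA.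
  by rewrite /d !hornerE => <-; rewrite /B addrC subrK.
(* The inner product of [B t] and [W t] as plane vectors. It is |A|^2 at 0, hence positive nearby,
   and then |B + t^m W| > |B|. *)
pose G t := Re (B t) * Re (W t) + Im (B t) * Im (W t).
have cont_h (g : {poly C}) (c : C) :
   continuous (fun t => Re (c * g.[((Z t).1 +i* (Z t).2)%C])) /\
   continuous (fun t => Im (c * g.[((Z t).1 +i* (Z t).2)%C])).
  have [hr hi] := continuous_horner_ReIm (c *: g).
  split => t.
    under eq_fun do rewrite -hornerZ.
    by apply: (@continuous_comp _ _ _ Z (fun z => Re (c *: g).[(z.1 +i* z.2)%C])); [exact: cZ | exact: hr].
  under eq_fun do rewrite -hornerZ.
  by apply: (@continuous_comp _ _ _ Z (fun z => Im (c *: g).[(z.1 +i* z.2)%C])); [exact: cZ | exact: hi].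
have cG : continuous G.
  have [b1 b2] := cont_h q p.[z0].
  have [w1 w2] := cont_h f (A / f.[z0]).
  move=> t; apply: cvgD; apply: cvgM; [exact: b1|exact: w1|exact: b2|exact: w2].
have G0 : 0 < G 0.
  have -> : G 0 = normc A ^+ 2.
    rewrite /G /B /W Z0 /= -/z0 -/A.
    have -> : A / f.[z0] * f.[z0] = A by rewrite divfK.
    by rewrite normc_sqr !expr2.
  by rewrite exprn_gt0 // normc_gt0.
have nG : \forall t \near (0 : R), 0 < G t.
  have /cvgrPdist_lt /(_ _ G0) := cG 0.
  by apply: filterS => t; rewrite ltr_norml => /andP[_]; lra.
have cZ1 : \forall t \near (0:R), `|(Z t).1 - x| < e.
  have : (fun t => (Z t).1) @ (0:R) --> (Z 0).1.
    by apply: cvgD; [exact: cvg_cst|apply: cvgM; [exact: cvg_id|exact: cvg_cst]].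
  by rewrite Z0 => /cvgrPdist_lt /(_ e e0); apply: filterS => t; rewrite distrC.
have cZ2 : \forall t \near (0:R), `|(Z t).2 - y| < e.
  have : (fun t => (Z t).2) @ (0:R) --> (Z 0).2.
    by apply: cvgD; [exact: cvg_cst|apply: cvgM; [exact: cvg_id|exact: cvg_cst]].
  by rewrite Z0 => /cvgrPdist_lt /(_ e e0); apply: filterS => t; rewrite distrC.
have [t [t0 Gt Z1 Z2]] : exists t : R, [/\ 0 < t, 0 < G t, `|(Z t).1 - x| < e & `|(Z t).2 - y| < e].
  have [r /= r0 H] : nbhs (0:R) (fun t => 0 < G t /\ `|(Z t).1 - x| < e /\ `|(Z t).2 - y| < e).
    by apply: filterI => //; apply: filterI.
  exists (r / 2).
  have [|g [z1 z2]] := H (r/2); last by split => //; rewrite divr_gt0.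
    by rewrite /= sub0r normrN gtr0_norm ?divr_gt0 // ltr_pdivrMr // ltr_pMr // ltr1n.
exists (Z t).1, (Z t).2; split => //.
rewrite -normcM [ltRHS]mulrC -normcM -/(B t) key.
rewrite -ltr_sqr ?nnegrE ?normc_ge0 // !normc_sqr.
have tm : 0 < t ^+ m by rewrite exprn_gt0.
move: Gt; rewrite /G; case: (B t) => b1 b2; case: (W t) => w1 w2 /=.
set T := t ^+ m in tm *.
rewrite mul0r subr0 mul0r addr0 => Gt.
have -> : (b1 + T * w1) ^+ 2 + (b2 + T * w2) ^+ 2 =
   b1 ^+ 2 + b2 ^+ 2 + (2 * T * (b1 * w1 + b2 * w2) + T ^+ 2 * (w1 ^+ 2 + w2 ^+ 2)) by ring.
rewrite ltrDl ltr_pwDl //; first by rewrite !mulr_gt0.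
by rewrite mulr_ge0 ?sqr_ge0 // addr_ge0 ?sqr_ge0.
Qed.

(** The quotient of squared moduli attains its maximum on the compact half disc. An interior maximum
    contradicts [poly_quot_no_local_max] unless [p] and [q] are proportional, and then the point 1
    of the arc already gives the bound. *)
Lemma max_modulus_half_disc (p q : {poly C}) (M : R) :
  (forall a b : R, 0 <= a -> a ^+ 2 + b ^+ 2 <= 1 -> q.[(a +i* b)%C] != 0) ->
  (forall a b : R, 0 <= a -> a ^+ 2 + b ^+ 2 <= 1 ->
     a = 0 \/ a ^+ 2 + b ^+ 2 = 1 ->
     normc p.[(a +i* b)%C] <= M * normc q.[(a +i* b)%C]) ->
  forall a b : R, 0 <= a -> a ^+ 2 + b ^+ 2 <= 1 ->
     normc p.[(a +i* b)%C] <= M * normc q.[(a +i* b)%C].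
Proof.
move=> q0 bd.
pose D : set (R * R) := [set z | 0 <= z.1 /\ z.1 ^+ 2 + z.2 ^+ 2 <= 1].
pose f (z : R * R) := normc p.[(z.1 +i* z.2)%C] ^+ 2 / normc q.[(z.1 +i* z.2)%C] ^+ 2.
have csq (g : {poly C}) : continuous (fun z : R * R => normc g.[(z.1 +i* z.2)%C] ^+ 2).
  move=> z; have [hr hi] := continuous_horner_ReIm g.
  under eq_fun do rewrite normc_sqr !expr2.
  by apply: cvgD; apply: cvgM; (exact: hr || exact: hi).
have Dc : compact D.
  apply: (@subclosed_compact _ _ (`[(-1 : R), 1] `*` `[(-1 : R), 1])).
  - have -> : D = [set z : R * R | 0 <= z.1] `&` [set z : R * R | z.1 ^+ 2 + z.2 ^+ 2 <= 1].
      by apply/seteqP; split => z.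
    apply: closedI.
      apply: (@closed_comp _ _ (fun z : R * R => z.1) [set x : R | 0 <= x]); last exact: closed_ge.
      by move=> z _; exact: cvg_fst.
    apply: (@closed_comp _ _ (fun z : R * R => z.1 ^+ 2 + z.2 ^+ 2) [set x : R | x <= 1]); last exact: closed_le.
    move=> z _; under eq_fun do rewrite !expr2.
    by apply: cvgD; apply: cvgM; (exact: cvg_fst || exact: cvg_snd).
  - by apply: compact_setX; exact: segment_compact.
  - move=> [a b] [/= a0 ab]; split => /=; rewrite in_itv /=.
      by have := sqr_ge0 b; nra.
    by have := sqr_ge0 a; nra.
have [||c cD cmax] := compact_EVT_max _ Dc (f := f).
- by exists (0, 0); rewrite /D /= expr0n addr0.
- apply: continuous_in_subspaceT => z zD; apply: cvgM; first exact: csq.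
  apply: cvgV; last exact: csq.
  move: zD; rewrite inE => -[z1 z2]; by rewrite expf_neq0 // normc_eq0 q0.
move: cD; rewrite inE => -[c1 c2].
have qc0 := q0 _ _ c1 c2.
have fle (a b : R) : 0 <= a -> a ^+ 2 + b ^+ 2 <= 1 ->
   normc p.[(a +i* b)%C] * normc q.[(c.1 +i* c.2)%C] <=
   normc p.[(c.1 +i* c.2)%C] * normc q.[(a +i* b)%C].
  move=> a0 ab; have := cmax (a, b); rewrite inE => /(_ (conj a0 ab)).
  have qa := q0 _ _ a0 ab.
  rewrite /f /= -!expr_div_n ler_sqr ?nnegrE ?divr_ge0 ?normc_ge0 //.
  rewrite ler_pdivrMr ?normc_gt0 // mulrAC ler_pdivlMr ?normc_gt0 //.
suff cM : normc p.[(c.1 +i* c.2)%C] <= M * normc q.[(c.1 +i* c.2)%C].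
  move=> a b a0 ab; rewrite -(ler_pM2r (x := normc q.[(c.1 +i* c.2)%C])) ?normc_gt0 //.
  apply: le_trans (fle _ _ a0 ab) _.
  by rewrite mulrAC ler_wpM2r // normc_ge0.
have [c10|c1n0] := eqVneq c.1 0; first by apply: bd => //; left.
have [c21|c2n1] := eqVneq (c.1 ^+ 2 + c.2 ^+ 2) 1; first by apply: bd => //; right.
have one : 0 <= (1 : R) by [].
have oneq : (1 : R) ^+ 2 + 0 ^+ 2 <= 1 by rewrite expr1n expr0n addr0.
have one1 : (1 : R) ^+ 2 + 0 ^+ 2 = 1 by rewrite expr1n expr0n addr0.
have b1 := bd _ _ one oneq (or_intror one1).
have q1 := q0 _ _ one oneq.
have M0 : 0 <= M.
  by rewrite -(pmulr_lge0 (x := normc q.[(1 +i* 0)%C])) ?normc_gt0 // (le_trans _ b1) ?normc_ge0.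
have [pc0|pcn0] := eqVneq p.[(c.1 +i* c.2)%C] 0.
  by rewrite pc0 (Normc.normc0 R) mulr_ge0 ?normc_ge0.
have [E|NE] := eqVneq (q.[(c.1 +i* c.2)%C] *: p) (p.[(c.1 +i* c.2)%C] *: q).
  have := congr1 (fun g : {poly C} => normc g.[(1 +i* 0)%C]) E.
  rewrite /= !hornerZ !normcM => E1.
  rewrite -(ler_pM2r (x := normc q.[(1 +i* 0)%C])) ?normc_gt0 // -E1.
  by rewrite mulrC mulrAC ler_wpM2r // normc_ge0.
have c1p : 0 < c.1 by rewrite lt_def c1n0.
have c2p : c.1 ^+ 2 + c.2 ^+ 2 < 1 by rewrite lt_def eq_sym c2n1.
(* Both coordinates of [c] are at most 1 in absolute value, so moving each by less than [e <= 1]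
   raises the squared modulus by less than 4e + 2e^2 <= 6e. *)
pose e := Num.min c.1 ((1 - (c.1 ^+ 2 + c.2 ^+ 2)) / 6).
have e0 : 0 < e by rewrite lt_min c1p /= divr_gt0 // subr_gt0.
have [a [b [ha hb]]] := poly_quot_no_local_max pcn0 qc0 NE e0.
rewrite ltNge fle //.
  have : e <= c.1 by rewrite ge_min lexx.
  by move: ha; rewrite ltr_norml => /andP[]; lra.
have e1 : e <= (1 - (c.1 ^+ 2 + c.2 ^+ 2)) / 6 by rewrite ge_min lexx orbT.
have ec : e <= c.1 by rewrite ge_min lexx.
move: ha hb; rewrite !ltr_norml => /andP[ha1 ha2] /andP[hb1 hb2].
have : -1 <= c.2 <= 1 by nra.
have : c.1 <= 1 by nra.
nra.
Qed.

End MaxModulus.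

(** * Unit complex numbers and Cauchy's estimate for coefficients *)

Section Cis.
Variable R : realType.
Local Notation C := R[i].

Lemma normcD_le (x y : C) : normc (x + y) <= normc x + normc y.
Proof. exact: le_normcD. Qed.

Lemma normc_sum_le (I : Type) (r : seq I) (P : pred I) (F : I -> C) :
  normc (\sum_(i <- r | P i) F i) <= \sum_(i <- r | P i) normc (F i).
Proof.
elim/big_ind2: _ => [|x a y b xa yb|//]; first by rewrite (Normc.normc0 R).
exact: le_trans (normcD_le _ _) (lerD xa yb).
Qed.

Lemma normc_prod (I : Type) (r : seq I) (P : pred I) (F : I -> C) :
  normc (\prod_(i <- r | P i) F i) = \prod_(i <- r | P i) normc (F i).
Proof. by elim/big_rec2: _ => [|i x y _ <-]; rewrite ?(Normc.normc1 R) ?normcM. Qed.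

Definition cis (x : R) : C := (cos x +i* sin x)%C.

Lemma cisD x y : cis (x + y) = cis x * cis y.
Proof.
by apply/eqP; rewrite eq_complex /= cosD sinD; apply/andP; split; apply/eqP; ring.
Qed.

Lemma cis0 : cis 0 = 1.
Proof. by rewrite /cis cos0 sin0. Qed.

Lemma cisX x n : cis x ^+ n = cis (x * n%:R).
Proof.
elim: n => [|n IH]; first by rewrite mulr0 cis0.
by rewrite exprS IH -cisD; congr cis; rewrite -natr1; ring.
Qed.

Lemma normc_cis x : normc (cis x) = 1.
Proof. by rewrite /= cos2Dsin2 sqrtr1. Qed.

Lemma cis_neq0 x : cis x != 0.
Proof. by rewrite -normc_eq0 normc_cis oner_neq0. Qed.

Lemma cis2pi (n : nat) : cis (2 * pi * n%:R) = 1.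
Proof.
rewrite -cisX; suff -> : cis (2 * pi) = 1 by rewrite expr1n.
have -> : 2 * pi = pi *+ 2 :> R by ring.
by rewrite /cis cos2pi sin2pi.
Qed.

Lemma cos_eq1 (x : R) : 0 <= x < 2 * pi -> cos x = 1 -> x = 0.
Proof.
move=> /andP[x0 x2] c1; apply/eqP; apply: contraT => xn0.
have h : 0 < x / 2 < pi by have : 0 < x; [rewrite lt_def xn0|move=> ?; apply/andP; split; lra].
have := sin_gt0_pi h.
have : cos x = 1 - 2 * sin (x / 2) ^+ 2.
  have -> : cos x = cos ((x / 2) *+ 2) by congr cos; rewrite mulr2n; lra.
  by rewrite cos_mulr2n cos2sin2; ring.
rewrite c1 => E sp.
have : 0 < sin (x / 2) ^+ 2 by rewrite exprn_gt0.
lra.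
Qed.

Lemma cis_eq1 (x : R) : `|x| < 2 * pi -> cis x = 1 -> x = 0.
Proof.
move=> x2 [c _]; apply/eqP; rewrite -normr_eq0; apply/eqP; apply: cos_eq1.
  by rewrite normr_ge0 x2.
by rewrite cos_norm.
Qed.

(** Cauchy's estimate with a finite average in place of the integral: over [size p] equally spaced
    points of the circle, all powers other than the i-th cancel, because two exponents below
    [size p] are congruent modulo [size p] only if they are equal. *)
Lemma coef_norm_le (p : {poly C}) (rho B : R) (i : nat) : 0 < rho ->
  (forall z, normc z = rho -> normc p.[z] <= B) ->
  normc p`_i * rho ^+ i <= B.
Proof.
move=> r0 hB.
have nr : normc (rho%:C)%C = rho by rewrite normcR gtr0_norm.
have B0 : 0 <= B by apply: le_trans (normc_ge0 _) (hB _ nr).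
have [isz|isz] := leqP (size p) i.
  by rewrite nth_default // (Normc.normc0 R) mul0r.
set K := size p in isz.
have K0 : (0 < K)%N by exact: leq_ltn_trans isz.
have KR : 0 < K%:R :> R by rewrite ltr0n.
pose a (k : nat) := 2 * pi * k%:R / K%:R : R.
pose z k := (rho%:C)%C * cis (a k).
have E : \sum_(k < K) p.[z k] * cis (- (a k * i%:R)) = K%:R * (p`_i * (rho%:C)%C ^+ i).
  under eq_bigr do rewrite horner_coef mulr_suml.
  rewrite exchange_big /= (bigD1 (Ordinal isz)) //= [X in _ + X]big1 ?addr0.
    rewrite (eq_bigr (fun=> p`_i * (rho%:C)%C ^+ i)).
      by rewrite sumr_const card_ord mulr_natl.
    move=> k _; rewrite /z exprMn cisX -!mulrA -cisD subrr cis0 mulr1 //.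
  move=> j ji.
  have hj (k : nat) : p`_j * z k ^+ j * cis (- (a k * i%:R)) =
     p`_j * (rho%:C)%C ^+ j * (cis (2 * pi * (j%:R - i%:R) / K%:R)) ^+ k.
    rewrite /z exprMn !cisX -!mulrA -cisD; congr (_ * (_ * cis _)).
    by rewrite /a; field; rewrite pnatr_eq0 -lt0n.
  under eq_bigr do rewrite hj.
  rewrite -mulr_sumr; set w := cis _.
  have wK : w ^+ K = 1.
    rewrite /w cisX divfK ?gt_eqF //.
    have [ij|ij] := leqP i j; first by rewrite -natrB // cis2pi.
    have -> : 2 * pi * (j%:R - i%:R) = - (2 * pi * (i - j)%:R) :> R by rewrite natrB 1?ltnW //; ring.
    apply: (mulIf (cis_neq0 (2 * pi * (i - j)%:R))).
    by rewrite -cisD addNr cis0 cis2pi mulr1.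
  have w1 : w != 1.
    apply/eqP => /cis_eq1; rewrite !normrM normfV !normr_nat (gtr0_norm (pi_gt0 R)).
    have hlt : `|j%:R - i%:R| < K%:R :> R.
      have := ltn_ord j; rewrite -/K -(ltr_nat R) => jK.
      have iK : i%:R < K%:R :> R by rewrite ltr_nat.
      rewrite ltr_norml; have := ler0n R j; have := ler0n R i; lra.
    move=> /(_ _) H; have /H/eqP : 2 * pi * `|j%:R - i%:R| / K%:R < 2 * pi :> R.
      by rewrite ltr_pdivrMr // ltr_pM2l // mulr_gt0 // pi_gt0.
    rewrite !mulf_eq0 invr_eq0 !(gt_eqF KR) orbF subr_eq0 eqr_nat (gt_eqF (pi_gt0 R)) pnatr_eq0 /=.
    by move=> /eqP ji'; case/eqP: ji; apply/val_inj.
  have := subrX1 w K; rewrite wK subrr => /esym/eqP; rewrite mulf_eq0 subr_eq0 (negbTE w1) /=.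
  by move=> /eqP ->; rewrite mulr0.
have : normc (K%:R * (p`_i * (rho%:C)%C ^+ i)) <= \sum_(k < K) B.
  rewrite -E; apply: le_trans (normc_sum_le _ _ _) _; apply: ler_sum => k _.
  rewrite normcM normc_cis mulr1 hB // /z normcM normc_cis mulr1 nr //.
rewrite sumr_const card_ord -[B *+ K]mulr_natl !normcM normcX nr.
have -> : normc (K%:R : C) = K%:R.
  have -> : (K%:R : C) = (K%:R : R)%:C%C by rewrite rmorph_nat.
  by rewrite normcR normr_nat.
by rewrite ler_pM2l.
Qed.

End Cis.

(** * Chebyshev nodes and products over them *)

Section Nodes.
Variable R : realType.
Local Notation C := R[i].

Lemma natr_odd (k : nat) : (2 * k + 1)%:R = 2 * k%:R + 1 :> R.
Proof. by rewrite addn1 -natr1 natrM. Qed.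

Lemma map_quad (c : R) :
  map_poly (real_complex R) ('X^2 - c *: 'X + 1) = 'X^2 - (c%:C)%C *: 'X + 1.
Proof. by rewrite rmorphD rmorphB rmorphXn /= map_polyZ /= map_polyX rmorph1. Qed.

(** The roots are [cis (a k)] for [k < 2 * K]; the k-th and the (2K - 1 - k)-th are conjugate, and
    each conjugate pair yields one real quadratic factor. *)
Lemma prod_cos_XnD1 (K : nat) : (0 < K)%N ->
  \prod_(j < K) ('X ^+ 2 - (2 * cos ((2 * j + 1)%:R * pi / (2 * K)%:R)) *: 'X + 1)
  = 'X ^+ (2 * K) + 1 :> {poly R}.
Proof.
move=> K0; apply: (@map_poly_inj _ _ (real_complex R)).
pose a (k : nat) : R := (2 * k + 1)%:R * pi / (2 * K)%:R.
have KR : 0 < (2 * K)%:R :> R by rewrite ltr0n; lia.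
have pi0 := pi_gt0 R.
have sz : size ('X^(2 * K) + 1 : {poly C}) = (2 * K).+1.
  by rewrite -[1]/(1%:P) size_XnaddC //; lia.
have hroot k : (cis (a k)) ^+ (2 * K) = -1.
  rewrite cisX /a divfK ?gt_eqF //.
  have -> : (2 * k + 1)%:R * pi = 2 * pi * k%:R + pi :> R by rewrite natr_odd; ring.
  by rewrite cisD cis2pi mul1r /cis cospi sinpi; apply/eqP; rewrite eq_complex /= oppr0 !eqxx.
have inj k l : (k < 2 * K)%N -> (l < 2 * K)%N -> cis (a k) = cis (a l) -> k = l.
  move=> kK lK E.
  have /cis_eq1 : cis (a k - a l) = 1.
    by apply: (mulIf (cis_neq0 (a l))); rewrite -cisD subrK mul1r.
  have -> : a k - a l = 2 * pi * (k%:R - l%:R) / (2 * K)%:R by rewrite /a !natr_odd; field; lra.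
  rewrite !normrM normfV !normr_nat (gtr0_norm pi0) => H.
  have hlt : `|k%:R - l%:R| < (2 * K)%:R :> R.
    have : k%:R < (2 * K)%:R :> R by rewrite ltr_nat.
    have : l%:R < (2 * K)%:R :> R by rewrite ltr_nat.
    by rewrite ltr_norml; have := ler0n R k; have := ler0n R l; lra.
  have /H/eqP : 2 * pi * `|k%:R - l%:R| / (2 * K)%:R < 2 * pi :> R.
    by rewrite ltr_pdivrMr // ltr_pM2l // mulr_gt0.
  rewrite !mulf_eq0 invr_eq0 !(gt_eqF KR) orbF subr_eq0 eqr_nat (gt_eqF pi0) pnatr_eq0 /=.
  by move=> /eqP.
have fact : ('X^(2 * K) + 1 : {poly C}) = \prod_(0 <= k < 2 * K) ('X - (cis (a k))%:P).
  pose rs := [seq cis (a k) | k <- iota 0 (2 * K)].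
  have := @all_roots_prod_XsubC _ ('X^(2 * K) + 1 : {poly C}) rs.
  rewrite sz /rs size_map size_iota => /(_ erefl) ->.
  - have -> : lead_coef ('X^(2 * K) + 1 : {poly C}) = 1.
      by rewrite -[X in _ + X]/(1%:P); apply/monicP/monicXnaddC; lia.
    by rewrite scale1r big_map /index_iota subn0.
  - apply/allP => z /mapP[k _ ->]; rewrite /root !hornerE hroot addNr //.
  - rewrite uniq_rootsE map_inj_in_uniq ?iota_uniq // => k l; rewrite !mem_iota /= !add0n.
    exact: inj.
rewrite rmorph_prod [RHS]rmorphD rmorphXn /= map_polyX rmorph1 fact.
have E2K : (2 * K = K + K)%N by lia.
rewrite [in RHS]E2K (big_cat_nat (n := K)) //=; last by lia.
rewrite -{2}[K in RHS]add0n big_addn.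
have -> : (K + K - K = K)%N by lia.
rewrite [X in _ * X]big_nat_rev /= -big_split /= big_mkord.
apply: eq_bigr => j _; rewrite add0n.
have -> : cis (a (K - j.+1 + K)%N) = ((cis (a j))^*)%C.
  have -> : a (K - j.+1 + K)%N = 2 * pi * 1%:R - a j.
    have -> : (K - j.+1 + K = 2 * K - j.+1)%N by have := ltn_ord j; lia.
    rewrite /a; have -> : (2 * (2 * K - j.+1) + 1)%:R = 2 * (2 * K)%:R - (2 * j + 1)%:R :> R.
      apply/eqP; rewrite eq_sym subr_eq -!natrM -natrD; apply/eqP; congr (_%:R).
      by have := ltn_ord j; lia.
    by field; lra.
  by rewrite cisD cis2pi mul1r /cis cosN sinN.
rewrite /= map_quad.
have -> : (2 * cos ((2 * j + 1)%:R * pi / (2 * K)%:R))%:C%C = cis (a j) + ((cis (a j))^*)%C.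
  by rewrite -/(a j) /cis; apply/eqP; rewrite eq_complex /=; apply/andP; split; apply/eqP; ring.
have E1 : 1 = (cis (a j) * ((cis (a j))^*)%C).
  apply/eqP; rewrite eq_complex /=; apply/andP; split; apply/eqP; last by ring.
  by rewrite mulrN opprK -!expr2 cos2Dsin2.
rewrite -[1]/(1%:P) {}E1 polyCM -mul_polyC polyCD; ring.
Qed.

(** For [j < K] these are the positive zeros of the Chebyshev polynomial T_{2K}. *)
Definition node (K j : nat) : R := cos ((2 * j + 1)%:R * (pi / (4 * K)%:R)).

Lemma node_sqr K j : (0 < K)%N ->
  4 * node K j ^+ 2 = 2 + 2 * cos ((2 * j + 1)%:R * pi / (2 * K)%:R).
Proof.
move=> K0.
have -> : (2 * j + 1)%:R * pi / (2 * K)%:R = ((2 * j + 1)%:R * (pi / (4 * K)%:R)) *+ 2 :> R.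
  by rewrite mulr2n !natrM; field; rewrite pnatr_eq0; lia.
by rewrite cos_mulr2n -/(node K j); ring.
Qed.

Lemma prod_node (K : nat) : (0 < K)%N ->
  \prod_(j < K) ((1 + 'X) ^+ 2 - (4 * node K j ^+ 2) *: 'X)
  = 'X ^+ (2 * K) + 1 :> {poly R}.
Proof.
move=> K0; rewrite -prod_cos_XnD1 //; apply: eq_bigr => j _.
by rewrite node_sqr // -!mul_polyC polyCD; ring.
Qed.

Lemma prod_node_real (K : nat) (x : R) : (0 < K)%N ->
  \prod_(j < K) ((1 + x) ^+ 2 - 4 * node K j ^+ 2 * x) = x ^+ (2 * K) + 1.
Proof.
move=> K0; have := congr1 (fun p : {poly R} => p.[x]) (prod_node K0).
rewrite /= horner_prod !hornerE => <-.
by apply: eq_bigr => j _; rewrite !hornerE.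
Qed.

Lemma prod_node_complex (K : nat) (x : C) : (0 < K)%N ->
  \prod_(j < K) ((1 + x) ^+ 2 - (4 * node K j ^+ 2)%:C%C * x) = x ^+ (2 * K) + 1.
Proof.
move=> K0; have := congr1 (fun p : {poly R} => (map_poly (real_complex R) p).[x]) (prod_node K0).
rewrite /= rmorph_prod horner_prod rmorphD rmorphXn /= map_polyX rmorph1 !hornerE => <-.
apply: eq_bigr => j _; rewrite rmorphB rmorphXn rmorphD /= map_polyZ /= map_polyX rmorph1.
by rewrite !hornerE.
Qed.

(** The product is |2 T_{2K}(b)|. With b = cos al, the factors of x^(2K) + 1 at x = [cis (2 * al)]
    are the numbers 4 (b^2 - c_j^2) up to unimodular factors. *)
Lemma prod_node_cheb (K : nat) (b : R) : (0 < K)%N -> -1 <= b <= 1 ->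
  \prod_(j < K) `|4 * (b ^+ 2 - node K j ^+ 2)| <= 2.
Proof.
move=> K0 hb; set al := acos b.
have cb : cos al = b by rewrite /al acosK // in_itv.
have := prod_node_complex (cis (2 * al)) K0.
move=> /(congr1 (fun z => normc z)); rewrite normc_prod => E.
have : normc (cis (2 * al) ^+ (2 * K) + 1) <= 2.
  apply: le_trans (normcD_le _ _) _.
  by rewrite cisX normc_cis (Normc.normc1 R).
rewrite -E; apply: le_trans; rewrite le_eqVlt; apply/orP; left; apply/eqP; apply: eq_bigr => j _.
have -> : (1 + cis (2 * al)) ^+ 2 - (4 * node K j ^+ 2)%:C%C * cis (2 * al)
  = (4 * (b ^+ 2 - node K j ^+ 2))%:C%C * cis (2 * al).
  have -> : 1 + cis (2 * al) = cis al * (2 * b)%:C%C.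
    rewrite -cb; have -> : 2 * al = al *+ 2 by rewrite mulr2n; ring.
    apply/eqP; rewrite eq_complex /= cos_mulr2n sin_mulr2n; apply/andP; split; apply/eqP.
      by rewrite mulr0 subr0 mulr2n; ring.
    by rewrite add0r mulr0 add0r mulr2n; ring.
  rewrite exprMn -rmorphXn cisX [al * _]mulrC /=.
  rewrite [_ * _%:C%C]mulrC -mulrBl -rmorphB; congr (_%:C%C * _); ring.
by rewrite normcM normc_cis mulr1 normcR.
Qed.

Lemma node_gt0 K j : (j < K)%N -> 0 < node K j.
Proof.
move=> jK; have KR : 0 < (4 * K)%:R :> R by rewrite ltr0n; lia.
have pi0 := pi_gt0 R.
apply: cos_gt0_pihalf; apply/andP; split.
  apply: (@lt_le_trans _ _ 0); first by rewrite oppr_lt0 divr_gt0.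
  by rewrite mulr_ge0 ?ler0n // divr_ge0 // ltW.
have -> : pi / 2 = (2 * K)%:R * (pi / (4 * K)%:R) :> R.
  by rewrite !natrM; field; rewrite pnatr_eq0; lia.
by rewrite ltr_pM2r ?divr_gt0 // ltr_nat; lia.
Qed.

Lemma node_le1 K j : node K j <= 1.
Proof. exact: cos_le1. Qed.

Lemma telescope_cos (x : R) m :
  2 * sin x * \sum_(j < m) cos ((2 * j + 1)%:R * x) = sin ((2 * m)%:R * x).
Proof.
elim: m => [|m IH]; first by rewrite big_ord0 mulr0 muln0 mul0r sin0.
rewrite big_ord_recr /= mulrDr IH.
have -> : (2 * m)%:R * x = (2 * m + 1)%:R * x - x by rewrite natr_odd natrM; ring.
have -> : (2 * m.+1)%:R * x = (2 * m + 1)%:R * x + x.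
  by rewrite natr_odd natrM -natr1; ring.
by rewrite sinB sinD; ring.
Qed.

(** Source of the constant 2/pi: the mean of the nodes is 1 / (2K sin(pi / 4K)). *)
Lemma sum_node K : (0 < K)%N ->
  2 * sin (pi / (4 * K)%:R) * \sum_(j < K) node K j = 1.
Proof.
move=> K0; rewrite telescope_cos.
have -> : (2 * K)%:R * (pi / (4 * K)%:R) = pi / 2 :> R.
  by rewrite !natrM; field; rewrite pnatr_eq0; lia.
exact: sin_pihalf.
Qed.

Lemma step_gt0 K : (0 < K)%N -> 0 < pi / (4 * K)%:R :> R.
Proof. by move=> K0; rewrite divr_gt0 ?pi_gt0 // ltr0n; lia. Qed.

Lemma sum_node_sqr K : (0 < K)%N -> \sum_(j < K) node K j ^+ 2 = K%:R / 2.
Proof.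
move=> K0; set h := pi / (4 * K)%:R : R.
have E j : node K j ^+ 2 = 1 / 2 + cos ((2 * j + 1)%:R * (2 * h)) / 2.
  have -> : (2 * j + 1)%:R * (2 * h) = ((2 * j + 1)%:R * h) *+ 2 by rewrite mulr2n; ring.
  by rewrite cos_mulr2n /node -/h; lra.
under eq_bigr do rewrite E.
rewrite big_split /= sumr_const card_ord -mulr_suml.
have := telescope_cos (2 * h) K.
have -> : (2 * K)%:R * (2 * h) = pi.
  by rewrite /h !natrM; field; rewrite pnatr_eq0; lia.
rewrite sinpi => /eqP; rewrite !mulf_eq0 pnatr_eq0 /= => /orP[|/eqP -> ]; last first.
  by rewrite mul0r addr0 -mulr_natr; ring.
rewrite gt_eqF //; apply: sin_gt0_pi; rewrite mulr_gt0 ?step_gt0 //=.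
have h0 : 0 < h := step_gt0 K0.
have <- : 4 * K%:R * h = pi by rewrite /h natrM; field; rewrite pnatr_eq0; lia.
have K1 : 1 <= K%:R :> R by rewrite ler1n.
nra.
Qed.

End Nodes.

(** * Moduli of the quadratic factors and their products over the nodes *)

Section Window.
Variable R : realType.
Local Notation C := R[i].

(** The variables stand for r = |S| and X = Re S. In these, [X = 0] describes the boundary of the
    half disc, and the quadratic dependence on [c] allows exact summation over the nodes. *)
Definition quad_sqr (c r X : R) : R :=
  (1 - r ^+ 2) ^+ 2 + 4 * c ^+ 2 * r ^+ 2 + 4 * c * X * (1 + r ^+ 2) + 4 * X ^+ 2.

Lemma quad_sqrE (c : R) (S : C) :
  normc (S ^+ 2 + (2 * c)%:C%C * S + 1) ^+ 2 = quad_sqr c (normc S) (Re S).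
Proof.
rewrite /quad_sqr !normc_sqr; case: S => x y /=.
by rewrite !mul0r !subr0 !addr0 expr2 /=; ring.
Qed.

Lemma quad_sqr_ge0 c r X : -1 <= c <= 1 -> X ^+ 2 <= r ^+ 2 -> 0 <= quad_sqr c r X.
Proof.
move=> c1 Xr.
have -> : quad_sqr c r X = (1 - r ^+ 2 ) ^+ 2 + 4 * c ^+ 2 * r ^+ 2 + 4 * c * X * (1 + r ^+ 2) + 4 * X ^+ 2 by [].
have -> : (1 - r ^+ 2) ^+ 2 + 4 * c ^+ 2 * r ^+ 2 + 4 * c * X * (1 + r ^+ 2) + 4 * X ^+ 2 =
  (1 - r ^+ 2 + 2 * X ^+ 2 + 2 * c * X) ^+ 2 + 4 * (r ^+ 2 - X ^+ 2) * (X + c) ^+ 2 by ring.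
have H : 0 <= r ^+ 2 - X ^+ 2 by rewrite subr_ge0.
by rewrite addr_ge0 ?sqr_ge0 // mulr_ge0 ?sqr_ge0 // mulr_ge0.
Qed.

Lemma quad_sqr_mono c r X Y : 0 <= c -> 0 <= X <= Y -> quad_sqr c r X <= quad_sqr c r Y.
Proof.
move=> c0 /andP[X0 XY]; rewrite /quad_sqr !lerD //.
  by rewrite ler_wpM2r ?addr_ge0 ?sqr_ge0 // ler_wpM2l // mulr_ge0.
by rewrite ler_wpM2l // ler_sqr ?nnegrE // (le_trans X0).
Qed.

Lemma prod_quad_sqr0 K r : (0 < K)%N ->
  \prod_(j < K) quad_sqr (node R K j) r 0 = 1 + r ^+ (4 * K).
Proof.
move=> K0.
have -> : r ^+ (4 * K) = (- r ^+ 2) ^+ (2 * K).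
  by rewrite [RHS]exprM sqrrN -!exprM; congr (_ ^+ _); lia.
rewrite [RHS]addrC -prod_node_real //; apply: eq_bigr => j _.
by rewrite /quad_sqr; ring.
Qed.

(** For c = cos a the roots of S^2 + 2cS + 1 are -e^(ia) and -e^(-ia). If |S| = r and Re S = r sin
    b, their squared distances from S are 1 + r^2 + 2r sin(b + a) and 1 + r^2 + 2r sin(b - a). Over
    all nodes these angles have step 2h, and for b = 2mh raising [m] by one only shifts the index
    [k] by one. *)
Let shifted (r h : R) (K m k : nat) : R :=
  1 + r ^+ 2 - 2 * r * sin ((2 * k%:R + 1 - 2 * K%:R - 2 * m%:R) * h).

Lemma prod_nat_fold (F : nat -> R) K :
  \prod_(0 <= k < 2 * K) F k = \prod_(j < K) (F (K - j.+1)%N * F (j + K)%N).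
Proof.
have -> : (2 * K = K + K)%N by lia.
rewrite (big_cat_nat (n := K)) //=; last by lia.
rewrite -{2}[K]add0n big_addn.
have -> : (K + K - K = K)%N by lia.
rewrite [X in X * _]big_nat_rev /= -big_split /= big_mkord.
by apply: eq_bigr => j _; rewrite add0n.
Qed.

Lemma prod_shifted K m r (h := pi / (4 * K)%:R) :
  \prod_(0 <= k < 2 * K) shifted r h K m k =
  \prod_(j < K) quad_sqr (node R K j) r (r * sin ((2 * m)%:R * h)).
Proof.
rewrite prod_nat_fold; apply: eq_bigr => j _; rewrite /shifted.
have jK := ltn_ord j.
have -> : (K - j.+1)%:R = K%:R - j%:R - 1 :> R by rewrite natrB // -natr1; ring.
have -> : (j + K)%:R = j%:R + K%:R :> R by rewrite natrD.
set b := (2 * m)%:R * h; set a := (2 * j + 1)%:R * h.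
have -> : (2 * (K%:R - j%:R - 1) + 1 - 2 * K%:R - 2 * m%:R) * h = - (a + b).
  by rewrite /a /b natr_odd natrM; ring.
have -> : (2 * (j%:R + K%:R) + 1 - 2 * K%:R - 2 * m%:R) * h = a - b.
  by rewrite /a /b natr_odd natrM; ring.
rewrite /node -/a sinN sinB sinD /quad_sqr.
have sa : sin a ^+ 2 = 1 - cos a ^+ 2 by exact: sin2cos2.
have cb : cos b ^+ 2 = 1 - sin b ^+ 2 by exact: cos2sin2.
transitivity ((1 + r ^+ 2 + 2 * r * cos a * sin b) ^+ 2 - 4 * r ^+ 2 * (sin a ^+ 2 * cos b ^+ 2)).
  by ring.
by rewrite sa cb; ring.
Qed.

Lemma prod_shifted_le K m r (h := pi / (4 * K)%:R) : (0 < K)%N -> 0 <= r < 1 ->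
  \prod_(0 <= k < 2 * K) shifted r h K m k <=
  (1 + r ^+ (4 * K)) * ((1 + r) / (1 - r)) ^+ (2 * m).
Proof.
move=> K0 /andP[r0 r1].
have lo m' k : (1 - r) ^+ 2 <= shifted r h K m' k.
  rewrite /shifted; have := sin_le1 ((2 * k%:R + 1 - 2 * K%:R - 2 * m'%:R) * h); nra.
have hi m' k : shifted r h K m' k <= (1 + r) ^+ 2.
  rewrite /shifted; have := sin_geN1 ((2 * k%:R + 1 - 2 * K%:R - 2 * m'%:R) * h); nra.
have r1' : 0 < (1 - r) ^+ 2 by rewrite exprn_gt0 // subr_gt0.
have pos m' k : 0 < shifted r h K m' k by apply: lt_le_trans (lo m' k).
elim: m => [|m IH].
  rewrite prod_shifted muln0 mul0r sin0 mulr0 prod_quad_sqr0 // expr0 mulr1 //.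
(* Raising [m] by one replaces a factor that is at least (1 - r)^2 by one that is at most (1 + r)^2
   and keeps the others. *)
have step : \prod_(0 <= k < 2 * K) shifted r h K m.+1 k =
   shifted r h K m.+1 0 / shifted r h K m (2 * K).-1 * \prod_(0 <= k < 2 * K) shifted r h K m k.
  have -> : (2 * K = (2 * K).-1.+1)%N by lia.
  rewrite big_nat_recl // [X in _ = _ * X]big_nat_recr //= -mulrA; congr (_ * _).
  rewrite mulrCA mulVf ?gt_eqF // mulr1; apply: eq_bigr => k _.
  by rewrite /shifted; congr (_ - _ * sin (_ * _)); rewrite -!natr1; ring.
rewrite step; have -> : (2 * m.+1 = 2 + 2 * m)%N by lia.
rewrite exprD mulrCA ler_pM //.
- by rewrite divr_ge0 // ltW.
- by rewrite prodr_ge0 // => k _; rewrite ltW.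
- rewrite expr_div_n ler_pdivrMr // mulrAC ler_pdivlMr //.
  by apply: ler_pM => //; rewrite ltW.
Qed.

(* With [X = r sin (2 m h)] the product is that of [1 + r^2 - 2 r sin] over a window of
   [2K] equally spaced angles shifted by [2 m] steps; the unshifted product is
   [1 + r^(4K)], and each of the [2 m] exchanged factors costs at most
   [(1 + r) / (1 - r)]. *)
Lemma prod_quad_sqr_window K m r X : (0 < K)%N -> 0 <= r < 1 ->
  0 <= X <= r * sin ((2 * m)%:R * (pi / (4 * K)%:R)) ->
  \prod_(j < K) quad_sqr (node R K j) r X <=
  (1 + r ^+ (4 * K)) * ((1 + r) / (1 - r)) ^+ (2 * m).
Proof.
move=> K0 r01 hX; apply: le_trans (prod_shifted_le m K0 r01).
rewrite prod_shifted; apply: ler_prod => j _.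
have c0 := ltW (node_gt0 R (ltn_ord j)).
move: r01 => /andP[r0 r1]; move: hX => /andP[X0 hX].
rewrite quad_sqr_mono ?X0 // andbT /quad_sqr.
have r2 : 0 <= 1 + r ^+ 2 by rewrite addr_ge0 ?sqr_ge0.
by rewrite !addr_ge0 ?sqr_ge0 // mulr_ge0 ?mulr_ge0 ?sqr_ge0.
Qed.

Lemma avg_quad_sqr K r X (cbar := (\sum_(j < K) node R K j) / K%:R) : (0 < K)%N ->
  (\sum_(j < K) quad_sqr (node R K j) r X) / K%:R =
  1 + r ^+ 4 + 4 * X ^+ 2 + 4 * cbar * X * (1 + r ^+ 2).
Proof.
move=> K0; have KR : K%:R != 0 :> R by rewrite pnatr_eq0; lia.
have -> : \sum_(j < K) quad_sqr (node R K j) r X =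
   (\sum_(j < K) ((1 - r ^+ 2) ^+ 2 + 4 * X ^+ 2)) + 4 * r ^+ 2 * (\sum_(j < K) node R K j ^+ 2)
   + 4 * X * (1 + r ^+ 2) * (\sum_(j < K) node R K j).
  rewrite !mulr_sumr -!big_split /=; apply: eq_bigr => j _; rewrite /quad_sqr; ring.
rewrite sumr_const card_ord sum_node_sqr // -mulr_natr /cbar; field; exact: KR.
Qed.

Lemma quad_sqr_node_ge0 K r X (j : 'I_K) : X ^+ 2 <= r ^+ 2 -> 0 <= quad_sqr (node R K j) r X.
Proof.
move=> Xr; apply: quad_sqr_ge0 => //.
by rewrite node_le1 andbT (le_trans _ (ltW (node_gt0 R (ltn_ord j)))).
Qed.

(** Arithmetic-geometric mean inequality. The squares of the nodes have mean exactly 1/2, so only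
    the mean of the nodes remains. The loss is small when all factors are near 1, that is for small
    [r]. *)
Lemma prod_quad_sqr_avg K r X (cbar := (\sum_(j < K) node R K j) / K%:R) :
  (0 < K)%N -> X ^+ 2 <= r ^+ 2 ->
  \prod_(j < K) quad_sqr (node R K j) r X <=
  (1 + r ^+ 4 + 4 * X ^+ 2 + 4 * cbar * X * (1 + r ^+ 2)) ^+ K.
Proof.
move=> K0 Xr; rewrite -avg_quad_sqr //.
have := @leif_AGM R 'I_K 'I_K (fun j => quad_sqr (node R K j) r X).
rewrite card_ord => -[]; first by move=> j _; exact: quad_sqr_node_ge0.
move=> + _; under eq_bigl do rewrite inE.
by under [X in _ <= (X / _) ^+ _ -> _]eq_bigl do rewrite inE.
Qed.

End Window.

(** * The comparison function on circles inside the unit disc *)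

Section CircleBound.
Variable R : realType.
Local Notation C := R[i].

Lemma le_sinh (x : R) : 0 <= x -> x <= (expR x - expR (- x)) / 2.
Proof.
move=> x0.
pose f (t : R) := expR t - expR (- t) - 2 * t.
have df (t : R) : is_derive t 1 f (expR t + expR (- t) - 2).
  apply: is_derive_eq; rewrite /GRing.scale /=; ring.
have cf : {within `[0, x], continuous f}.
  by apply: derivable_within_continuous => t _; exact: ex_derive.
have [c _] := MVT_segment x0 (fun t _ => df t) cf.
have := expR_ge1Dx c; have := expR_ge1Dx (- c).
rewrite /f oppr0 subrr mulr0 subr0 subr0 => h1 h2 E.
have : 0 <= (expR c + expR (- c) - 2) * x by rewrite mulr_ge0 //; lra.
lra.
Qed.

Lemma sin_bounds (x : R) : 0 <= x -> sin x <= x /\ x * (1 - x ^+ 2 / 2) <= sin x.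
Proof.
have csin (t : R) : {within `[0, t], continuous (@sin R)}.
  by apply: continuous_subspaceT; exact: continuous_sin.
have hle (t : R) : 0 <= t -> sin t <= t.
  move=> t0; have [c _] := MVT_segment t0 (fun y _ => is_derive_sin y) (csin t).
  by rewrite sin0 !subr0 => ->; have := cos_le1 c; nra.
have habs (t : R) : sin t ^+ 2 <= t ^+ 2.
  have [t0|t0] := leP 0 t.
    have := hle _ t0; have h1 := sin_geN1 t; have h2 := sin_le1 t.
    have [s0|s0] := leP 0 (sin t); first by nra.
    have [t1|t1] := leP t 1; last by nra.
    have : 0 <= sin t; last by lra.
    by apply: sin_ge0_pi; rewrite t0 /=; have := pi_ge2 R; lra.
  have t0' : 0 <= - t by lra.
  have := hle _ t0'; rewrite sinN; have h1 := sin_geN1 t; have h2 := sin_le1 t.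
  have [s0|s0] := leP (sin t) 0; first by nra.
  have [t1|t1] := leP (-1) t; last by nra.
  have : 0 <= sin (- t); last by rewrite sinN; lra.
  by apply: sin_ge0_pi; rewrite t0' /=; have := pi_ge2 R; lra.
have hcos (t : R) : 1 - t ^+ 2 / 2 <= cos t.
  have -> : cos t = cos ((t / 2) *+ 2) by congr cos; rewrite mulr2n; lra.
  rewrite cos_mulr2n cos2sin2; have := habs (t / 2); lra.
move=> x0; split; first exact: hle.
have [c] := MVT_segment x0 (fun y _ => is_derive_sin y) (csin x).
rewrite in_itv /= => /andP[c0 cx]; rewrite sin0 !subr0 => ->.
rewrite mulrC ler_wpM2r //; apply: le_trans (hcos c).
by nra.
Qed.

(** The left side is e^(2x) with x = artanh r, and x <= sinh x = r / sqrt(1 - r^2). *)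
Lemma ratio_le_exp (r : R) : 0 <= r < 1 ->
  ((1 + r) / (1 - r)) <= expR (2 * (r / Num.sqrt (1 - r ^+ 2))).
Proof.
move=> /andP[r0 r1]; set s := Num.sqrt _.
have s2 : s ^+ 2 = 1 - r ^+ 2 by rewrite sqr_sqrtr //; nra.
have s0 : 0 < s by rewrite sqrtr_gt0; nra.
pose x := ln ((1 + r) / s).
have w0 : 0 < (1 + r) / s by rewrite divr_gt0 //; lra.
have ex : expR x = (1 + r) / s by rewrite lnK.
have x0 : 0 <= x.
  by apply: ln_ge0; rewrite ler_pdivlMr // mul1r -(ler_sqr (x := s)) ?nnegrE; nra.
have xs : x <= r / s.
  apply: le_trans (le_sinh x0) _; rewrite expRN ex invf_div.
  have -> : (1 + r) / s - s / (1 + r) = ((1 + r) ^+ 2 - s ^+ 2) / (s * (1 + r)).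
    by field; apply/andP; split; lra.
  rewrite s2 le_eqVlt; apply/orP; left; apply/eqP; field.
  by apply/andP; split; lra.
have -> : (1 + r) / (1 - r) = expR (2 * x).
  have -> : 2 * x = x + x by ring.
  rewrite expRD ex -expr2 expr_div_n s2.
  have -> : 1 - r ^+ 2 = (1 + r) * (1 - r) by ring.
  by field; apply/andP; split; lra.
by rewrite ler_expR ler_pM2l.
Qed.

(** Here [m] is the least integer for which t = 2mh exceeds (1 + e1) X / r; the margin [e1] pays for
    passing from t to sin t. *)
Lemma prod_quad_sqr_window_exp K r X e1 h : (0 < K)%N -> h = pi / (4 * K)%:R ->
  0 < r < 1 -> 0 <= X -> 0 < e1 <= 1 ->
  ((1 + e1) * (X / r) + 2 * h) ^+ 2 <= e1 ->
  \prod_(j < K) quad_sqr (node R K j) r X <=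
  2 * expR (2 * (r / Num.sqrt (1 - r ^+ 2)) * ((1 + e1) * (X / r) / h + 2)).
Proof.
move=> K0 hE /andP[r0 r1] X0 /andP[e10 e11]; set z := X / r => ht.
have h0 : 0 < h by rewrite hE step_gt0.
have z0 : 0 <= z by rewrite divr_ge0 // ltW.
pose m := (Num.trunc ((1 + e1) * z / (2 * h))).+1.
have x0 : 0 <= (1 + e1) * z / (2 * h) by rewrite divr_ge0 // mulr_ge0 // ?addr_ge0 // ltW.
have [m1 m2] : m%:R <= (1 + e1) * z / (2 * h) + 1 /\ (1 + e1) * z / (2 * h) < m%:R.
  have /andP[a b] := truncn_itv x0; split => //.
  by rewrite /m -natr1 lerD2r.
have [t tE] : {t : R | t = (2 * m)%:R * h} by exists ((2 * m)%:R * h).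
have t1 : (1 + e1) * z <= t.
  move: m2; rewrite ltr_pdivrMr; last by rewrite mulr_gt0.
  by rewrite tE natrM; lra.
have t2 : t <= (1 + e1) * z + 2 * h.
  have : m%:R * (2 * h) <= ((1 + e1) * z / (2 * h) + 1) * (2 * h) by rewrite ler_pM2r // mulr_gt0.
  have -> : ((1 + e1) * z / (2 * h) + 1) * (2 * h) = (1 + e1) * z + 2 * h.
    by field; rewrite gt_eqF.
  by rewrite tE natrM; lra.
have t0 : 0 <= t by rewrite tE mulr_ge0 // ltW.
have tt : t ^+ 2 <= e1 by apply: le_trans ht; rewrite ler_sqr ?nnegrE //; lra.
have zs : z <= sin t.
  have [_ s] := sin_bounds t0; apply: le_trans s.
  have : (1 + e1) * z * (1 - e1 / 2) <= t * (1 - t ^+ 2 / 2).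
    have h1 : 0 <= (1 + e1) * z by rewrite mulr_ge0 // addr_ge0 // ltW.
    have h2 : 0 <= 1 - e1 / 2 by lra.
    have h3 : 1 - e1 / 2 <= 1 - t ^+ 2 / 2 by lra.
    exact: ler_pM.
  apply: le_trans.
  (* Used through (1 + e1)(1 - e1/2) = 1 + e1 (1 - e1)/2 >= 1. *)
  have h4 : 0 <= z * (e1 * (1 - e1)) by apply: mulr_ge0 => //; apply: mulr_ge0; lra.
  by lra.
have hX : 0 <= X <= r * sin t.
  by rewrite X0 /= mulrC -ler_pdivrMr.
rewrite tE hE in hX.
have r01 : 0 <= r < 1 by rewrite ltW.
apply: le_trans (prod_quad_sqr_window K0 r01 hX) _.
apply: ler_pM.
- by rewrite addr_ge0 // exprn_ge0 // ltW.
- by rewrite exprn_ge0 // divr_ge0 //; lra.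
- have : r ^+ (4 * K) <= 1 by rewrite exprn_ile1 // ltW.
  lra.
set s := r / _.
have s0 : 0 <= s by rewrite divr_ge0 ?sqrtr_ge0 // ltW.
apply: le_trans (_ : expR (2 * s) ^+ (2 * m) <= _).
  by rewrite lerXn2r ?nnegrE ?expR_ge0 ?ratio_le_exp // divr_ge0; lra.
rewrite -expRM_natr ler_expR; apply: ler_wpM2l; first exact: mulr_ge0.
rewrite natrM; have -> : (1 + e1) * z / h + 2 = 2 * ((1 + e1) * z / (2 * h) + 1).
  by field; rewrite gt_eqF.
by rewrite ler_pM2l.
Qed.

(** Divided by t^2 at a fixed ratio z = X / t, the value depends on t only through ((1 - t^2)/t)^2
    and (1 + t^2)/t, and the square of the latter is the former plus 4. A radius that is near 1 or
    above it, where the window estimate degenerates, can thus be exchanged for some [r0 < 1]. *)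
Lemma quad_sqr_rescale (c r r0 z : R) : 0 <= c -> 0 <= z -> 0 < r0 <= r ->
  `|1 - r ^+ 2| <= 1 - r0 ^+ 2 ->
  quad_sqr c r (z * r) <= (r ^+ 2 / r0 ^+ 2) * quad_sqr c r0 (z * r0).
Proof.
move=> c0 z0 /andP[r00 r0r] hD.
have rp : 0 < r by exact: lt_le_trans r0r.
pose q (t : R) := ((1 - t ^+ 2) / t) ^+ 2 + 4 * c ^+ 2 + 4 * c * z * ((1 + t ^+ 2) / t) + 4 * z ^+ 2.
have qE (t : R) : 0 < t -> quad_sqr c t (z * t) = t ^+ 2 * q t.
  by move=> t0; rewrite /q /quad_sqr; field; rewrite gt_eqF.
rewrite !qE // mulrA divfK ?expf_neq0 ?gt_eqF // ler_pM2l ?exprn_gt0 //.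
have h1 : ((1 - r ^+ 2) / r) ^+ 2 <= ((1 - r0 ^+ 2) / r0) ^+ 2.
  rewrite -[leLHS]real_normK ?num_real // normrM normfV (gtr0_norm rp).
  have d0 : 0 <= 1 - r0 ^+ 2 by apply: le_trans hD.
  rewrite ler_sqr ?nnegrE ?divr_ge0 ?normr_ge0 ?(ltW rp) ?(ltW r00) //.
  by apply: ler_pM => //; rewrite ?invr_ge0 ?(ltW rp) // lef_pV2 ?posrE.
have h2 : (1 + r ^+ 2) / r <= (1 + r0 ^+ 2) / r0.
  have e (t : R) : 0 < t -> ((1 + t ^+ 2) / t) ^+ 2 = ((1 - t ^+ 2) / t) ^+ 2 + 4.
    by move=> t0; field; rewrite gt_eqF.
  have p (t : R) : 0 < t -> 0 <= (1 + t ^+ 2) / t by move=> t0; rewrite divr_ge0 ?addr_ge0 ?sqr_ge0 // ltW.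
  by rewrite -ler_sqr ?nnegrE ?p // !e // lerD2r.
rewrite /q lerD2r lerD // ?lerD2r // ler_wpM2l // mulr_ge0 // mulr_ge0 //.
Qed.

Lemma node_avg_ge K : (0 < K)%N -> 2 / pi <= (\sum_(j < K) node R K j) / K%:R.
Proof.
move=> K0; have KR : 0 < K%:R :> R by rewrite ltr0n.
have pi0 := pi_gt0 R.
have h0 := step_gt0 R K0; set h := pi / _ in h0.
have hK : pi = 4 * K%:R * h by rewrite /h natrM; field; rewrite gt_eqF.
have := sum_node R K0; rewrite -/h; set S := \sum_(_ < _) _ => E.
have S0 : 0 <= S by apply: sumr_ge0 => j _; rewrite ltW // node_gt0.
have [s1 _] := sin_bounds (ltW h0).
have : 2 * sin h * S <= 2 * h * S by rewrite ler_wpM2r // ler_pM2l.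
rewrite E => E2; rewrite ler_pdivlMr // mulrAC ler_pdivrMr // hK.
have K2 : 0 <= 2 * K%:R :> R by rewrite mulr_ge0 // ltW.
have := ler_peMr K2 E2; lra.
Qed.

Lemma node_avg_le K : (0 < K)%N -> pi / (4 * K)%:R <= 1 / 2 :> R ->
  (\sum_(j < K) node R K j) / K%:R <= 2 / pi + (pi / (4 * K)%:R) ^+ 2.
Proof.
move=> K0; have KR : 0 < K%:R :> R by rewrite ltr0n.
have pi0 := pi_gt0 R.
have h0 := step_gt0 R K0; set h := pi / _ in h0 *.
have hK : pi = 4 * K%:R * h by rewrite /h natrM; field; rewrite gt_eqF.
have := sum_node R K0; rewrite -/h; clearbody h; set S := \sum_(_ < _) _ => E h1.
have S0 : 0 <= S by apply: sumr_ge0 => j _; rewrite ltW // node_gt0.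
have [_ s1] := sin_bounds (ltW h0).
have E1 : 2 * h * (1 - h ^+ 2 / 2) * S <= 1.
  by rewrite -[leRHS]E; apply: ler_wpM2r => //; lra.
have p0 : 0 < 1 - h ^+ 2 / 2 by nra.
have -> : S / K%:R = (2 / pi) * (2 * h * S).
  by rewrite hK; field; rewrite !gt_eqF.
have : 2 * h * S <= 1 + h ^+ 2.
  have hh : 1 <= (1 + h ^+ 2) * (1 - h ^+ 2 / 2).
    have : 0 <= h ^+ 2 * (1 - h ^+ 2) by rewrite mulr_ge0 ?sqr_ge0 //; nra.
    by lra.
  by rewrite -(ler_pM2r p0); lra.
have pi2 := pi_ge2 R.
have c1 : 2 / pi <= 1 :> R by rewrite ler_pdivrMr // mul1r.
have c0 : 0 <= 2 / pi :> R by rewrite divr_ge0 // ltW.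
move=> H; apply: (@le_trans _ _ (2 / pi * (1 + h ^+ 2))); first by rewrite ler_wpM2l.
by rewrite mulrDr mulr1 lerD2l ler_piMl ?sqr_ge0.
Qed.

End CircleBound.

Section CircleBound2.
Variable R : realType.
Local Notation C := R[i].

Lemma expR1_ge2 : 2 <= expR 1 :> R.
Proof. by have := expR_ge1Dx (1 : R). Qed.

(* [kap] plays the role of a small epsilon; [kap ^+ 4] is sinh of minus the logarithm of the radius. *)
Lemma circle_case_small (K : nat) (kap c s r : R) :
  (0 < K)%N -> 0 < kap <= 1 / 100 ->
  pi / (4 * K)%:R <= kap ^+ 8 -> 0 <= c -> c ^+ 2 + s ^+ 2 = 1 ->
  0 <= r -> r ^+ 2 = (kap ^+ 4) ^+ 2 + s ^+ 2 ->
  r ^+ 4 <= 100 * kap * kap ^+ 4 ->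
  \prod_(j < K) quad_sqr (node R K j) r (kap ^+ 4 * c) <=
  expR (4 * K%:R * kap ^+ 4 * (2 / pi + 100 * kap)).
Proof.
move=> K0 /andP[k0 k1] hh c0 cs r0 rE r4.
have pi0 := pi_gt0 R.
have c1 : c <= 1 by nra.
have h0 := step_gt0 R K0.
have kk : kap ^+ 8 <= kap.
  by rewrite exprS ler_piMr ?(ltW k0) // exprn_ile1 ?(ltW k0) //; lra.
have cl : \sum_(j < K) node R K j / K%:R <= 2 / pi + kap ^+ 2.
  rewrite -mulr_suml; apply: le_trans (node_avg_le K0 _) _; first by lra.
  by rewrite lerD2l ler_sqr ?nnegrE ?(ltW h0) ?(ltW k0) //; apply: le_trans kk.
set e := kap ^+ 4 in rE r4 *.
have e0 : 0 < e by rewrite exprn_gt0.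
have ek : e <= kap.
  by rewrite /e exprS ler_piMr ?(ltW k0) // exprn_ile1 ?(ltW k0) //; lra.
have r2 : r ^+ 2 <= kap ^+ 2.
  rewrite -ler_sqr ?nnegrE ?sqr_ge0 // -!exprM; apply: le_trans r4 _.
  by rewrite -/e ler_piMl ?(ltW e0) //; lra.
clearbody e.
have Xr : (e * c) ^+ 2 <= r ^+ 2.
  have c2 : 0 <= 1 - c ^+ 2 by have := sqr_ge0 s; lra.
  have := mulr_ge0 (sqr_ge0 e) c2; rewrite rE exprMn; have := sqr_ge0 s; lra.
apply: le_trans (prod_quad_sqr_avg K0 Xr) _.
rewrite -mulr_suml in cl; set cb := (_ / K%:R) in cl *; have cb0 : 0 <= cb.
  by rewrite divr_ge0 // sumr_ge0 // => j _; rewrite ltW // node_gt0.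
clearbody cb.
have -> : 4 * K%:R * e * (2 / pi + 100 * kap) = (4 * e * (2 / pi + 100 * kap)) * K%:R by ring.
rewrite expRM_natr lerXn2r ?nnegrE ?expR_ge0 //.
  have er := mulr_ge0 (ltW e0) c0; have r22 := sqr_ge0 r; have cbe := mulr_ge0 cb0 er.
  have := sqr_ge0 (e * c); have := mulr_ge0 cbe r22; have := exprn_ge0 4 r0; lra.
apply: le_trans (expR_ge1Dx _); rewrite -!addrA lerD2l.
have /andP[p0 p1] : 0 <= 2 / (pi : R) <= 1.
  by rewrite divr_ge0 ?(ltW pi0) //= ler_pdivrMr // mul1r pi_ge2.
have b1 : 4 * cb * (e * c) * (1 + r ^+ 2) <= 4 * (2 / pi + kap ^+ 2) * e * (1 + kap ^+ 2).
  apply: ler_pM.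
  - by rewrite !mulr_ge0 // ltW.
  - by rewrite addr_ge0 ?sqr_ge0.
  - rewrite -!mulrA ler_pM2l //; apply: ler_pM => //; first by rewrite mulr_ge0 // ltW.
    by rewrite ler_piMr // ltW.
  - by rewrite lerD2l.
have b2 : 4 * (e * c) ^+ 2 <= 4 * kap * e.
  rewrite -mulrA ler_pM2l // expr2; apply: ler_pM; rewrite ?mulr_ge0 ?(ltW e0) //.
    by apply: le_trans ek; rewrite ler_piMr // ltW.
  by rewrite ler_piMr // ltW.
have k2 : kap ^+ 2 <= kap / 100 by rewrite expr2 ler_pM2l //; lra.
have b3 : (2 / pi + kap ^+ 2) * (1 + kap ^+ 2) <= 2 / pi + kap.
  have : 2 / pi * kap ^+ 2 <= kap ^+ 2 by rewrite ler_piMl ?sqr_ge0 //; lra.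
  have : kap ^+ 2 * kap ^+ 2 <= kap ^+ 2 by rewrite ler_piMl ?sqr_ge0 //; lra.
  lra.
have b4 : 4 * (2 / pi + kap ^+ 2) * e * (1 + kap ^+ 2) <= 4 * e * (2 / pi + kap).
  have -> : 4 * (2 / pi + kap ^+ 2) * e * (1 + kap ^+ 2) = 4 * e * ((2 / pi + kap ^+ 2) * (1 + kap ^+ 2)) by ring.
  by rewrite ler_pM2l // mulr_gt0.
have : 0 <= kap * e by rewrite mulr_ge0 // ltW.
lra.
Qed.

Lemma quad_sqr_pos (c r X : R) : 0 <= c -> 0 <= X -> 0 <= quad_sqr c r X.
Proof.
move=> c0 X0; rewrite /quad_sqr; have cX := mulr_ge0 c0 X0.
have := mulr_ge0 cX (sqr_ge0 r); have := sqr_ge0 (1 - r ^+ 2).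
have := mulr_ge0 (sqr_ge0 c) (sqr_ge0 r); have := sqr_ge0 X; lra.
Qed.

Lemma step_small (K : nat) (kap : R) : (0 < K)%N -> 0 < kap ->
  100 <= K%:R * kap ^+ 8 -> pi / (4 * K)%:R <= kap ^+ 8 / 100.
Proof.
move=> K0 k0 hK; have KR : 0 < K%:R :> R by rewrite ltr0n.
have pi4 := pihalf_lt2 R; have k80 : 0 < kap ^+ 8 by rewrite exprn_gt0.
rewrite natrM ler_pdivrMr ?mulr_gt0 //; lra.
Qed.

(** Window estimate. As sqrt(1 - r^2) is close to [c], its quotient X / sqrt(1 - r^2) is about
    kap^4, and 1/h = 4K/pi turns the exponent into 4K kap^4 * 2/pi. The remaining term 4r / sqrt(1 -
    r^2) is at most 4 kap^-3, which K kap^8 >= 100 makes negligible. *)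
Lemma circle_case_mid (K : nat) (kap c s r : R) :
  (0 < K)%N -> 0 < kap <= 1 / 100 ->
  100 <= K%:R * kap ^+ 8 -> 0 <= c -> c ^+ 2 + s ^+ 2 = 1 ->
  0 <= r -> r ^+ 2 = (kap ^+ 4) ^+ 2 + s ^+ 2 ->
  100 * kap * kap ^+ 4 <= r ^+ 4 -> kap ^+ 6 <= 1 - r ^+ 2 ->
  \prod_(j < K) quad_sqr (node R K j) r (kap ^+ 4 * c) <=
  expR (4 * K%:R * kap ^+ 4 * (2 / pi + 100 * kap)).
Proof.
move=> K0 /andP[k0 k1] hK c0 cs r0 rE r4 hD.
have KR : 0 < K%:R :> R by rewrite ltr0n.
have pi0 := pi_gt0 R; have pi2 := pi_ge2 R; have pi4 := pihalf_lt2 R.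
have c1 : c <= 1 by nra.
have h0 := step_gt0 R K0.
pose h : R := pi / (4 * K)%:R.
have hE : h = pi / (4 * K)%:R by [].
have hV : h^-1 = 4 * K%:R / pi by rewrite hE invf_div natrM.
clearbody h; rewrite -hE in h0.
have k2 : kap ^+ 2 <= kap / 100 by rewrite expr2 ler_pM2l //; lra.
have k20 : 0 < kap ^+ 2 by rewrite exprn_gt0.
have k30 : 0 < kap ^+ 3 by rewrite exprn_gt0.
have k40 : 0 < kap ^+ 4 by rewrite exprn_gt0.
have k80 : 0 < kap ^+ 8 by rewrite exprn_gt0.
have hs : h <= kap ^+ 8 / 100 by rewrite hE step_small.
have k82 : kap ^+ 8 <= kap ^+ 2.
  by rewrite (_ : 8 = 2 + 6)%N // exprD ler_piMr ?(ltW k20) // exprn_ile1 ?(ltW k0) //; lra.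
have rk : kap ^+ 2 <= r.
  rewrite -ler_sqr ?nnegrE ?(ltW k20) // -ler_sqr ?nnegrE ?sqr_ge0 //.
  have -> : (r ^+ 2) ^+ 2 = r ^+ 4 by rewrite -exprM.
  have -> : ((kap ^+ 2) ^+ 2) ^+ 2 = kap ^+ 3 * kap * kap ^+ 4 by rewrite -!exprM -exprSr -exprD.
  apply: le_trans r4; rewrite ler_pM2r // ler_pM2r //.
  have : kap ^+ 3 <= 1 by rewrite exprn_ile1 ?(ltW k0) //; lra.
  lra.
have r0' : 0 < r by apply: lt_le_trans rk.
have k60 : 0 < kap ^+ 6 by rewrite exprn_gt0.
have r1 : r < 1 by nra.
pose X := kap ^+ 4 * c.
have X0 : 0 <= X by rewrite mulr_ge0 // ltW.
have Xk : X <= kap ^+ 4 by rewrite /X ler_piMr // ltW.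
have zk : X / r <= kap ^+ 2.
  rewrite ler_pdivrMr //; apply: le_trans Xk _.
  by rewrite (_ : 4 = 2 + 2)%N // exprD ler_pM2l.
have z0 : 0 <= X / r by rewrite divr_ge0.
have e1 : 0 < 25 * kap <= 1 by rewrite mulr_gt0 //=; lra.
have hw : ((1 + 25 * kap) * (X / r) + 2 * h) ^+ 2 <= 25 * kap.
  have : (1 + 25 * kap) * (X / r) <= 2 * (X / r) by rewrite ler_wpM2r //; lra.
  set y := _ * (X / r) => hy.
  have y0 : 0 <= y by rewrite mulr_ge0 //; lra.
  have : y + 2 * h <= kap by lra.
  move=> hy2; apply: (@le_trans _ _ (kap ^+ 2)); last by lra.
  by rewrite ler_sqr ?nnegrE //; lra.
have r01 : 0 < r < 1 by rewrite r0'.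
apply: le_trans (prod_quad_sqr_window_exp K0 hE r01 X0 e1 hw) _.
set S := Num.sqrt _.
have S2 : S ^+ 2 = 1 - r ^+ 2 by rewrite sqr_sqrtr //; lra.
have S0 : 0 < S by rewrite sqrtr_gt0; lra.
have Sk : kap ^+ 3 <= S.
  by rewrite -ler_sqr ?nnegrE ?(ltW S0) ?(ltW k30) // -exprM S2.
have XS : X <= kap ^+ 4 * (1 + kap ^+ 2) * S.
  rewrite /X -mulrA ler_pM2l // -ler_sqr ?nnegrE // ?mulr_ge0 ?(ltW S0) //; last by lra.
  have e6 : kap ^+ 8 = kap ^+ 2 * kap ^+ 6 by rewrite -exprD.
  have e8 : (kap ^+ 4) ^+ 2 = kap ^+ 8 by rewrite -exprM.
  have : kap ^+ 2 * kap ^+ 6 <= kap ^+ 2 * S ^+ 2 by rewrite ler_pM2l // S2.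
  rewrite exprMn sqrrD expr1n mul1r => H.
  have : 0 <= kap ^+ 2 * S ^+ 2 by rewrite mulr_ge0 ?sqr_ge0.
  have : 0 <= kap ^+ 2 ^+ 2 * S ^+ 2 by rewrite mulr_ge0 ?sqr_ge0.
  have : c ^+ 2 = S ^+ 2 + kap ^+ 8 by rewrite S2 rE e8; lra.
  lra.
apply: (@le_trans _ _ (expR 1 * expR (4 * K%:R * kap ^+ 4 * (2 / pi + 100 * kap) - 1))); last first.
  by rewrite -expRD addrC subrK.
apply: ler_pM; rewrite ?expR_ge0 ?expR1_ge2 // ler_expR.
have -> : 2 * (r / S) * ((1 + 25 * kap) * (X / r) / h + 2) =
   2 * (1 + 25 * kap) * (X / S) * h^-1 + 4 * (r / S).
  by field; rewrite ?gt_eqF //=.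
rewrite hV.
have rS : r / S <= kap ^- 3.
  by rewrite -[leRHS]mul1r; apply: ler_pM; rewrite ?invr_ge0 ?(ltW S0) ?(ltW r1) // lef_pV2 ?posrE.
have XS' : X / S <= kap ^+ 4 * (1 + kap ^+ 2) by rewrite ler_pdivrMr.
have XS0 : 0 <= X / S by rewrite divr_ge0 // ltW.
have w0 : 0 < pi^-1 :> R by rewrite invr_gt0.
have w1 : pi^-1 <= 1 / 2 :> R by rewrite mul1r lef_pV2 ?posrE.
have ek : (1 + 25 * kap) * (1 + kap ^+ 2) <= 1 + 26 * kap.
  have : kap * kap ^+ 2 <= kap ^+ 2 by rewrite ler_piMl ?(ltW k20) //; lra.
  lra.
have b1 : 2 * (1 + 25 * kap) * (X / S) * (4 * K%:R / pi) <=
    4 * K%:R * kap ^+ 4 * (2 / pi) + 26 * kap * (4 * K%:R * kap ^+ 4).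
  apply: (@le_trans _ _ (4 * K%:R * kap ^+ 4 * (2 / pi) * ((1 + 25 * kap) * (1 + kap ^+ 2)))).
    have -> : 2 * (1 + 25 * kap) * (X / S) * (4 * K%:R / pi) = (8 * (1 + 25 * kap) * K%:R / pi) * (X / S) by ring.
    have -> : 4 * K%:R * kap ^+ 4 * (2 / pi) * ((1 + 25 * kap) * (1 + kap ^+ 2)) =
      (8 * (1 + 25 * kap) * K%:R / pi) * (kap ^+ 4 * (1 + kap ^+ 2)) by ring.
    apply: ler_wpM2l => //; rewrite !mulr_ge0 ?(ltW w0) ?(ltW KR) //; lra.
  set P := 4 * K%:R * kap ^+ 4.
  have P0 : 0 <= P by rewrite !mulr_ge0 // ltW.
  apply: (@le_trans _ _ (P * (2 / pi) * (1 + 26 * kap))).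
    by apply: ler_wpM2l => //; rewrite mulr_ge0 // mulr_ge0 // ltW.
  rewrite mulrDr mulr1 lerD2l.
  have : P * (26 * kap) * (2 / pi) <= P * (26 * kap) * 1.
    by apply: ler_wpM2l; [rewrite mulr_ge0 // mulr_ge0 // ltW|lra].
  lra.
have b2 : 100 * kap ^- 3 <= K%:R * kap ^+ 4 * kap.
  rewrite ler_pdivrMr //.
  have -> : K%:R * kap ^+ 4 * kap * kap ^+ 3 = K%:R * kap ^+ 8 by ring.
  by [].
have b3 : 1 <= kap ^- 3.
  rewrite invf_ge1 // exprn_ile1 ?(ltW k0) //; lra.
lra.
Qed.

(** Near the imaginary axis [r] is close to 1 and may exceed it. The window estimate is applied at a
    radius [r1] with 1 - r1^2 = kap^4/4 and carried over by [quad_sqr_rescale]. The loss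
    (r^2/r1^2)^K <= exp(K kap^4) is affordable because the target exponent is at least 2K kap^4. *)
Lemma circle_case_edge (K : nat) (kap c s r : R) :
  (0 < K)%N -> 0 < kap <= 1 / 100 ->
  100 <= K%:R * kap ^+ 8 -> 0 <= c -> c ^+ 2 + s ^+ 2 = 1 ->
  0 <= r -> r ^+ 2 = (kap ^+ 4) ^+ 2 + s ^+ 2 -> 1 - r ^+ 2 <= kap ^+ 6 ->
  \prod_(j < K) quad_sqr (node R K j) r (kap ^+ 4 * c) <=
  expR (4 * K%:R * kap ^+ 4 * (2 / pi + 100 * kap)).
Proof.
move=> K0 /andP[k0 k1] hK c0 cs r0 rE hD.
have KR : 0 < K%:R :> R by rewrite ltr0n.
have pi0 := pi_gt0 R; have pi2 := pi_ge2 R; have pi4 := pihalf_lt2 R.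
have h0 := step_gt0 R K0.
have [h hE] : {h : R | h = pi / (4 * K)%:R} by exists (pi / (4 * K)%:R).
have hV : h^-1 = 4 * K%:R / pi by rewrite hE invf_div natrM.
rewrite -hE in h0.
have k2 : kap ^+ 2 <= kap / 100 by rewrite expr2 ler_pM2l //; lra.
have k20 : 0 < kap ^+ 2 by rewrite exprn_gt0.
have k40 : 0 < kap ^+ 4 by rewrite exprn_gt0.
have k60 : 0 < kap ^+ 6 by rewrite exprn_gt0.
have k80 : 0 < kap ^+ 8 by rewrite exprn_gt0.
have E4 : kap ^+ 4 = kap ^+ 2 * kap ^+ 2 by rewrite -exprD.
have E6 : kap ^+ 6 = kap ^+ 2 * kap ^+ 4 by rewrite -exprD.
have E8 : (kap ^+ 4) ^+ 2 = kap ^+ 8 by rewrite -exprM.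
have E8' : kap ^+ 8 = kap ^+ 2 * kap ^+ 6 by rewrite -exprD.
have l1 : kap ^+ 2 <= 1 / 10000 by clear -k2 k1; lra.
have l4 : kap ^+ 4 <= kap ^+ 2 / 10000 by rewrite E4 ler_pM2l //; clear -l1; lra.
have l6 : kap ^+ 6 <= kap ^+ 4 / 10000 by rewrite E6 mulrC ler_pM2l //; clear -l1; lra.
have l8 : kap ^+ 8 <= kap ^+ 6 / 10000 by rewrite E8' mulrC ler_pM2l //; clear -l1; lra.
have hs : h <= kap ^+ 8 / 100 by rewrite hE step_small.
have s1 : 0 <= s ^+ 2 by exact: sqr_ge0.
have cr : (kap ^+ 4 * c) ^+ 2 <= r ^+ 2.
  have cE : c ^+ 2 = 1 - s ^+ 2 by clear -cs; lra.
  have := mulr_ge0 (sqr_ge0 (kap ^+ 4)) s1 => H.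
  by rewrite [leLHS]exprMn rE cE; clear -s1 H; lra.
have r2 : 1 / 2 <= r ^+ 2 by clear -hD l6 l4 l1; lra.
have r2' : r ^+ 2 <= 1 + kap ^+ 8 by have := sqr_ge0 c; clear -rE cs E8; lra.
have r0' : 0 < r by rewrite lt_def r0 andbT; apply/eqP => E; move: r2; rewrite E expr0n /=; clear; lra.
have [r1 [r10 r1E]] : exists r1 : R, 0 < r1 /\ r1 ^+ 2 = 1 - kap ^+ 4 / 4.
  exists (Num.sqrt (1 - kap ^+ 4 / 4)); rewrite sqrtr_gt0 sqr_sqrtr; [split => //|]; clear -l1 l4; lra.
have r1r : r1 <= r by rewrite -ler_sqr ?nnegrE ?(ltW r10) // r1E; clear -hD l6 k40; lra.
have r11 : r1 < 1 by rewrite -ltr_sqr ?nnegrE ?(ltW r10) // r1E expr1n; clear -k40; lra.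
have S2E : Num.sqrt (1 - r1 ^+ 2) = kap ^+ 2 / 2.
  by rewrite r1E (_ : _ - _ = (kap ^+ 2 / 2) ^+ 2) ?sqrtr_sqr ?ger0_norm ?divr_ge0 ?(ltW k20) //; rewrite expr_div_n -exprM; clear; lra.
pose z := kap ^+ 4 * c / r.
have z0 : 0 <= z by rewrite divr_ge0 // mulr_ge0 // ltW.
have zE : kap ^+ 4 * c = z * r by rewrite divfK // gt_eqF.
have zs : z <= 2 * kap ^+ 7.
  have k70 : 0 < kap ^+ 7 by rewrite exprn_gt0.
  rewrite -ler_sqr ?nnegrE //; last by rewrite mulr_ge0 // ltW.
  rewrite /z expr_div_n ler_pdivrMr ?exprn_gt0 // exprMn.
  have -> : (2 * kap ^+ 7) ^+ 2 * r ^+ 2 = (kap ^+ 4) ^+ 2 * (4 * kap ^+ 6 * r ^+ 2).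
    by ring.
  rewrite ler_pM2l ?exprn_gt0 //.
  have : kap ^+ 6 * (1 / 2) <= kap ^+ 6 * r ^+ 2 by rewrite ler_pM2l.
  clear -cs rE E8 hD l8 k60; lra.
clearbody z.
have hw : ((1 + 1) * (z * r1 / r1) + 2 * h) ^+ 2 <= 1.
  rewrite mulfK ?gt_eqF //.
  have k7 : kap ^+ 7 <= 1 / 100.
    rewrite exprS; have : kap * kap ^+ 6 <= 1 / 100 * 1.
      by apply: ler_pM; rewrite ?(ltW k0) ?(ltW k60) // exprn_ile1 ?(ltW k0) //; clear -k1; lra.
    by rewrite mulr1.
  have h1 : h <= 1 / 100.
    apply: le_trans hs _; rewrite ler_pM2r //; rewrite exprn_ile1 ?(ltW k0) //; clear -k1; lra.
  by rewrite -(expr1n _ 2) ler_sqr ?nnegrE; clear -k7 zs z0 h0 h1; lra.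
have r11' : 0 < r1 < 1 by rewrite r10.
have X0 : 0 <= z * r1 by rewrite mulr_ge0 // ltW.
have o1 : 0 < (1 : R) <= 1 by rewrite ltr01 lexx.
have := prod_quad_sqr_window_exp K0 hE r11' X0 o1 hw.
rewrite S2E mulfK ?gt_eqF // => W.
apply: (@le_trans _ _ ((r ^+ 2 / r1 ^+ 2) ^+ K * \prod_(j < K) quad_sqr (node R K j) r1 (z * r1))).
  have -> : (r ^+ 2 / r1 ^+ 2) ^+ K = \prod_(j < K) (r ^+ 2 / r1 ^+ 2) by rewrite prodr_const card_ord.
  rewrite -big_split /=.
  apply: ler_prod => j _; have cj := ltW (node_gt0 R (ltn_ord j)).
  rewrite zE; apply/andP; split; last first.
    apply: quad_sqr_rescale => //; first by rewrite r10.
    by rewrite r1E ler_norml; apply/andP; split; clear -r2' hD l8 l6 k40 k60; lra.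
  apply: quad_sqr_ge0; first by rewrite node_le1 andbT (le_trans _ cj).
  by rewrite -zE.
have rr : (r ^+ 2 / r1 ^+ 2) ^+ K <= expR (K%:R * kap ^+ 4).
  rewrite expRM_natl lerXn2r ?nnegrE ?expR_ge0 ?divr_ge0 ?sqr_ge0 //.
  apply: le_trans (expR_ge1Dx _); rewrite ler_pdivrMr ?exprn_gt0 // r1E.
  have : kap ^+ 4 * kap ^+ 4 <= kap ^+ 4 / 10000.
    by rewrite ler_pM2l //; clear -l4 l1; lra.
  clear -r2' k40 l8 l6; lra.
apply: (@le_trans _ _ (expR (K%:R * kap ^+ 4) * (expR 1 * expR (4 * K%:R * kap ^+ 4 * (2 / pi + 100 * kap) - 1 - K%:R * kap ^+ 4)))); last first.
  by rewrite -!expRD ler_expR; set u := K%:R * _; set v := 4 * _ * _; clear; lra.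
apply: ler_pM => //.
- by rewrite exprn_ge0 // divr_ge0 ?sqr_ge0.
- apply: prodr_ge0 => j _; have cj := ltW (node_gt0 R (ltn_ord j)).
  exact: quad_sqr_pos.
apply: le_trans W _; apply: ler_pM; rewrite ?expR_ge0 ?expR1_ge2 // ler_expR.
have w0 : 0 < pi^-1 :> R by rewrite invr_gt0.
have w1 : pi^-1 <= 1 / 2 :> R by rewrite mul1r lef_pV2 ?posrE.
have w2 : 1 / 4 <= pi^-1 :> R by rewrite mul1r lef_pV2 ?posrE //; clear -pi4; lra.
rewrite hV.
have a1 : r1 / (kap ^+ 2 / 2) <= 2 * kap ^- 2.
  by rewrite invf_div mulrA ler_pM2r ?invr_gt0 //; clear -r11; lra.
have a2 : (1 + 1) * z * (4 * K%:R / pi) + 2 <= 8 * kap ^+ 7 * K%:R + 2.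
  rewrite lerD2r; apply: (@le_trans _ _ ((1 + 1) * z * (4 * K%:R / 2))); last first.
    have : z * K%:R <= 2 * kap ^+ 7 * K%:R by rewrite ler_pM2r.
    clear; lra.
  by rewrite ler_wpM2l ?mulr_ge0 // ler_pM2l ?mulr_gt0 //; clear -w1; lra.
have a3 : 2 * (r1 / (kap ^+ 2 / 2)) * ((1 + 1) * z * (4 * K%:R / pi) + 2) <=
   (4 * kap ^- 2) * (8 * kap ^+ 7 * K%:R + 2).
  apply: ler_pM => //; last by (clear -a1; lra).
    by rewrite mulr_ge0 // divr_ge0 ?(ltW r10) // divr_ge0 // ltW.
  by rewrite addr_ge0 // !mulr_ge0 // ltW.
apply: le_trans a3 _.
have -> : 4 * kap ^- 2 * (8 * kap ^+ 7 * K%:R + 2) = 32 * (kap ^+ 5 * K%:R) + 8 * kap ^- 2.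
  by field; rewrite gt_eqF.
have b1 : kap ^+ 5 * K%:R <= K%:R * kap ^+ 4 / 100.
  rewrite exprS; have : kap * (kap ^+ 4 * K%:R) <= 1 / 100 * (kap ^+ 4 * K%:R) by rewrite ler_pM2r ?mulr_gt0.
  clear; lra.
have b2 : 100 * kap ^- 2 <= K%:R * kap ^+ 4.
  rewrite ler_pdivrMr //.
  apply: (le_trans hK); rewrite -mulrA ler_pM2l // -exprD; rewrite (_ : 8 = 2 + (4 + 2))%N // exprD ler_piMl //; last by (clear -l1; lra).
  by rewrite ltW // exprn_gt0.
have b3 : 1 <= kap ^- 2 by rewrite invf_ge1 //; clear -l1; lra.
have b4 : 4 * K%:R * kap ^+ 4 * (1 / 2) <= 4 * K%:R * kap ^+ 4 * (2 / pi + 100 * kap).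
  by apply: ler_wpM2l; [rewrite !mulr_ge0 // ltW|clear -w2 k0; lra].
clear -b1 b2 b3 b4; lra.
Qed.

End CircleBound2.

(** * The product of quartic forms: values on the boundary of the half disc and on circles *)

Section NPoly.
Variable R : realType.
Local Notation C := R[i].
Local Notation pC p := (map_poly (real_complex R) p).

Definition qfactor (c : R) : {poly R} :=
  (1 + 'X ^+ 2) ^+ 2 + (4 * c) *: ('X * (1 - 'X ^+ 2)).

Definition nodepoly (K : nat) : {poly R} := \prod_(j < K) qfactor (node R K j).

(* [S = joukowski y] turns [qfactor c] into [4 y^2 (S^2 + 2 c S + 1)]. *)
Definition joukowski (y : C) : C := (1 - y ^+ 2) / (2 * y).

Lemma qfactor_eval c (y : C) :
  (pC (qfactor c)).[y] = (1 + y ^+ 2) ^+ 2 + (4 * c)%:C%C * (y * (1 - y ^+ 2)).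
Proof.
rewrite /qfactor; move: (4 * c) => d.
by rewrite rmorphD /= rmorphXn /= rmorphD /= rmorph1 map_polyXn map_polyZ /= rmorphM /=
  rmorphB /= rmorph1 map_polyXn map_polyX !hornerE.
Qed.

Lemma nodepoly_eval K (y : C) :
  (pC (nodepoly K)).[y] = \prod_(j < K) (pC (qfactor (node R K j))).[y].
Proof. by rewrite rmorph_prod horner_prod. Qed.

Lemma qfactor_joukowski c (y : C) : y != 0 ->
  (pC (qfactor c)).[y] =
  4 * y ^+ 2 * (joukowski y ^+ 2 + (2 * c)%:C%C * joukowski y + 1).
Proof.
move=> y0; rewrite qfactor_eval /joukowski.
have -> : (4 * c)%:C%C = 2 * (2 * c)%:C%C :> C.
  by rewrite -[2 in RHS](rmorph_nat (real_complex R) 2) -rmorphM; congr (_%:C)%C; ring.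
by field.
Qed.

Lemma normc_nat n : normc (n%:R : C) = n%:R.
Proof. by rewrite -(rmorph_nat (real_complex R) n) normcR normr_nat. Qed.

Lemma normc_nodepoly K (y : C) : y != 0 ->
  normc (pC (nodepoly K)).[y] ^+ 2 =
  (4 * normc y ^+ 2) ^+ (2 * K) *
  \prod_(j < K) quad_sqr (node R K j) (normc (joukowski y)) (Re (joukowski y)).
Proof.
move=> y0; rewrite nodepoly_eval normc_prod -prodrXl exprM.
have -> : ((4 * normc y ^+ 2) ^+ 2) ^+ K = \prod_(j < K) ((4 * normc y ^+ 2) ^+ 2).
  by rewrite prodr_const card_ord.
rewrite -big_split /=; apply: eq_bigr => j _.
by rewrite qfactor_joukowski // normcM normcM normcX normc_nat exprMn quad_sqrE.
Qed.

Lemma joukowskiE (a b : R) (m := a ^+ 2 + b ^+ 2) : m != 0 ->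
  joukowski (a +i* b)%C = ((a * (1 - m) / (2 * m)) +i* (- (b * (1 + m) / (2 * m))))%C.
Proof.
move=> m0; apply: (@mulIf _ (2 * (a +i* b)%C)).
  rewrite mulf_neq0 ?pnatr_eq0 // eq_complex /= negb_and.
  have [a0|//] := eqVneq a 0; have [b0|//] := eqVneq b 0.
  by move: m0; rewrite /m a0 b0 expr0n /= addr0 eqxx.
rewrite divfK; last first.
  rewrite mulf_neq0 ?pnatr_eq0 // eq_complex /= negb_and.
  have [a0|//] := eqVneq a 0; have [b0|//] := eqVneq b 0.
  by move: m0; rewrite /m a0 b0 expr0n /= addr0 eqxx.
have -> : (2 : C) = (2%:C)%C by rewrite -(rmorph_nat (real_complex R) 2).
rewrite expr2; apply/eqP; rewrite eq_complex /= /m; apply/andP; split; apply/eqP.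
  by field.
by field.
Qed.

Lemma joukowski_sqr (a b : R) (m := a ^+ 2 + b ^+ 2) : m != 0 ->
  normc (joukowski (a +i* b)%C) ^+ 2 =
  ((1 - m) ^+ 2 * a ^+ 2 + (1 + m) ^+ 2 * b ^+ 2) / (4 * m ^+ 2).
Proof. by move=> m0; rewrite joukowskiE // normc_sqr /= -/m; field. Qed.

Lemma normc_sqrE (a b : R) : normc (a +i* b)%C ^+ 2 = a ^+ 2 + b ^+ 2.
Proof. by rewrite normc_sqr. Qed.

(** On the arc, and on the segment treated next, [joukowski y] is purely imaginary, so
    [prod_quad_sqr0] evaluates the product over the nodes exactly; one of its two terms gives the
    bound. *)
Lemma nodepoly_arc K (a b : R) : (0 < K)%N -> a ^+ 2 + b ^+ 2 = 1 ->
  16 ^+ K <= normc (pC (nodepoly K)).[(a +i* b)%C] ^+ 2.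
Proof.
move=> K0 ab.
have m0 : a ^+ 2 + b ^+ 2 != 0 by rewrite ab oner_eq0.
have y0 : (a +i* b)%C != 0 :> C by rewrite -normc_eq0 -sqrf_eq0 normc_sqrE.
rewrite normc_nodepoly // normc_sqrE ab mulr1 joukowskiE // ab subrr mulr0 mul0r prod_quad_sqr0 //.
have -> : (4 : R) ^+ (2 * K) = 16 ^+ K by rewrite exprM; congr (_ ^+ K); ring.
by rewrite ler_peMr ?exprn_ge0 // lerDl exprn_even_ge0 // oddM.
Qed.

Lemma nodepoly_segment K (t : R) : (0 < K)%N ->
  (1 + t ^+ 2) ^+ (4 * K) <= normc (pC (nodepoly K)).[(0 +i* t)%C] ^+ 2.
Proof.
move=> K0; have [->|t0] := eqVneq t 0.
  rewrite expr0n /= addr0 expr1n nodepoly_eval big1 ?(Normc.normc1 R) ?expr1n // => j _.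
  rewrite qfactor_eval; have -> : (0 +i* 0)%C = 0 :> C by [].
  by rewrite expr0n /= addr0 mul0r mulr0 addr0 expr1n.
have m0 : 0 ^+ 2 + t ^+ 2 != 0 by rewrite expr0n add0r sqrf_eq0.
have y0 : (0 +i* t)%C != 0 :> C by rewrite -normc_eq0 -sqrf_eq0 normc_sqrE.
rewrite normc_nodepoly // normc_sqrE.
have -> : Re (joukowski (0 +i* t)%C) = 0 by rewrite joukowskiE // !mul0r.
rewrite prod_quad_sqr0 //.
have -> : normc (joukowski (0 +i* t)%C) ^+ (4 * K) = ((1 + t ^+ 2) ^+ 2 / (4 * t ^+ 2)) ^+ (2 * K).
  have -> : (4 * K = 2 * (2 * K))%N by lia.
  by rewrite [LHS]exprM joukowski_sqr //; congr (_ ^+ _); rewrite expr0n !add0r mulr0 add0r; field.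
rewrite mulrDr mulr1 -exprMn !expr0n !add0r.
have -> : 4 * t ^+ 2 * ((1 + t ^+ 2) ^+ 2 / (4 * t ^+ 2)) = (1 + t ^+ 2) ^+ 2 by field.
rewrite -exprM; have -> : (2 * (2 * K) = 4 * K)%N by lia.
by rewrite lerDr exprn_ge0 // mulr_ge0 // sqr_ge0.
Qed.

(** The half disc is mapped to Re S >= 0, whereas the roots of S^2 + 2cS + 1 for a node c > 0 have
    negative real part. The centre, a pole of the map, is handled by [nodepoly_segment]. *)
Lemma nodepoly_neq0 K (a b : R) : (0 < K)%N -> 0 <= a -> a ^+ 2 + b ^+ 2 <= 1 ->
  (pC (nodepoly K)).[(a +i* b)%C] != 0.
Proof.
move=> K0 a0 ab.
have [/eqP|m0] := eqVneq (a ^+ 2 + b ^+ 2) 0.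
  rewrite paddr_eq0 ?sqr_ge0 // !sqrf_eq0 => /andP[/eqP -> /eqP ->].
  rewrite -normc_eq0 -sqrf_eq0 gt_eqF //; apply: lt_le_trans (nodepoly_segment 0 K0).
  by rewrite expr0n /= addr0 expr1n.
have mp : 0 < a ^+ 2 + b ^+ 2 by rewrite lt_def m0 addr_ge0 ?sqr_ge0.
have y0 : (a +i* b)%C != 0 :> C by rewrite -normc_eq0 -sqrf_eq0 normc_sqrE.
rewrite -normc_eq0 -sqrf_eq0 normc_nodepoly //.
set S := joukowski _.
have S0 : 0 <= Re S.
  by rewrite /S joukowskiE //= divr_ge0 ?mulr_ge0 ?subr_ge0 // ltW.
apply: mulf_neq0; first by rewrite expf_neq0 // mulf_neq0 ?pnatr_eq0 // expf_neq0 // normc_eq0.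
rewrite gt_eqF //; apply: prodr_gt0 => j _; have cj := node_gt0 R (ltn_ord j).
rewrite /quad_sqr; have r0 := normc_ge0 S.
have h1 := mulr_ge0 (mulr_ge0 (ltW cj) S0) (sqr_ge0 (normc S)).
have h2 := mulr_ge0 (ltW cj) S0; have h3 := sqr_ge0 (Re S).
have h4 : 0 < (1 - normc S ^+ 2) ^+ 2 + 4 * node R K j ^+ 2 * normc S ^+ 2.
  have [E|NE] := eqVneq (normc S ^+ 2) 1.
    by rewrite E mulr1 subrr expr0n add0r mulr_gt0 // exprn_gt0.
  apply: ltr_pwDl; last by rewrite !mulr_ge0 ?sqr_ge0 // ltW.
  by rewrite lt_def sqr_ge0 andbT sqrf_eq0 subr_eq0 eq_sym.
lra.
Qed.

Lemma nodepoly_circle_normc K (a b rho : R) (e := (rho^-1 - rho) / 2) : (0 < K)%N ->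
  0 < rho -> a ^+ 2 + b ^+ 2 = rho ^+ 2 ->
  normc (pC (nodepoly K)).[(a +i* b)%C] ^+ 2 =
  (4 * rho ^+ 2) ^+ (2 * K) *
  \prod_(j < K) quad_sqr (node R K j) (Num.sqrt (e ^+ 2 + (b / rho) ^+ 2)) (e * (a / rho)).
Proof.
move=> K0 r0 ab.
have m0 : a ^+ 2 + b ^+ 2 != 0 by rewrite ab expf_neq0 // gt_eqF.
have y0 : (a +i* b)%C != 0 :> C by rewrite -normc_eq0 -sqrf_eq0 normc_sqrE.
rewrite normc_nodepoly // normc_sqrE ab.
have -> : Num.sqrt (e ^+ 2 + (b / rho) ^+ 2) = normc (joukowski (a +i* b)%C).
  rewrite -[RHS]ger0_norm ?normc_ge0 // -sqrtr_sqr joukowski_sqr // ab; congr Num.sqrt.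
  have -> : a ^+ 2 = rho ^+ 2 - b ^+ 2 by rewrite -ab addrK.
  by rewrite /e; field; rewrite gt_eqF.
have -> : Re (joukowski (a +i* b)%C) = e * (a / rho).
  by rewrite joukowskiE //= ab /e; field; rewrite gt_eqF.
by [].
Qed.

End NPoly.

Section QCircle.
Variable R : realType.
Local Notation C := R[i].
Local Notation pC p := (map_poly (real_complex R) p).

Lemma circle_case (K : nat) (kap c s r : R) :
  (0 < K)%N -> 0 < kap <= 1 / 100 ->
  100 <= K%:R * kap ^+ 8 -> 0 <= c -> c ^+ 2 + s ^+ 2 = 1 ->
  0 <= r -> r ^+ 2 = (kap ^+ 4) ^+ 2 + s ^+ 2 ->
  \prod_(j < K) quad_sqr (node R K j) r (kap ^+ 4 * c) <=
  expR (4 * K%:R * kap ^+ 4 * (2 / pi + 100 * kap)).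
Proof.
move=> K0 k01 hK c0 cs r0 rE.
have [r4|/ltW r4] := leP (r ^+ 4) (100 * kap * kap ^+ 4).
  apply: (circle_case_small (s := s)) => //.
  have/andP[k0 _] := k01.
  apply: le_trans (step_small K0 k0 hK) _; rewrite ler_pdivrMr // ler_peMr ?exprn_ge0 ?(ltW k0) //.
  lra.
have [hD|/ltW hD] := leP (1 - r ^+ 2) (kap ^+ 6).
  exact: (circle_case_edge (s := s)).
exact: (circle_case_mid (s := s)).
Qed.

Lemma sinh_inverse (e : R) : 0 < e ->
  exists2 lam, 0 < lam /\ e <= lam * (1 + e) &
    (expR lam - expR (- lam)) / 2 = e.
Proof.
move=> e0; have q0 : 0 <= 1 + e ^+ 2 by rewrite addr_ge0 // sqr_ge0.
have [q [q1 qE]] : {q : R | 1 <= q /\ q ^+ 2 = 1 + e ^+ 2}.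
  exists (Num.sqrt (1 + e ^+ 2)); rewrite sqr_sqrtr //; split => //.
  by rewrite -[leLHS]sqrtr1 ler_wsqrtr // lerDl sqr_ge0.
have w0 : 0 < e + q by lra.
exists (ln (e + q)); last first.
  rewrite expRN lnK ?posrE //.
  have -> : (e + q)^-1 = q - e.
    apply: (mulfI (lt0r_neq0 w0)); rewrite mulfV ?lt0r_neq0 //; lra.
  lra.
have h1 : 0 < 1 + e by lra.
have l1 : ln (1 + e) <= ln (e + q) by rewrite ler_ln ?posrE //; lra.
have l2 : e <= ln (1 + e) * (1 + e).
  have iv : (1 + e)^-1 = 1 + ((1 + e)^-1 - 1) by ring.
  have := @le_ln1Dx R ((1 + e)^-1 - 1); rewrite -iv lnV ?posrE // => h.
  have {}h : - ln (1 + e) <= (1 + e)^-1 - 1.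
    by apply: h; rewrite ltrBrDl subrr invr_gt0.
  have := ler_wpM2r (ltW h1) h; rewrite mulrBl mulVf ?lt0r_neq0 // mul1r; lra.
have l3 : ln (1 + e) * (1 + e) <= ln (e + q) * (1 + e) by rewrite ler_wpM2r // ltW.
split; last lra.
by rewrite ln_gt0 //; lra.
Qed.

(** With rho = e^(-lam) the squared modulus is 16^K rho^(4K) times the product over the nodes: the
    power of rho gives the 1/2, and the product, at most about exp(4K lam * 2/pi), gives the
    -1/pi. *)
Lemma nodepoly_circle (eps : R) : 0 < eps ->
  exists2 K, (0 < K)%N & exists2 lam : R, 0 < lam & forall a b : R,
    0 <= a -> a ^+ 2 + b ^+ 2 = expR (- lam) ^+ 2 ->
    normc (pC (nodepoly R K)).[(a +i* b)%C] <=
      4 ^+ K * expR (- (4 * K%:R * lam * (1 / 2 - 1 / pi - eps))).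
Proof.
move=> eps0.
(* The 51 comes from (1 + kap^4)(2/pi + 100 kap) <= 2/pi + 102 kap <= 2/pi + 2 eps. *)
have [kap [k0 k1 ke]] : exists kap : R, [/\ 0 < kap, kap <= 1 / 100 & kap <= eps / 51].
  exists (Num.min (1 / 100) (eps / 51)); split; rewrite ?ge_min ?lexx ?orbT //.
  by rewrite lt_min !divr_gt0.
have k80 : 0 < kap ^+ 8 by rewrite exprn_gt0.
have [K hK] : exists K : nat, 100 <= K%:R * kap ^+ 8.
  exists (Num.truncn (100 / kap ^+ 8)).+1; rewrite -ler_pdivrMr //.
  by apply: ltW; apply: truncnS_gt.
have K0 : (0 < K)%N by case: K hK => //; rewrite mul0r; lra.
have e0 : 0 < kap ^+ 4 by rewrite exprn_gt0.
have [lam [l0 el] se] := sinh_inverse e0.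
exists K => //; exists lam => // a b a0 ab.
set rho := expR (- lam) in ab; have r0 : 0 < rho by rewrite expR_gt0.
have eE : (rho^-1 - rho) / 2 = kap ^+ 4 by rewrite -se /rho expRN invrK.
rewrite -ler_sqr ?nnegrE ?normc_ge0 ?mulr_ge0 ?exprn_ge0 ?expR_ge0 //.
rewrite (nodepoly_circle_normc K0 r0 ab) eE.
have cs : (a / rho) ^+ 2 + (b / rho) ^+ 2 = 1.
  by rewrite !expr_div_n -mulrDl ab divff // expf_neq0 // gt_eqF.
have key : \prod_(j < K) quad_sqr (node R K j)
    (Num.sqrt ((kap ^+ 4) ^+ 2 + (b / rho) ^+ 2)) (kap ^+ 4 * (a / rho)) <=
    expR (4 * K%:R * kap ^+ 4 * (2 / pi + 100 * kap)).
  apply: (circle_case (s := b / rho)); rewrite ?k0 ?sqrtr_ge0 ?divr_ge0 ?(ltW r0) //.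
  by rewrite sqr_sqrtr // addr_ge0 // sqr_ge0.
apply: le_trans (ler_wpM2l _ key) _.
  by rewrite exprn_ge0 // mulr_ge0 // sqr_ge0.
have -> : (4 * rho ^+ 2) ^+ (2 * K) = (4 ^+ K) ^+ 2 * expR (- (4 * K%:R * lam)).
  rewrite (exprMn (2 * K) 4) -!exprM (mulnC K) /rho -expRM_natl; congr (_ * expR _).
  by rewrite !natrM; ring.
rewrite [X in _ <= X]exprMn -[X in X <= _]mulrA ler_wpM2l ?exprn_ge0 //.
rewrite -[(expR _) ^+ 2]expRM_natl -expRD ler_expR.
have p2 : 2 / pi <= 1 :> R by rewrite ler_pdivrMr ?pi_gt0 // mul1r pi_ge2.
have p0 : 0 < 2 / pi :> R by rewrite divr_gt0 ?pi_gt0.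
have -> : 1 / pi = 2 / pi / 2 :> R by rewrite mulrAC divff // pnatr_eq0.
move: (2 / pi) p2 p0 => P p2 p0.
have KR : 0 < K%:R :> R by rewrite ltr0n.
have k4 : kap ^+ 4 <= kap by apply: ler_iXnr; rewrite ?(ltW k0) //; lra.
have h1 : kap ^+ 4 * (P + 100 * kap) <= lam * (P + 2 * eps).
  have := ler_wpM2r (_ : 0 <= P + 100 * kap) el => /(_ _) h.
  have {}h : kap ^+ 4 * (P + 100 * kap) <= lam * (1 + kap ^+ 4) * (P + 100 * kap) by apply: h; lra.
  apply: le_trans h _; rewrite -mulrA ler_wpM2l // ?(ltW l0) //.
  have : kap ^+ 4 * (P + 100 * kap) <= kap * 2 by apply: ler_pM; rewrite ?(ltW e0) //; lra.
  lra.
have := ler_wpM2l (ltW KR) h1; move: (K%:R : R) (kap ^+ 4) => k e.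
lra.
Qed.

End QCircle.

(** * The transform on generating polynomials *)

Section Transform.
Variable R : realType.

(* Both sides are the coefficient of [x^k z^i] in the symmetric polynomial [(1 + x + z - x z)^n]. *)
Lemma krawtchoukC n (i k : nat) : (i <= n)%N -> (k <= n)%N ->
  'C(n, k)%:R * krawtchouk R n i k = 'C(n, i)%:R * krawtchouk R n k i.
Proof.
pose B : {poly {poly R}} := ((1 + 'X)%:P + (1 - 'X)%:P * 'X) ^+ n.
have cB (a b : nat) : (a <= n)%N -> (b <= n)%N ->
    B`_a`_b = 'C(n, a)%:R * krawtchouk R n b a.
  move=> an bn; rewrite /B exprDn coef_sum (bigD1 (Ordinal (an : (a < n.+1)%N))) //=.
  rewrite big1 ?addr0; last first.
    move=> j /eqP nj; rewrite exprMn -!rmorphXn /= mulrA -rmorphM coefMn coefCM coefXn.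
    case: eqP => [E|_]; last by rewrite mulr0 mul0rn.
    by case: nj; apply: val_inj.
  rewrite exprMn -!rmorphXn /= mulrA -rmorphM coefMn coefCM coefXn eqxx mulr1.
  by rewrite coefMn mulr_natl.
move=> hi hk; rewrite -cB // -cB //.
have sB : swapXY B = B.
  rewrite /B rmorphXn; congr (_ ^+ n).
  rewrite rmorphD rmorphM /= !swapXY_polyC swapXY_X !rmorphD !rmorphN /= !rmorph1 !map_polyX /=.
  ring.
by rewrite -{1}sB coef_swapXY.
Qed.

(* [P^n p(Q / P)], with [p] regarded as a form of degree [n]. *)
Definition homog n (P Q p : {poly R}) : {poly R} :=
  \sum_(i < n.+1) p`_i *: (P ^+ (n - i) * Q ^+ i).

Lemma homog_linear n P Q : linear (homog n P Q).
Proof.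
move=> a p q; rewrite /homog scaler_sumr -big_split; apply: eq_bigr => i _ /=.
by rewrite coefD coefZ scalerDl scalerA.
Qed.
HB.instance Definition _ n P Q :=
  GRing.isLinear.Build R {poly R} {poly R} _ _ (homog_linear n P Q).

Lemma homogXn n P Q i : (i <= n)%N -> homog n P Q 'X^i = P ^+ (n - i) * Q ^+ i.
Proof.
move=> hi; rewrite /homog (bigD1 (Ordinal (hi : (i < n.+1)%N))) //= coefXn eqxx scale1r.
rewrite big1 ?addr0 // => j /eqP nj; rewrite coefXn; case: eqP => [E|_]; last by rewrite scale0r.
by case: nj; apply: val_inj.
Qed.

Lemma homog1 n P Q : homog n P Q 1 = P ^+ n.
Proof. by rewrite -(expr0 'X) homogXn // subn0 expr0 mulr1. Qed.

Lemma poly_expand k (p : {poly R}) : (size p <= k.+1)%N -> p = \sum_(i < k.+1) p`_i *: 'X^i.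
Proof.
move=> hp; rewrite -poly_def; apply/polyP => i; rewrite coef_poly; case: ltnP => // hi.
by rewrite nth_default // (leq_trans hp).
Qed.

Lemma homogM m n P Q (p q : {poly R}) : (size p <= m.+1)%N -> (size q <= n.+1)%N ->
  homog (m + n) P Q (p * q) = homog m P Q p * homog n P Q q.
Proof.
move=> /poly_expand Ep /poly_expand Eq.
rewrite [in LHS]Ep [in LHS]Eq mulr_suml linear_sum [homog m P Q p]/homog mulr_suml.
apply: eq_bigr => i _; rewrite -scalerAl linearZ -scalerAl; congr (_ *: _).
rewrite mulr_sumr linear_sum /homog mulr_sumr; apply: eq_bigr => j _.
rewrite -scalerAr linearZ -scalerAr; congr (_ *: _).
have hi := ltn_ord i; have hj := ltn_ord j.
rewrite /= -exprD homogXn; last by lia.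
have -> : (m + n - (i + j) = (m - i) + (n - j))%N by lia.
by rewrite !exprD; ring.
Qed.

Lemma size_polyexp_bound n k (p : {poly R}) : (size p <= n.+1)%N -> (size (p ^+ k) <= (n * k).+1)%N.
Proof.
move=> hp; apply: leq_trans (size_poly_exp_leq _ _) _; rewrite ltnS leq_mul2r; lia.
Qed.

Lemma size_polyM_bound m n (p q : {poly R}) : (size p <= m.+1)%N -> (size q <= n.+1)%N ->
  (size (p * q)%R <= (m + n).+1)%N.
Proof. by move=> hp hq; apply: leq_trans (size_polyMleq _ _) _; lia. Qed.

Lemma homogX n k P Q (p : {poly R}) : (size p <= n.+1)%N ->
  homog (n * k) P Q (p ^+ k) = homog n P Q p ^+ k.
Proof.
move=> hp; elim: k => [|k IH]; first by rewrite muln0 !expr0 homog1.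
by rewrite mulnS !exprS homogM // ?IH // size_polyexp_bound.
Qed.

Notation ktrans n p := (homog n (1 + 'X) (1 - 'X) p).

Lemma size_1DX : (size (1 + 'X : {poly R})%R <= 2)%N.
Proof. by apply: leq_trans (size_polyD _ _) _; rewrite size_poly1 size_polyX. Qed.

Lemma size_1BX : (size (1 - 'X : {poly R})%R <= 2)%N.
Proof. by apply: leq_trans (size_polyD _ _) _; rewrite size_polyN size_poly1 size_polyX. Qed.

Definition radial_poly n (u : 'rV[R]_n.+1) : {poly R} :=
  \poly_(i < n.+1) ('C(n, i)%:R * u 0 (inord i)).

Lemma powR2_half n : 2 `^ (- (n%:R / 2)) = (Num.sqrt 2 ^+ n)^-1 :> R.
Proof. by rewrite powRN mulrC powRrM powR12_sqrt // powR_mulrn // sqrtr_ge0. Qed.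

Lemma sqrt2_gt0 n : 0 < Num.sqrt 2 ^+ n :> R.
Proof. by rewrite exprn_gt0 // sqrtr_gt0. Qed.

Lemma coef_radial n (u : 'rV[R]_n.+1) (i : 'I_n.+1) :
  (radial_poly u)`_i = 'C(n, i)%:R * u 0 i.
Proof. by rewrite coef_poly ltn_ord inord_val. Qed.

Lemma bin_neq0 n (i : 'I_n.+1) : 'C(n, i)%:R != 0 :> R.
Proof. by rewrite pnatr_eq0 -lt0n bin_gt0 -ltnS. Qed.

(** The coefficient on the left involves K_k(i), the transform K_i(k); the symmetry [krawtchoukC]
    exchanges them, which is why the coefficients carry binomial weights. *)
Lemma coef_ktrans_radial n (u : 'rV[R]_n.+1) (k : 'I_n.+1) :
  (ktrans n (radial_poly u))`_k = 'C(n, k)%:R * (Num.sqrt 2 ^+ n * krawtchouk_transform u 0 k).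
Proof.
rewrite mxE powR2_half mulVKf; last by rewrite gt_eqF // sqrt2_gt0.
rewrite coef_sum mulr_sumr; apply: eq_bigr => i _.
rewrite coefZ coef_radial [RHS]mulrA krawtchoukC -1?ltnS //.
by rewrite /krawtchouk; ring.
Qed.

Lemma size_ktrans n (p : {poly R}) : (size (ktrans n p) <= n.+1)%N.
Proof.
apply: leq_trans (size_sum _ _ _) _; apply/bigmax_leqP => i _.
apply: leq_trans (size_scale_leq _ _) _.
have h := size_polyM_bound (size_polyexp_bound (n - i) size_1DX) (size_polyexp_bound i size_1BX).
apply: leq_trans h _; have := ltn_ord i; lia.
Qed.

Lemma krawtchouk_eigenspaceP n s (u : 'rV[R]_n.+1) :
  krawtchouk_eigenspace s u <->
  ktrans n (radial_poly u) = (s * Num.sqrt 2 ^+ n) *: radial_poly u.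
Proof.
have c0 := lt0r_neq0 (sqrt2_gt0 n).
split=> [E|E].
  apply/polyP => k; rewrite coefZ; have [kn|nk] := ltnP k n.+1; last first.
    by rewrite !nth_default ?mulr0 // ?(leq_trans (size_ktrans _ _)) ?(leq_trans (size_poly _ _)).
  rewrite -[k]/(val (Ordinal kn)) coef_ktrans_radial coef_radial E mxE; ring.
apply/rowP => k; rewrite [RHS]mxE; apply: (mulfI c0); apply: (mulfI (bin_neq0 k)).
by rewrite -coef_ktrans_radial E coefZ coef_radial; ring.
Qed.

Lemma exists_radial n (U : {poly R}) : (size U <= n.+1)%N ->
  exists2 u : 'rV[R]_n.+1, radial_poly u = U & forall i, u 0 i = U`_i / 'C(n, i)%:R.
Proof.
move=> sU; exists (\row_i (U`_i / 'C(n, i)%:R)) => [|i]; last by rewrite mxE.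
apply/polyP => k; have [kn|nk] := ltnP k n.+1; last first.
  by rewrite !nth_default // ?(leq_trans sU) ?(leq_trans (size_poly _ _)).
by rewrite -[k]/(val (Ordinal kn)) coef_radial mxE mulrC divfK // bin_neq0.
Qed.

End Transform.

Notation ktrans n p := (homog n (1 + 'X) (1 - 'X) p).

(** * Lower bound *)

Section LowerBound.
Variable R : realType.
Local Notation C := R[i].
Local Notation pC p := (map_poly (real_complex R) p).

(** Comparing [p ^+ (4 * K)] with the n-th power of [nodepoly] avoids fractional powers; both are
    forms of degree 4Kn when [p] is one of degree n. [K] and [lam] depend on [eps] alone, so the
    estimate is uniform in [n]. *)
Lemma disc_bound (eps : R) : 0 < eps ->
  exists2 lam : R, 0 < lam & forall n (p : {poly C}) (L : R), 0 <= L ->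
    (forall z, normc z = 1 -> normc p.[z] <= L) ->
    (forall t : R, 2 ^+ n * normc p.[(0 +i* t)%C] ^+ 2 <= (1 + t ^+ 2) ^+ n * L ^+ 2) ->
    forall a b : R, 0 <= a -> a ^+ 2 + b ^+ 2 = expR (- lam) ^+ 2 ->
    normc p.[(a +i* b)%C] <= L * expR (- (n%:R * lam * (1 / 2 - 1 / pi - eps))).
Proof.
move=> eps0; have [K K0 [lam l0 hQ]] := nodepoly_circle eps0.
exists lam => // n p L L0 harc hseg a b a0 ab.
pose M := L ^+ (4 * K) / 4 ^+ (K * n).
have M0 : 0 <= M by rewrite divr_ge0 ?exprn_ge0.
have K4 : (0 < 4 * K)%N by lia.
have key : normc (p ^+ (4 * K)).[(a +i* b)%C] <= M * normc ((pC (nodepoly R K)) ^+ n).[(a +i* b)%C].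
  apply: max_modulus_half_disc => //; last first.
  - by rewrite ab expr_le1 ?expR_ge0 // -expR0 ler_expR oppr_le0 ltW.
  - move=> c d c0 cd [cE|cdE]; rewrite !horner_exp !normcX /M.
    + rewrite {}cE in cd *.
      have h1 : normc p.[(0 +i* d)%C] ^+ 2 <= (1 + d ^+ 2) ^+ n * L ^+ 2 / 2 ^+ n.
        by rewrite ler_pdivlMr ?exprn_gt0 // mulrC.
      have d1 : 0 <= 1 + d ^+ 2 by rewrite addr_ge0 // sqr_ge0.
      have h2 : (1 + d ^+ 2) ^+ (2 * K) <= normc (pC (nodepoly R K)).[(0 +i* d)%C].
        rewrite -ler_sqr ?nnegrE ?normc_ge0 ?exprn_ge0 // -exprM.
        have -> : (2 * K * 2 = 4 * K)%N by lia.
        exact: nodepoly_segment.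
      have -> : (4 * K = 2 * (2 * K))%N by lia.
      rewrite [leLHS]exprM.
      have h3 : (normc p.[(0 +i* d)%C] ^+ 2) ^+ (2 * K) <= ((1 + d ^+ 2) ^+ n * L ^+ 2 / 2 ^+ n) ^+ (2 * K).
        by rewrite lerXn2r ?nnegrE ?exprn_ge0 ?normc_ge0 // divr_ge0 ?mulr_ge0 ?exprn_ge0.
      apply: le_trans h3 _.
      have -> : ((1 + d ^+ 2) ^+ n * L ^+ 2 / 2 ^+ n) ^+ (2 * K) =
         L ^+ (2 * (2 * K)) / 4 ^+ (K * n) * ((1 + d ^+ 2) ^+ (2 * K)) ^+ n.
        rewrite exprMn exprMn exprVn -[(L ^+ 2) ^+ _]exprM -!exprM.
        have -> : (4 : R) ^+ (K * n) = 2 ^+ (n * (2 * K)).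
          have -> : (4 : R) = 2 ^+ 2 by ring.
          by rewrite -exprM; congr (_ ^+ _); lia.
        by rewrite [(2 * K * n)%N]mulnC; ring.
      rewrite ler_wpM2l ?divr_ge0 ?exprn_ge0 //.
      by rewrite lerXn2r ?nnegrE ?exprn_ge0 ?normc_ge0.
    + have n1 : normc (c +i* d)%C = 1.
        by apply/eqP; rewrite -(@eqrXn2 _ 2) ?normc_ge0 // normc_sqrE cdE expr1n.
      have h1 : normc p.[(c +i* d)%C] ^+ (4 * K) <= L ^+ (4 * K).
        by rewrite lerXn2r ?nnegrE ?normc_ge0 // harc.
      apply: le_trans h1 _.
      rewrite -mulrA ler_peMr ?exprn_ge0 // ler_pdivlMl ?exprn_gt0 // mulr1 exprM.
      rewrite lerXn2r ?nnegrE ?exprn_ge0 ?normc_ge0 //.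
      rewrite -ler_sqr ?nnegrE ?normc_ge0 ?exprn_ge0 //.
      apply: le_trans (nodepoly_arc K0 cdE).
      by rewrite -exprM mulnC exprM; have -> : (4 : R) ^+ 2 = 16 by ring.
  - by move=> c d c0 cd; rewrite horner_exp expf_neq0 // nodepoly_neq0.
rewrite !horner_exp !normcX in key.
rewrite -(ler_pXn2r K4) ?nnegrE ?normc_ge0 ?mulr_ge0 ?expR_ge0 //.
apply: le_trans key _.
have h : normc (pC (nodepoly R K)).[(a +i* b)%C] ^+ n <=
    (4 ^+ K * expR (- (4 * K%:R * lam * (1 / 2 - 1 / pi - eps)))) ^+ n.
  by rewrite lerXn2r ?nnegrE ?normc_ge0 ?mulr_ge0 ?exprn_ge0 ?expR_ge0 ?hQ.
apply: le_trans (ler_wpM2l M0 h) _.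
rewrite /M exprMn -exprM [leRHS]exprMn -!expRM_natl mulrA divfK ?expf_neq0 ?pnatr_eq0 //.
suff -> : n%:R * - (4 * K%:R * lam * (1 / 2 - 1 / pi - eps)) =
  (4 * K)%:R * - (n%:R * lam * (1 / 2 - 1 / pi - eps)) by [].
by rewrite natrM; ring.
Qed.

Lemma normc_horner_le n (p : {poly R}) z : (size p <= n.+1)%N -> normc z = 1 ->
  normc (pC p).[z] <= \sum_(i < n.+1) `|p`_i|.
Proof.
move=> sp z1; rewrite (@horner_coef_wide _ n.+1); last first.
  by rewrite size_map_poly.
apply: le_trans (normc_sum_le _ _ _) _; apply: ler_sum => i _.
by rewrite normcM normcX z1 expr1n mulr1 coef_map normcR.
Qed.

(** On the imaginary axis 1 + y and 1 - y have the same modulus, so every term of the form carries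
    the same power of sqrt(1 + t^2). *)
Lemma normc_ktrans_le n (p : {poly R}) (t : R) :
  normc (pC (ktrans n p)).[(0 +i* t)%C] ^+ 2 <=
  (1 + t ^+ 2) ^+ n * (\sum_(i < n.+1) `|p`_i|) ^+ 2.
Proof.
set w := (0 +i* t)%C; have d1 : 0 <= 1 + t ^+ 2 by rewrite addr_ge0 // sqr_ge0.
set q := Num.sqrt (1 + t ^+ 2).
have nq (v : C) : v = (1 +i* t)%C \/ v = (1 -i* t)%C -> normc v = q.
  by case=> ->; rewrite /= ?sqrrN expr1n.
have h : normc (pC (ktrans n p)).[w] <= q ^+ n * \sum_(i < n.+1) `|p`_i|.
  rewrite rmorph_sum /= horner_sum mulr_sumr.
  apply: le_trans (normc_sum_le _ _ _) _; apply: ler_sum => i _.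
  rewrite map_polyZ rmorphM !rmorphXn /= rmorphB rmorphD !rmorph1 /= map_polyX !hornerE.
  rewrite !normcM !normcX normcR.
  have -> : normc (1 + w) = q by apply: nq; left; apply/eqP; rewrite eq_complex /= addr0 add0r !eqxx.
  have -> : normc (1 - w) = q by apply: nq; right; apply/eqP; rewrite eq_complex /= subr0 add0r !eqxx.
  by rewrite -mulrA mulrC -exprD subnK // -ltnS.
have q0 : 0 <= q by rewrite sqrtr_ge0.
have S0 : 0 <= \sum_(i < n.+1) `|p`_i| by apply: sumr_ge0.
apply: le_trans (_ : (q ^+ n * \sum_(i < n.+1) `|p`_i|) ^+ 2 <= _).
  by rewrite lerXn2r ?nnegrE ?normc_ge0 ?mulr_ge0 ?exprn_ge0.
by rewrite exprMn -exprM mulnC exprM sqr_sqrtr.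
Qed.

Lemma eigenpoly_coef_le (eps : R) : 0 < eps ->
  exists2 lam : R, 0 < lam & forall n s (p : {poly R}), (size p <= n.+1)%N ->
    s ^+ 2 = 1 -> ktrans n p = (s * Num.sqrt 2 ^+ n) *: p -> forall i,
    `|p`_i| <= (\sum_(j < n.+1) `|p`_j|) * expR (- (lam * (n%:R * (1 / 2 - 1 / pi - eps) - i%:R))).
Proof.
move=> eps0; have [lam l0 hlam] := disc_bound eps0; exists lam => // n s p sp s1 Ep i.
set L := \sum_(j < _) _; have L0 : 0 <= L by apply: sumr_ge0.
have segE (t : R) : 2 ^+ n * normc (pC p).[(0 +i* t)%C] ^+ 2 <= (1 + t ^+ 2) ^+ n * L ^+ 2.
  apply: le_trans (normc_ktrans_le n p t).
  rewrite Ep map_polyZ hornerZ normcM normcR exprMn real_normK ?num_real //.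
  by rewrite exprMn s1 mul1r -exprM mulnC exprM sqr_sqrtr.
have arcE z : normc z = 1 -> normc (pC p).[z] <= L by exact: normc_horner_le.
have rho0 : 0 < expR (- lam) by exact: expR_gt0.
have key := @coef_norm_le R (pC p) (expR (- lam)) (L * expR (- (n%:R * lam * (1 / 2 - 1 / pi - eps)))) i rho0.
rewrite coef_map normcR in key.
have {}key : `|p`_i| * expR (- lam) ^+ i <= L * expR (- (n%:R * lam * (1 / 2 - 1 / pi - eps))).
  apply: key => -[a b] /(congr1 (fun x => x ^+ 2)); rewrite normc_sqrE => ab.
  have [a0|a0] := leP 0 a; first exact: hlam.
  (* The polynomial p(-y) need not come from an eigenvector, but the two boundary bounds are
     invariant under y -> -y, and [disc_bound] asks for nothing else. *)
  have -> : (pC p).[(a +i* b)%C] = (pC p \Po (- 'X)).[((- a) +i* (- b))%C].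
    rewrite horner_comp hornerN hornerX; congr (_.[_]).
    by apply/eqP; rewrite eq_complex /= !opprK !eqxx.
  apply: hlam => //; rewrite ?sqrrN //.
  - move=> z z1; rewrite horner_comp hornerN hornerX; apply: arcE.
    by rewrite -z1; case: (z) => x y /=; rewrite !sqrrN.
  - move=> t; rewrite horner_comp hornerN hornerX.
    have -> : - (0 +i* t)%C = (0 +i* (- t))%C by apply/eqP; rewrite eq_complex /= oppr0 !eqxx.
    by rewrite -[t ^+ 2]sqrrN; exact: segE.
  - by rewrite oppr_ge0 ltW.
rewrite -(ler_pM2r (exprn_gt0 i rho0)); apply: le_trans key _.
rewrite -[leRHS]mulrA ler_wpM2l // -expRM_natl -expRD ler_expR; lra.
Qed.

Lemma ktrans_coef0 n (p : {poly R}) : (ktrans n p)`_0 = \sum_(i < n.+1) p`_i.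
Proof.
rewrite coef_sum; apply: eq_bigr => i _.
by rewrite coefZ -horner_coef0 hornerM !horner_exp !hornerD hornerN hornerX hornerC oppr0 !addr0 !expr1n !mulr1.
Qed.

Lemma last_sign_lower (eps : R) : 0 < eps ->
  \forall n \near \oo, forall s (p : {poly R}) (r : nat), (size p <= n.+1)%N ->
    s ^+ 2 = 1 -> ktrans n p = (s * Num.sqrt 2 ^+ n) *: p -> p != 0 -> p`_0 = 0 ->
    (forall i, (r <= i)%N -> 0 <= p`_i) -> (r <= n)%N ->
    n%:R * (1 / 2 - 1 / pi - 2 * eps) <= r%:R.
Proof.
move=> eps0; have [lam l0 hlam] := eigenpoly_coef_le eps0.
have le0 : 0 < lam * eps by rewrite mulr_gt0.
near=> n => s p r sp s1 Ep p0 p00 hr rn; rewrite leNgt; apply/negP => hlt.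
set L := \sum_(j < n.+1) `|p`_j|.
have L0 : 0 < L.
  rewrite lt_def sumr_ge0 // andbT; apply: contra p0 => /eqP/psumr_eq0P h.
  apply/eqP/polyP => i; rewrite coef0; have [iN|Ni] := ltnP i n.+1; last first.
    by rewrite nth_default // (leq_trans sp).
  by apply/eqP; rewrite -normr_eq0; apply/eqP/(h _ (Ordinal iN)).
have S0 : \sum_(j < n.+1) p`_j = 0.
  by rewrite -ktrans_coef0 Ep coefZ p00 mulr0.
have n0 : (0 < n)%N by near: n; exact: nbhs_infty_gt.
have LE : L <= 2 * (n%:R * (L * expR (- (lam * eps * n%:R)))).
  (* As the coefficients sum to 0, [L] can be written with terms that vanish from index [r] on. *)
  rewrite [leLHS](_ : _ = \sum_(j < n.+1) (`|p`_j| - p`_j)); last by rewrite sumrB S0 subr0.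
  rewrite (bigID (fun j : 'I_n.+1 => (j < r)%N)) /= [X in _ + X]big1 ?addr0; last first.
    by move=> j; rewrite -leqNgt => /hr h; rewrite ger0_norm // subrr.
  apply: (@le_trans _ _ (\sum_(j < n.+1 | (j < r)%N) (2 * (L * expR (- (lam * eps * n%:R)))))).
    apply: ler_sum => j jr.
    have h1 : `|p`_j| - p`_j <= 2 * `|p`_j| by have := ler_norm (- p`_j); rewrite normrN; lra.
    apply: le_trans h1 _; rewrite ler_wpM2l //.
    apply: le_trans (hlam _ _ _ sp s1 Ep j) _.
    rewrite ler_wpM2l ?(ltW L0) // ler_expR lerN2 -mulrA ler_wpM2l ?(ltW l0) //.
    have : j%:R <= r%:R :> R by rewrite ler_nat ltnW.
    lra.
  move: (expR _) (expR_ge0 (- (lam * eps * n%:R))) => x x0.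
  have wid (c : R) : \sum_(j < n.+1 | (j < r)%N) c = r%:R * c.
    have <- := @big_ord_widen R 0 +%R r n.+1 (fun=> c) (leqW rn).
    by rewrite sumr_const card_ord mulr_natl.
  rewrite wid; have Lx : 0 <= L * x by rewrite mulr_ge0 // ltW.
  have rn' : r%:R <= n%:R :> R by rewrite ler_nat.
  by have := ler_wpM2r Lx rn'; lra.
have nR : 0 < n%:R :> R by rewrite ltr0n.
(* Together with e^x >= (x/2)^2 for x = lam eps n, this gives 2n e^(-x) < 1. *)
have big : 8 / (lam * eps) ^+ 2 < n%:R by near: n; exact: nbhs_infty_gtr.
rewrite ltr_pdivrMr ?exprn_gt0 // in big.
set E := expR (- (lam * eps * n%:R)) in LE; have E0 : 0 < E by exact: expR_gt0.
have {}LE : 1 <= 2 * n%:R * E.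
  by rewrite -(ler_pM2r L0) mul1r; apply: le_trans LE _; rewrite le_eqVlt; apply/orP; left; apply/eqP; ring.
have EV : E * expR (lam * eps * n%:R) = 1 by rewrite -expRD addNr expR0.
have h1 : (lam * eps * n%:R / 2) ^+ 2 <= expR (lam * eps * n%:R).
  have -> : lam * eps * n%:R = 2%:R * (lam * eps * n%:R / 2) by field.
  rewrite expRM_natl; set x := lam * eps * n%:R / 2.
  have -> : 2%:R * x / 2 = x by field.
  have x0 : 0 <= x by rewrite divr_ge0 // mulr_ge0 ?ltW.
  rewrite lerXn2r ?nnegrE ?expR_ge0 //.
  by apply: le_trans (expR_ge1Dx x); rewrite lerDr.
have h2 : E * (lam * eps * n%:R / 2) ^+ 2 <= 1 by rewrite -[leRHS]EV ler_wpM2l // ltW.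
have h3 : 2 * n%:R * E < E * (lam * eps * n%:R / 2) ^+ 2.
  have -> : E * (lam * eps * n%:R / 2) ^+ 2 = (n%:R * E / 4) * (n%:R * (lam * eps) ^+ 2) by field.
  have -> : 2 * n%:R * E = n%:R * E / 4 * 8 by field.
  by rewrite ltr_pM2l // divr_gt0 // mulr_gt0.
lra.
Unshelve. all: by end_near.
Qed.

End LowerBound.

(** * Upper bound *)

Section LowPart.
Variable R : realType.
Local Notation C := R[i].
Local Notation pC p := (map_poly (real_complex R) p).

(** With P = 1 + y and Q = y(1 - y) one has (1 + y^2)^2 = (P - Q)^2 and y(1 - y^2) = PQ, so
    [qfactor c] is P^2 + 2(2c - 1)PQ + Q^2; [hpoly] is the product of these with P = 1 and Q = y. As
    forms of degree 2, both P and Q have eigenvalue 2, so every form in P and Q is an eigenvector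
    and can be truncated freely. *)
Definition hpoly (K : nat) : {poly R} :=
  \prod_(j < K) (1 + (2 * (2 * node R K j - 1)) *: 'X + 'X ^+ 2).

Lemma size_quadratic c : (size (1 + c *: 'X + 'X ^+ 2 : {poly R})%R <= 3)%N.
Proof.
apply: leq_trans (size_polyD _ _) _; rewrite size_polyXn geq_max andbT.
apply: leq_trans (size_polyD _ _) _; rewrite size_poly1 geq_max /=.
by apply: leq_trans (size_scale_leq _ _) _; rewrite size_polyX.
Qed.

Lemma prod_quadratic_homog (I : finType) (c : I -> R) (P Q : {poly R}) (s : seq I) :
  (size (\prod_(j <- s) (1 + c j *: 'X + 'X ^+ 2 : {poly R}))%R <= (2 * size s).+1)%N /\
  homog (2 * size s) P Q (\prod_(j <- s) (1 + c j *: 'X + 'X ^+ 2)) =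
  \prod_(j <- s) (P ^+ 2 + c j *: (P * Q) + Q ^+ 2).
Proof.
elim: s => [|j s [IH1 IH2]].
  by rewrite !big_nil size_poly1 homog1.
rewrite !big_cons /= mulnS; split; first exact: size_polyM_bound (size_quadratic _) IH1.
rewrite homogM ?size_quadratic // IH2; congr (_ * _).
have := homogXn P Q (isT : (1 <= 2)%N); rewrite expr1 => hX.
by rewrite !linearD linearZ /= homog1 hX homogXn // subnn expr0 mul1r !expr1.
Qed.

Lemma size_index_ord K : size (index_enum 'I_K) = K.
Proof. by rewrite [index_enum _]unlock -enumT size_enum_ord. Qed.

Lemma nodepoly_homog K : nodepoly R K = homog (2 * K) (1 + 'X) ('X * (1 - 'X)) (hpoly K).
Proof.
have [_ h] := prod_quadratic_homog (fun j : 'I_K => 2 * (2 * node R K j - 1)) (1 + 'X) ('X * (1 - 'X)) (index_enum 'I_K).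
rewrite size_index_ord in h; rewrite h.
apply: eq_bigr => j _; rewrite /qfactor -!mul_polyC; set c := node R K j.
have -> : (2 * (2 * c - 1))%:P = 4 * c%:P - 2 :> {poly R} by rewrite !(polyCM, polyCB, polyCD, polyC_natr) polyC1; ring.
by rewrite polyCM polyC_natr; ring.
Qed.

(** On the unit circle a factor has modulus 4|c - v| with v = (1 - Re z)/2 in [0, 1]. Since c and v
    are nonnegative, |c - v|^2 <= |c^2 - v^2|, and the Chebyshev bound controls the square of the
    product. This yields growth 2^K, where bounding each factor by 4 would yield 4^K. *)
Lemma hpoly_coef_le K k : (0 < K)%N -> `|(hpoly K)`_k| <= 2 ^+ K.+1.
Proof.
move=> K0.
have key := @coef_norm_le R (pC (hpoly K)) 1 (2 ^+ K.+1) k ltr01.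
rewrite coef_map normcR expr1n mulr1 in key; apply: key => -[a b] /(congr1 (fun x => x ^+ 2)).
rewrite normc_sqrE expr1n => ab.
have [v hv] : {v : R | v = (1 - a) / 2} by exists ((1 - a) / 2).
have a1 : a <= 1 by nra.
have a2 : -1 <= a by nra.
have v01 : 0 <= v <= 1 by rewrite hv; apply/andP; split; lra.
rewrite rmorph_prod horner_prod normc_prod.
have E (j : 'I_K) : normc (pC (1 + (2 * (2 * node R K j - 1)) *: 'X + 'X ^+ 2)).[(a +i* b)%C] =
    4 * `|node R K j - v|.
  move: (node R K j) => c.
  have [d dE] : {d : R | d = 2 * (2 * c - 1)} by exists (2 * (2 * c - 1)).
  rewrite -dE.
  rewrite !rmorphD /= rmorph1 map_polyZ /= map_polyX map_polyXn !hornerE.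
  have -> : 4 * `|c - v| = `|d + 2 * a|.
    by rewrite -[4]ger0_norm // -normrM hv dE; congr `|_|; field.
  have -> : 1 + d%:C%C * (a +i* b)%C + (a +i* b)%C ^+ 2 = (a +i* b)%C * (d + 2 * a)%:C%C.
    rewrite expr2; apply/eqP; rewrite eq_complex /=; apply/andP; split; apply/eqP; last ring.
    lra.
  rewrite normcM normcR.
  have -> : normc (a +i* b)%C = 1; last by rewrite mul1r.
  by apply/eqP; rewrite -(@eqrXn2 _ 2) ?normc_ge0 // normc_sqrE ab expr1n.
under eq_bigr do rewrite E.
rewrite -ler_sqr ?nnegrE ?exprn_ge0 //; last by apply: prodr_ge0 => j _; rewrite mulr_ge0.
apply: (@le_trans _ _ (4 ^+ K * \prod_(j < K) `|4 * (v ^+ 2 - node R K j ^+ 2)|)).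
  rewrite -prodrXl.
  have -> : (4 : R) ^+ K = \prod_(j < K) 4 by rewrite prodr_const card_ord.
  rewrite -big_split /=; apply: ler_prod => j _; rewrite exprn_ge0 ?mulr_ge0 //=.
  have c0 := node_gt0 R (ltn_ord j); move: (node R K j) c0 => c c0.
  have h : `|c - v| <= `|c + v|.
    rewrite [leRHS]ger0_norm; last by lra.
    by rewrite ler_norml; apply/andP; split; lra.
  have -> : v ^+ 2 - c ^+ 2 = - ((c - v) * (c + v)) by ring.
  rewrite !normrM normrN normrM ger0_norm // exprMn.
  have := ler_wpM2l (normr_ge0 (c - v)) h; move: `|c - v| `|c + v| => x y; lra.
have v11 : -1 <= v <= 1 by apply/andP; split; lra.
apply: le_trans (ler_wpM2l _ (prod_node_cheb K0 v11)) _; rewrite ?exprn_ge0 //.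
rewrite -exprM; have -> : (K.+1 * 2 = K * 2 + 2)%N by lia.
rewrite exprD mulnC exprM; have -> : (2 : R) ^+ 2 = 4 by ring.
by rewrite ler_wpM2l ?exprn_ge0 // ler_nat.
Qed.

End LowPart.

(** * The truncated product at points outside the unit disc *)

Section LowPartBounds.
Variable R : realType.
Local Notation C := R[i].
Local Notation pC p := (map_poly (real_complex R) p).

(* Truncating at degree [K] in [X (1 - X)] lowers the degree of [nodepoly K] from [4K] to [3K]
   and changes it by a negligible amount near the half disc. *)
Definition lowpart K : {poly R} :=
  \sum_(k < K.+1) (hpoly R K)`_k *: ((1 + 'X) ^+ (2 * K - k) * ('X * (1 - 'X)) ^+ k).

Lemma horner_form_term (c : R) (i k : nat) (y : C) :
  (pC (c *: ((1 + 'X) ^+ i * ('X * (1 - 'X)) ^+ k))).[y] =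
  c%:C%C * ((1 + y) ^+ i * (y * (1 - y)) ^+ k).
Proof.
rewrite map_polyZ rmorphM !rmorphXn rmorphM rmorphB rmorphD /= !rmorph1 map_polyX.
by rewrite hornerZ hornerM !horner_exp hornerM !hornerD hornerN hornerX hornerC.
Qed.

(** Where |Q| > |P|, each retained monomial in P and Q is at most |PQ|^K; where |Q| <= |P|, each
    discarded one is. So the full product has to be estimated in the second region only. *)
Lemma lowpart_le K (y : C) (B : R) : (0 < K)%N -> 0 <= B ->
  (normc (y * (1 - y)) <= normc (1 + y) -> normc (pC (nodepoly R K)).[y] <= B) ->
  normc (pC (lowpart K)).[y] <=
    B + 2 * K.+1%:R * (2 * (normc (1 + y) * normc (y * (1 - y)))) ^+ K.
Proof.
move=> K0 B0 hB; set P := normc (1 + y); set Q := normc (y * (1 - y)).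
have P0 : 0 <= P by exact: normc_ge0.
have Q0 : 0 <= Q by exact: normc_ge0.
have H0 : 0 <= (P * Q) ^+ K by rewrite exprn_ge0 ?mulr_ge0.
have -> : 2 * K.+1%:R * (2 * (P * Q)) ^+ K = K.+1%:R * (2 ^+ K.+1 * (P * Q) ^+ K).
  by rewrite exprMn exprS; ring.
have term (k i : nat) : P ^+ i * Q ^+ k <= (P * Q) ^+ K ->
    normc (((hpoly R K)`_k)%:C%C * ((1 + y) ^+ i * (y * (1 - y)) ^+ k)) <= 2 ^+ K.+1 * (P * Q) ^+ K.
  move=> h; rewrite normcM normcR normcM !normcX -/P -/Q.
  by apply: ler_pM => //; rewrite ?hpoly_coef_le // mulr_ge0 ?exprn_ge0.
have [PQ|QP] := ltP P Q.
  rewrite ler_wpDl //.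
  have -> : K.+1%:R * (2 ^+ K.+1 * (P * Q) ^+ K) = \sum_(k < K.+1) (2 ^+ K.+1 * (P * Q) ^+ K).
    by rewrite sumr_const card_ord mulr_natl.
  rewrite rmorph_sum /= horner_sum; apply: le_trans (normc_sum_le _ _ _) _.
  apply: ler_sum => k _; rewrite horner_form_term; apply: term.
  have kK : (k <= K)%N by rewrite -ltnS.
  have -> : (2 * K - k = K + (K - k))%N by lia.
  rewrite exprD exprMn -mulrA ler_wpM2l ?exprn_ge0 //.
  rewrite -[in leRHS](subnK kK) exprD ler_wpM2r ?exprn_ge0 //.
  by rewrite lerXn2r ?nnegrE // ltW.
have E : (pC (lowpart K)).[y] = (pC (nodepoly R K)).[y] -
   \sum_(k < K) ((hpoly R K)`_(K.+1 + k)%N)%:C%C *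
      ((1 + y) ^+ (2 * K - (K.+1 + k)) * (y * (1 - y)) ^+ (K.+1 + k)).
  apply/eqP; rewrite -subr_eq opprK eq_sym; apply/eqP.
  rewrite nodepoly_homog /homog.
  have -> : ((2 * K).+1 = K.+1 + K)%N by lia.
  rewrite big_split_ord /= rmorphD /= hornerD; congr (_ + _).
  by rewrite rmorph_sum /= horner_sum; apply: eq_bigr => k _; rewrite horner_form_term.
rewrite E; apply: le_trans (normcD_le _ _) _; rewrite normcN; apply: lerD; first exact: hB.
apply: le_trans (normc_sum_le _ _ _) _.
apply: (@le_trans _ _ (\sum_(k < K) (2 ^+ K.+1 * (P * Q) ^+ K))); last first.
  have Z0 : 0 <= 2 ^+ K.+1 * (P * Q) ^+ K by rewrite mulr_ge0 // exprn_ge0.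
  have KK : K%:R <= K.+1%:R :> R by rewrite ler_nat.
  move: (2 ^+ K.+1 * (P * Q) ^+ K) Z0 => z z0.
  by rewrite sumr_const card_ord -[z *+ K]mulr_natl; apply: ler_wpM2r.
apply: ler_sum => k _; apply: term.
have kK := ltn_ord k.
have -> : (K.+1 + k = K + k.+1)%N by lia.
have -> : (2 * K - (K + k.+1) = K - k.+1)%N by lia.
rewrite [leRHS]exprMn -[in P ^+ K](subnK kK) !exprD.
have h : P ^+ (K - k.+1) * Q ^+ K * Q ^+ k.+1 <= P ^+ (K - k.+1) * Q ^+ K * P ^+ k.+1.
  by rewrite ler_wpM2l ?mulr_ge0 ?exprn_ge0 // lerXn2r ?nnegrE.
by move: h; rewrite !mulrA => /le_trans; apply; rewrite mulrAC.
Qed.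

(** The products at S and -S multiply to |S^(4K) + 1|^2 <= 4, and the one at S is the smaller
    because Re S <= 0 and the nodes are positive. *)
Lemma prod_quad_sqr_neg K (S : C) : (0 < K)%N -> Re S <= 0 -> normc S <= 1 ->
  \prod_(j < K) quad_sqr (node R K j) (normc S) (Re S) <= 2.
Proof.
move=> K0 S0 S1.
have nn (j : 'I_K) T : 0 <= quad_sqr (node R K j) (normc T) (Re T) by rewrite -quad_sqrE sqr_ge0.
have E : \prod_(j < K) quad_sqr (node R K j) (normc S) (Re S) *
    \prod_(j < K) quad_sqr (node R K j) (normc (- S)) (Re (- S)) = normc ((S ^+ 2) ^+ (2 * K) + 1) ^+ 2.
  rewrite -prod_node_complex // normc_prod -prodrXl -big_split /=; apply: eq_bigr => j _.
  rewrite -!quad_sqrE -exprMn -normcM; congr (normc _ ^+ 2).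
  have -> : (4 * node R K j ^+ 2)%:C%C = ((2 * node R K j)%:C)%C ^+ 2 :> C.
    by rewrite -rmorphXn /=; congr (_%:C)%C; ring.
  by ring.
have le : \prod_(j < K) quad_sqr (node R K j) (normc S) (Re S) <=
    \prod_(j < K) quad_sqr (node R K j) (normc (- S)) (Re (- S)).
  apply: ler_prod => j _; rewrite nn /=.
  have -> : normc (- S) = normc S by rewrite normcN.
  have -> : Re (- S) = - Re S by case: (S).
  have c0 := node_gt0 R (ltn_ord j).
  have h : node R K j * Re S * (1 + normc S ^+ 2) <= 0.
    by rewrite mulr_le0_ge0 ?addr_ge0 ?sqr_ge0 // mulr_ge0_le0 // ltW.
  rewrite /quad_sqr sqrrN; lra.
have h1 : normc ((S ^+ 2) ^+ (2 * K) + 1) <= 2.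
  apply: le_trans (normcD_le _ _) _; rewrite (Normc.normc1 R) !normcX -exprM.
  by have := exprn_ile1 (2 * (2 * K)) (normc_ge0 S) S1; lra.
have h2 : normc ((S ^+ 2) ^+ (2 * K) + 1) ^+ 2 <= 2 ^+ 2.
  by rewrite lerXn2r ?nnegrE ?normc_ge0.
have p0 : 0 <= \prod_(j < K) quad_sqr (node R K j) (normc S) (Re S) by apply: prodr_ge0.
rewrite -ler_sqr ?nnegrE //; apply: le_trans h2; rewrite -E expr2.
exact: ler_wpM2l.
Qed.

Section Circle.
Variables (a b rho : R).
Hypotheses (rho1 : 1 <= rho) (ab : a ^+ 2 + b ^+ 2 = rho ^+ 2).
Let y : C := (a +i* b)%C.

Let rho0 : 0 < rho. Proof. by apply: lt_le_trans rho1. Qed.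
Let m0 : a ^+ 2 + b ^+ 2 != 0. Proof. by rewrite ab expf_neq0 // gt_eqF. Qed.
Let y0 : y != 0. Proof. by rewrite -normc_eq0 -sqrf_eq0 normc_sqrE. Qed.
Let rho21 : 1 <= rho ^+ 2. Proof. by rewrite exprn_ege1. Qed.

Lemma normc_1D : normc (1 + y) ^+ 2 = 1 + rho ^+ 2 + 2 * a.
Proof. by rewrite normc_sqr /= add0r -ab; ring. Qed.

Lemma normc_y1B : normc (y * (1 - y)) ^+ 2 = rho ^+ 2 * (1 + rho ^+ 2 - 2 * a).
Proof. by rewrite normcM exprMn !normc_sqr /= -ab; ring. Qed.

Lemma low_region : normc (y * (1 - y)) <= normc (1 + y) -> rho ^+ 2 - 1 <= 2 * a.
Proof.
rewrite -ler_sqr ?nnegrE ?normc_ge0 // normc_1D normc_y1B => h.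
have r2 := sqr_ge0 rho; have q0 : 0 < 1 + rho ^+ 2 by lra.
rewrite -(ler_pM2r q0); lra.
Qed.

(** The hypothesis on [a] places [joukowski y] in the left half of the closed unit disc. *)
Lemma nodepoly_crude K : (0 < K)%N -> rho ^+ 2 - 1 <= 2 * a ->
  normc (pC (nodepoly R K)).[y] <= 2 * (2 * rho) ^+ (2 * K).
Proof.
move=> K0 h; have r4 : 0 < 4 * rho ^+ 2 by rewrite mulr_gt0 // exprn_gt0.
rewrite -ler_sqr ?nnegrE ?normc_ge0 //; last by rewrite mulr_ge0 // exprn_ge0 // mulr_ge0 // ltW.
rewrite normc_nodepoly // normc_sqrE ab.
have hS : Re (joukowski y) <= 0.
  have r21 := rho21; rewrite joukowskiE //= ab; apply: mulr_le0_ge0.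
    by apply: mulr_ge0_le0; [lra | rewrite subr_le0].
  by rewrite invr_ge0 mulr_ge0 ?sqr_ge0.
have nS : normc (joukowski y) <= 1.
  rewrite -ler_sqr ?nnegrE ?normc_ge0 // expr1n joukowski_sqr // ab.
  rewrite ler_pdivrMr ?mulr_gt0 ?exprn_gt0 // mul1r.
  have -> : b ^+ 2 = rho ^+ 2 - a ^+ 2 by rewrite -ab addrAC subrr add0r.
  have h2 : (rho ^+ 2 - 1) ^+ 2 <= 4 * a ^+ 2.
    have -> : 4 * a ^+ 2 = (2 * a) ^+ 2 by ring.
    have r21 := rho21; have u0 : 0 <= rho ^+ 2 - 1 by rewrite subr_ge0.
    by rewrite lerXn2r ?nnegrE // (le_trans u0).
  have := ler_wpM2l (ltW (exprn_gt0 2 rho0)) h2; lra.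
have hp := prod_quad_sqr_neg K0 hS nS.
apply: le_trans (ler_wpM2l _ hp) _; first by rewrite exprn_ge0 // ltW.
have -> : (2 * (2 * rho) ^+ (2 * K)) ^+ 2 = 4 * (4 * rho ^+ 2) ^+ (2 * K).
  have -> : 4 * rho ^+ 2 = (2 * rho) ^+ 2 by ring.
  by rewrite exprMn -!exprM [(2 * K * 2)%N]mulnC; congr (_ * _); ring.
have := exprn_ge0 (2 * K) (ltW r4); lra.
Qed.

(** Outside the unit disc the real part of S is -X <= 0, so an upper bound now uses the lower bound
    2/pi for the mean of the nodes. *)
Lemma nodepoly_avg K (e := (rho - rho^-1) / 2) (X := e * (a / rho)) (r2 := e ^+ 2 + (b / rho) ^+ 2) :
  (0 < K)%N -> rho ^+ 2 - 1 <= 2 * a ->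
  normc (pC (nodepoly R K)).[y] ^+ 2 <= (4 * rho ^+ 2) ^+ (2 * K) *
    (1 + r2 ^+ 2 + 4 * X ^+ 2 - 8 / pi * X * (1 + r2)) ^+ K.
Proof.
move=> K0 h; have r4 : 0 < 4 * rho ^+ 2 by rewrite mulr_gt0 // exprn_gt0.
rewrite (nodepoly_circle_normc K0 rho0 ab) ler_wpM2l ?exprn_ge0 ?(ltW r4) //.
have -> : (rho^-1 - rho) / 2 = - e by rewrite /e; ring.
rewrite sqrrN -/r2 mulNr -/X.
have r20 : 0 <= r2 by rewrite addr_ge0 ?sqr_ge0.
have e0 : 0 <= e by rewrite divr_ge0 // subr_ge0 (le_trans _ rho1) // invf_le1.
have a0 : 0 <= a by have r21 := rho21; lra.
have X0 : 0 <= X by rewrite mulr_ge0 // divr_ge0 // ltW.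
have XE : X ^+ 2 <= r2.
  rewrite /X exprMn /r2 ler_wpDr ?sqr_ge0 // ler_piMr ?sqr_ge0 //.
  rewrite expr_div_n ler_pdivrMr ?exprn_gt0 // mul1r -ab lerDl sqr_ge0.
  by [].
apply: le_trans (prod_quad_sqr_avg K0 _) _; first by rewrite sqrrN sqr_sqrtr.
have c1 := node_avg_ge R K0; set cbar := _ / K%:R in c1 *.
have sE : Num.sqrt r2 ^+ 4 = r2 ^+ 2.
  by rewrite (exprM _ 2 2) sqr_sqrtr.
rewrite sE sqr_sqrtr // sqrrN.
have XX : 0 <= X * (1 + r2) by rewrite mulr_ge0 // addr_ge0.
have P8 : 8 / pi = 4 * (2 / pi) :> R by rewrite mulrA; congr (_ / _); ring.
rewrite P8; move: (2 / pi) c1 => P c1.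
have {}XX := ler_wpM2r XX c1.
have hle : 1 + r2 ^+ 2 + 4 * X ^+ 2 + 4 * cbar * - X * (1 + r2) <=
  1 + r2 ^+ 2 + 4 * X ^+ 2 - 4 * P * X * (1 + r2) by lra.
have h0 : 0 <= 1 + r2 ^+ 2 + 4 * X ^+ 2 + 4 * cbar * - X * (1 + r2).
  have := @avg_quad_sqr R K (Num.sqrt r2) (- X) K0; rewrite sE sqr_sqrtr // sqrrN => <-.
  by rewrite divr_ge0 ?sumr_ge0 // => j _; apply: quad_sqr_node_ge0; rewrite sqrrN sqr_sqrtr.
by rewrite lerXn2r ?nnegrE // (le_trans h0).
Qed.

End Circle.
End LowPartBounds.

(** * The truncated product on circles: arbitrary radius, then radius close to 1 *)

Section LowCircle.
Variable R : realType.
Local Notation C := R[i].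
Local Notation pC p := (map_poly (real_complex R) p).

Section Point.
Variables (a b rho : R).
Hypotheses (rho1 : 1 <= rho) (ab : a ^+ 2 + b ^+ 2 = rho ^+ 2).
Let y : C := (a +i* b)%C.

Lemma normc_W_sqr :
  (normc (1 + y) * normc (y * (1 - y))) ^+ 2 = rho ^+ 2 * ((1 + rho ^+ 2) ^+ 2 - 4 * a ^+ 2).
Proof. by rewrite exprMn (normc_1D ab) (normc_y1B ab); ring. Qed.

Lemma normc_W_le : normc (1 + y) * normc (y * (1 - y)) <= rho * (1 + rho ^+ 2).
Proof.
have r0 : 0 <= rho by apply: le_trans rho1.
rewrite -ler_sqr ?nnegrE ?mulr_ge0 ?normc_ge0 ?addr_ge0 ?sqr_ge0 //.
rewrite normc_W_sqr exprMn ler_wpM2l ?sqr_ge0 // gerBl mulr_ge0 ?sqr_ge0 //.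
Qed.

(** The power on the right is the growth of 2^(-n/2) (1 + y)^n for n = 4K, hence of the binomial
    tails with which the coefficients are to be compared. *)
Lemma lowpart_far K : (0 < K)%N ->
  normc (pC (lowpart R K)).[y] <= (2 * K%:R + 4) * ((1 + rho) / Num.sqrt 2) ^+ (4 * K).
Proof.
move=> K0; have r0 : 0 <= rho by apply: le_trans rho1.
have -> : ((1 + rho) / Num.sqrt 2) ^+ (4 * K) = ((1 + rho) ^+ 4 / 4) ^+ K.
  rewrite exprM expr_div_n; congr ((_ / _) ^+ K).
  by rewrite (exprM _ 2 2) sqr_sqrtr //; ring.
have h1 : 2 * (normc (1 + y) * normc (y * (1 - y))) <= (1 + rho) ^+ 4 / 4.
  apply: (@le_trans _ _ (2 * (rho * (1 + rho ^+ 2)))); first by rewrite ler_wpM2l // normc_W_le.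
  have := sqr_ge0 ((1 - rho) ^+ 2); lra.
have h2 : (2 * rho) ^+ 2 <= (1 + rho) ^+ 4 / 4.
  have -> : (1 + rho) ^+ 4 / 4 = ((1 + rho) ^+ 2 / 2) ^+ 2 by field.
  by rewrite lerXn2r ?nnegrE ?mulr_ge0 ?exprn_ge0 ?addr_ge0 //; have := sqr_ge0 (1 - rho); lra.
set G := (1 + rho) ^+ 4 / 4 in h1 h2 *.
have G0 : 0 <= G by rewrite divr_ge0 // exprn_ge0 // addr_ge0.
have GK : 0 <= G ^+ K by rewrite exprn_ge0.
have B0 : 0 <= 2 * G ^+ K by rewrite mulr_ge0.
have hB : normc (y * (1 - y)) <= normc (1 + y) -> normc (pC (nodepoly R K)).[y] <= 2 * G ^+ K.
  move=> h; apply: le_trans (nodepoly_crude rho1 ab K0 (low_region ab h)) _.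
  by rewrite ler_wpM2l // exprM lerXn2r ?nnegrE ?sqr_ge0.
apply: le_trans (lowpart_le K0 B0 hB) _.
have h3 : (2 * (normc (1 + y) * normc (y * (1 - y)))) ^+ K <= G ^+ K.
  by rewrite lerXn2r ?nnegrE // mulr_ge0 // mulr_ge0 ?normc_ge0.
have K1 : 0 <= 2 * K.+1%:R :> R by rewrite mulr_ge0.
have := ler_wpM2l K1 h3; rewrite -natr1; move: (_ ^+ K) => z; lra.
Qed.

Section Near.
Variables (eps : R) (K l : nat).
Let n := (4 * K + l)%N.
Hypotheses (eps0 : 0 < eps) (eps1 : eps <= 1 / 10) (K0 : (0 < K)%N).
Hypotheses (rhoE : rho = 1 + eps ^+ 3 / 100) (hl : 4 * K%:R * eps <= l%:R).
Let lam := ln rho.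
Let al := a / rho.

Let rho0 : 0 < rho. Proof. by apply: lt_le_trans rho1. Qed.
Let e3 : 0 < eps ^+ 3 <= eps ^+ 2 / 10.
Proof.
rewrite exprn_gt0 //=; have h := eps1; have := ler_wpM2l (sqr_ge0 eps) h; lra.
Qed.
Let e2 : 0 < eps ^+ 2 <= eps / 10.
Proof.
rewrite exprn_gt0 //=; have h := eps1; have := ler_wpM2l (ltW eps0) h; lra.
Qed.
Let rho_le : rho <= 1 + 1 / 10000.
Proof. by rewrite rhoE; have h3 := eps1; have h4 := eps0; move: e3 e2 => /andP[_ h1] /andP[_ h2]; lra. Qed.
Let lam_le : lam <= eps ^+ 3 / 100.
Proof.
rewrite /lam rhoE; apply: le_ln1Dx.
by apply: lt_le_trans (_ : 0 <= _); rewrite ?divr_ge0 ?exprn_ge0 ?(ltW eps0) ?ltrN10.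
Qed.
Let lam_ge : eps ^+ 3 / 101 <= lam.
Proof.
have [d dE] : {d : R | d = eps ^+ 3 / 100} by exists (eps ^+ 3 / 100).
have d0 : 0 < d by rewrite dE divr_gt0 // exprn_gt0.
have d1 : d <= 1 / 10000 by rewrite dE; have h3 := eps1; have h4 := eps0; move: e3 e2 => /andP[_ h1] /andP[_ h2]; lra.
have := @le_ln1Dx R (rho^-1 - 1); rewrite addrCA subrr addr0 lnV ?posrE // -/lam => h.
have {}h : - lam <= rho^-1 - 1 by apply: h; rewrite ltrBrDl subrr invr_gt0.
have : rho^-1 <= 1 - d * (100 / 101).
  rewrite -[leLHS]mul1r ler_pdivrMr // rhoE -dE; nra.
rewrite dE; lra.
Qed.
Let lam0 : 0 < lam.
Proof. by apply: lt_le_trans lam_ge; rewrite divr_gt0 // exprn_gt0. Qed.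
Let rho_exp : rho = expR lam. Proof. by rewrite lnK. Qed.
Let al_le1 : -1 <= al <= 1.
Proof.
have : al ^+ 2 <= 1.
  by rewrite /al expr_div_n ler_pdivrMr ?exprn_gt0 // mul1r -ab lerDl sqr_ge0.
by move=> h; apply/andP; split; nra.
Qed.
Let aE : a = rho * al. Proof. by rewrite mulrC divfK // gt_eqF. Qed.

(** Bounds the loss of (1 + (sqrt 2 - 1) y)^l away from the positive axis, as [normc_1DX_near]
    shows; [al] is the cosine of the argument of [y]. *)
Let damp := expR (- (l%:R * (1 - al) / 5)).

Let damp_le1 : damp <= 1.
Proof.
rewrite -expR0 ler_expR oppr_le0 divr_ge0 // mulr_ge0 // subr_ge0.
by case/andP: al_le1.
Qed.

Lemma high_part_near :
  (2 * (normc (1 + y) * normc (y * (1 - y)))) ^+ K * damp <= 4 ^+ K.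
Proof.
have W0 : 0 <= normc (1 + y) * normc (y * (1 - y)) by rewrite mulr_ge0 ?normc_ge0.
have W2 := normc_W_sqr; have Wle := normc_W_le.
move: (normc (1 + y) * _) W0 W2 Wle => W W0 W2 Wle.
have [al2|al2] := leP (1 / 2) al.
  rewrite -[leRHS]mulr1; apply: ler_pM; rewrite ?exprn_ge0 ?expR_ge0 ?mulr_ge0 //.
  rewrite lerXn2r ?nnegrE ?mulr_ge0 //.
  suff : W <= 2 by lra.
  rewrite -ler_sqr ?nnegrE // W2 aE exprMn.
  have h1 : 1 / 4 <= al ^+ 2 by nra.
  have [m mE] : {m : R | m = rho ^+ 2} by exists (rho ^+ 2).
  have m1 : 1 <= m by rewrite mE exprn_ege1.
  have m2 : m <= 101 / 100 by have h := rho_le; have h' := rho1; rewrite mE; nra.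
  rewrite -mE; have := ler_wpM2l (_ : 0 <= m ^+ 2) h1 => /(_ (sqr_ge0 _)) h.
  have h3 : m * ((1 + m) ^+ 2 - m) <= 4.
    by nra.
  lra.
have WW : W <= 2 * rho ^+ 3.
  apply: le_trans Wle _; have r2 : 1 <= rho ^+ 2 by rewrite exprn_ege1.
  rewrite (exprS rho 2) mulrCA ler_wpM2l ?(ltW rho0) //; lra.
apply: (@le_trans _ _ ((4 * rho ^+ 3) ^+ K * expR (- (l%:R / 10)))).
  apply: ler_pM; rewrite ?exprn_ge0 ?expR_ge0 ?mulr_ge0 //.
    rewrite lerXn2r ?nnegrE ?mulr_ge0 ?exprn_ge0 ?(ltW rho0) //; lra.
  rewrite ler_expR lerN2 -mulrA ler_wpM2l //; lra.
rewrite exprMn -mulrA ler_piMr ?exprn_ge0 // -exprM rho_exp -expRM_natl -expRD -[leRHS]expR0 ler_expR.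
rewrite natrM.
have h1 : K%:R * lam <= K%:R * (eps / 100).
  rewrite ler_wpM2l // (le_trans lam_le) //.
  by have h3 := eps1; have h4 := eps0; move: e3 e2 => /andP[_ h1] /andP[_ h2]; lra.
have : 0 <= K%:R * eps by rewrite mulr_ge0 // ltW.
have := hl; lra.
Qed.

(** If 1 - al >= eps^2/40, the crude bound exceeds 2 * 4^K only by rho^(2K) <= exp(K eps^3/50), and
    [damp] cancels exactly this because l >= 4K eps. Closer to the positive axis, [nodepoly_avg]
    gives the rate with 1/pi. *)
Lemma nodepoly_near : normc (y * (1 - y)) <= normc (1 + y) ->
  normc (pC (nodepoly R K)).[y] * damp <=
  2 * 4 ^+ K * expR (4 * K%:R * lam * (1 / 2 - 1 / pi + eps)).
Proof.
move=> reg; have hr := low_region ab reg.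
have r0pos : 0 <= 1 / 2 - 1 / pi + eps :> R.
  have p2 : 1 / pi <= 1 / 2 :> R by rewrite !div1r lef_pV2 ?posrE ?pi_gt0 // pi_ge2.
  by have := eps0; lra.
have lamp := lam0.
have E1 : 1 <= expR (4 * K%:R * lam * (1 / 2 - 1 / pi + eps)).
  by rewrite -[leLHS]expR0 ler_expR !mulr_ge0 // ltW.
have [al3|al3] := leP (eps ^+ 2 / 40) (1 - al).
  apply: (@le_trans _ _ (2 * 4 ^+ K)); last by rewrite ler_peMr ?mulr_ge0 ?exprn_ge0.
  apply: le_trans (ler_wpM2r (expR_ge0 _) (nodepoly_crude rho1 ab K0 hr)) _.
  rewrite -[leLHS]mulrA ler_wpM2l // exprM; have -> : (2 * rho) ^+ 2 = 4 * rho ^+ 2 by ring.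
  rewrite exprMn -[leLHS]mulrA ler_piMr ?exprn_ge0 // -exprM rho_exp -expRM_natl -expRD.
  rewrite -[leRHS]expR0 ler_expR natrM.
  have h1 : l%:R * (eps ^+ 2 / 40) <= l%:R * (1 - al) by rewrite ler_wpM2l.
  have h2 : (4 * K%:R * eps) * eps ^+ 2 <= l%:R * eps ^+ 2 by rewrite ler_wpM2r ?sqr_ge0.
  have h3 : K%:R * lam <= K%:R * (eps ^+ 3 / 100) by rewrite ler_wpM2l // lam_le.
  lra.
rewrite -[leRHS]mulr1; apply: ler_pM; rewrite ?normc_ge0 ?expR_ge0 ?damp_le1 //.
apply: (@le_trans _ _ (4 ^+ K * expR (4 * K%:R * lam * (1 / 2 - 1 / pi + eps)))); last first.
  by rewrite ler_wpM2r ?expR_ge0 // ler_peMl ?exprn_ge0 ?ler1n.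
rewrite -ler_sqr ?nnegrE ?normc_ge0 ?mulr_ge0 ?exprn_ge0 ?expR_ge0 //.
apply: le_trans (nodepoly_avg rho1 ab K0 hr) _.
have [e eE] : {e : R | e = (rho - rho^-1) / 2} by exists ((rho - rho^-1) / 2).
rewrite -eE -/al.
have le_e : lam <= e.
  by rewrite eE rho_exp -expRN; apply: le_sinh; rewrite ltW.
have e_le : e <= eps ^+ 3 / 100.
  rewrite eE; have [d dE] : {d : R | d = eps ^+ 3 / 100} by exists (eps ^+ 3 / 100).
  have rE : rho = 1 + d by rewrite dE -rhoE.
  have d0 : 0 < d by rewrite dE divr_gt0 // exprn_gt0.
  have : 1 - d <= rho^-1 by rewrite -[leRHS]mul1r ler_pdivlMr // rE; nra.
  by rewrite -dE; move: rE => ->; lra.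
have bE : (b / rho) ^+ 2 = 1 - al ^+ 2.
  rewrite /al !expr_div_n -(divff (lt0r_neq0 (exprn_gt0 2 rho0))) -mulrBl -ab.
  by rewrite addrAC subrr add0r.
rewrite bE.
have [r2 rE] : {r2 : R | r2 = e ^+ 2 + (1 - al ^+ 2)} by exists (e ^+ 2 + (1 - al ^+ 2)).
rewrite -rE.
have al1 := al_le1.
have r20 : 0 <= r2.
  by rewrite rE addr_ge0 ?sqr_ge0 // -bE sqr_ge0.
have e0 : 0 < e by apply: lt_le_trans le_e.
have p83 : 8 / pi <= 4 :> R by rewrite ler_pdivrMr ?pi_gt0 //; have := pi_ge2 R; lra.
have p80 : 0 < 8 / pi :> R by rewrite divr_gt0 ?pi_gt0.
have P8 : 1 / pi = 8 / pi / 8 :> R by rewrite mulrAC divff.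
have lam_g := lam_ge; have e3' := e3; have e2' := e2; have ep0 := eps0; have ep1 := eps1.
have al2 : 1 - eps ^+ 2 / 40 <= al by lra.
have r2_le : r2 <= eps ^+ 2 / 19.
  have h1 : 1 - al ^+ 2 <= eps ^+ 2 / 20.
    have -> : 1 - al ^+ 2 = (1 - al) * (1 + al) by ring.
    by move: al1 => /andP[a1 a2]; nra.
  have h2 : e ^+ 2 <= eps ^+ 2 / 1000.
    have : e <= eps / 100 by move: e3' e2' => /andP[_ ?] /andP[_ ?]; lra.
    nra.
  rewrite rE; lra.
(* Here the cube in [rho] matters: [r2] is of order eps^2, so its square is of order eps^4, a small
   multiple of eps times lam. *)
have g_le : r2 ^+ 2 + 4 * (e * al) ^+ 2 - 8 / pi * (e * al) <= 8 * lam * (eps - 1 / pi).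
  rewrite P8; move: (8 / pi) p83 p80 => P p83 p80.
  have h1 : r2 ^+ 2 <= eps * (eps ^+ 3) / 361.
    have -> : eps * eps ^+ 3 / 361 = (eps ^+ 2 / 19) ^+ 2 by field.
    by rewrite lerXn2r ?nnegrE // divr_ge0 // exprn_ge0 // ltW.
  have h2 : eps * eps ^+ 3 <= 101 * (eps * lam).
    have := ler_wpM2l (ltW ep0) lam_g; lra.
  have h3 : (e * al) ^+ 2 <= e ^+ 2.
    by rewrite exprMn ler_piMr ?sqr_ge0 // -subr_ge0 -bE sqr_ge0.
  have h4 : e ^+ 2 <= eps ^+ 3 / 100 * (eps ^+ 3 / 100).
    by rewrite expr2; apply: ler_pM; rewrite // ltW.
  have h5 : eps ^+ 3 / 100 <= eps / 10000 by move: e3' e2' => /andP[_ ?] /andP[_ ?]; lra.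
  have h6 : eps ^+ 3 / 100 * (eps ^+ 3 / 100) <= eps ^+ 3 / 100 * (eps / 10000).
    by rewrite ler_wpM2l // divr_ge0 // exprn_ge0 // ltW.
  have h7 : lam * (1 - eps ^+ 2 / 40) <= e * al.
    apply: ler_pM => //; first exact: ltW.
    by move: e2' => /andP[_ ?]; lra.
  have h8 : P * (lam * (1 - eps ^+ 2 / 40)) <= P * (e * al) by rewrite ler_wpM2l // ltW.
  have h9a : lam * eps ^+ 2 <= lam * (eps / 10).
    by apply: ler_wpM2l; [exact: ltW | case/andP: e2'].
  have h9b : 0 <= lam * eps ^+ 2 by rewrite mulr_ge0 ?sqr_ge0 // ltW.
  have h9 := ler_pM (ltW p80) h9b p83 h9a.
  have h10 := mulr_gt0 lamp ep0.
  lra.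
have G1 : 1 + r2 ^+ 2 + 4 * (e * al) ^+ 2 - 8 / pi * (e * al) * (1 + r2) <=
    expR (8 * lam * (eps - 1 / pi)).
  apply: le_trans (expR_ge1Dx _); apply: le_trans (lerD (lexx 1) g_le).
  have al0 : 0 <= al by move: e2' => /andP[_ ?]; lra.
  have : 0 <= 8 / pi * (e * al) * r2.
    by apply: mulr_ge0 => //; apply: mulr_ge0; [exact: ltW | rewrite mulr_ge0 // ltW].
  lra.
have G0 : 0 <= 1 + r2 ^+ 2 + 4 * (e * al) ^+ 2 - 8 / pi * (e * al) * (1 + r2).
  have h1 : 8 / pi * (e * al) <= 1 / 2.
    have : e * al <= 1 / 8.
      have : e <= eps / 100 by move: e3' e2' => /andP[_ ?] /andP[_ ?]; lra.
      by move: al1 => /andP[_ a1]; nra.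
    by move: p80 p83; move: (8 / pi) => P p80 p83; nra.
  have h2 := ler_wpM2r (addr_ge0 ler01 r20) h1.
  have h3 : r2 <= 1 by move: e3' e2' => /andP[_ ?] /andP[_ ?]; lra.
  have := sqr_ge0 (e * al); have := sqr_ge0 r2; lra.
move: G1 G0; move: (1 + r2 ^+ 2 + 4 * (e * al) ^+ 2 - 8 / pi * (e * al) * (1 + r2)) => G G1 G0.
apply: le_trans (ler_wpM2l _ (_ : G ^+ K <= expR (8 * lam * (eps - 1 / pi)) ^+ K)) _.
- by rewrite exprn_ge0 // mulr_ge0 // sqr_ge0.
- by rewrite lerXn2r ?nnegrE ?expR_ge0.
have -> : (4 * rho ^+ 2) ^+ (2 * K) = (4 ^+ K) ^+ 2 * expR (4 * K%:R * lam).
  rewrite (exprMn (2 * K) 4) -!exprM (mulnC K) rho_exp -expRM_natl; congr (_ * expR _).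
  by rewrite !natrM; ring.
rewrite [leRHS]exprMn -[leLHS]mulrA ler_wpM2l ?exprn_ge0 //.
rewrite -!expRM_natl -expRD ler_expR; lra.
Qed.

End Near.
End Point.
End LowCircle.

(** * The small eigenvector and its size on circles *)

Section FullPoly.
Variable R : realType.
Local Notation C := R[i].
Local Notation pC p := (map_poly (real_complex R) p).
Local Notation s2 := (Num.sqrt 2 : R).

Lemma s2_sqr : s2 ^+ 2 = 2.
Proof. by rewrite sqr_sqrtr. Qed.

Lemma s2_bounds : 7 / 5 <= s2 <= 3 / 2.
Proof.
have h := s2_sqr; have s0 : 0 <= s2 by rewrite sqrtr_ge0.
by move: (s2) h s0 => s h s0; apply/andP; split; nra.
Qed.

(* The two linear factors are the eigenvectors of degree 1: the first one damps the growth away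
   from the positive axis, the second one switches the sign of the eigenvalue. *)
Definition upoly (K l e : nat) : {poly R} :=
  lowpart R K * (1 + (s2 - 1) *: 'X) ^+ l * (1 - (s2 + 1) *: 'X) ^+ e.

Lemma size_1DZX c : (size (1 + c *: 'X : {poly R})%R <= 2)%N.
Proof.
apply: leq_trans (size_polyD _ _) _; rewrite size_poly1 geq_max /=.
by apply: leq_trans (size_scale_leq _ _) _; rewrite size_polyX.
Qed.

Lemma ktrans1DZX c : ktrans 1 (1 + c *: 'X) = (1 + c)%:P + (1 - c) *: 'X :> {poly R}.
Proof.
have hX := @homogXn R 1 (1 + 'X) (1 - 'X) 1 isT; rewrite expr1 in hX.
rewrite linearD linearZ /= homog1 hX subnn expr0 mul1r !expr1 -!mul_polyC polyCD polyCB polyC1.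
ring.
Qed.

Lemma ktrans_pq i k :
  ktrans (2 * (i + k)) ((1 + 'X) ^+ i * ('X * (1 - 'X)) ^+ k) =
  2 ^+ (i + k) *: ((1 + 'X) ^+ i * ('X * (1 - 'X)) ^+ k) :> {poly R}.
Proof.
have s1 : (size (1 + 'X : {poly R})%R <= 3)%N by apply: leq_trans (size_1DX R) _.
have s3 : (size ('X * (1 - 'X) : {poly R})%R <= 3)%N.
  by apply: (@size_polyM_bound R 1 1); rewrite ?size_polyX ?size_1BX.
have hX1 := @homogXn R 2 (1 + 'X) (1 - 'X) 1 isT.
have hX2 := @homogXn R 2 (1 + 'X) (1 - 'X) 2 isT.
rewrite expr1 in hX1.
rewrite mulnDr homogM ?size_polyexp_bound // !homogX //.
have -> : ktrans 2 (1 + 'X) = 2 *: (1 + 'X) :> {poly R}.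
  by rewrite linearD /= homog1 hX1 -mul_polyC polyC_natr; ring.
have -> : ktrans 2 ('X * (1 - 'X)) = 2 *: ('X * (1 - 'X)) :> {poly R}.
  have -> : 'X * (1 - 'X) = 'X - 'X ^+ 2 :> {poly R} by ring.
  by rewrite linearB /= hX1 hX2 -mul_polyC polyC_natr; ring.
by rewrite !exprZn -scalerAl -scalerAr scalerA exprD.
Qed.

Lemma size_lowpart K : (size (lowpart R K) <= (3 * K).+1)%N.
Proof.
apply: leq_trans (size_sum _ _ _) _; apply/bigmax_leqP => k _.
apply: leq_trans (size_scale_leq _ _) _; have hk := ltn_ord k.
have s3 : (size ('X * (1 - 'X) : {poly R})%R <= 3)%N.
  by apply: (@size_polyM_bound R 1 1); rewrite ?size_polyX ?size_1BX.
apply: leq_trans (size_polyM_bound (size_polyexp_bound _ (size_1DX R)) (size_polyexp_bound _ s3)) _.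
lia.
Qed.

Lemma ktrans_lowpart K : ktrans (4 * K) (lowpart R K) = s2 ^+ (4 * K) *: lowpart R K.
Proof.
rewrite /lowpart linear_sum scaler_sumr; apply: eq_bigr => k _; rewrite linearZ /=.
have hk := ltn_ord k.
have E : (2 * K - k + k = 2 * K)%N by lia.
have -> : (4 * K = 2 * (2 * K - k + k))%N by lia.
by rewrite ktrans_pq !scalerA mulrC exprM s2_sqr.
Qed.

Lemma ktrans_upoly K l e :
  ktrans (4 * K + l + e) (upoly K l e) = ((-1) ^+ e * s2 ^+ (4 * K + l + e)) *: upoly K l e.
Proof.
have sl : (size (lowpart R K) <= (4 * K).+1)%N by apply: leq_trans (size_lowpart K) _; lia.
have sN : (size (1 - (s2 + 1) *: 'X : {poly R})%R <= 2)%N by rewrite -scaleNr size_1DZX.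
have sle := size_polyM_bound sl (size_polyexp_bound l (size_1DZX (s2 - 1))).
rewrite mul1n in sle.
have h1 : ktrans l ((1 + (s2 - 1) *: 'X) ^+ l) = s2 ^+ l *: (1 + (s2 - 1) *: 'X) ^+ l.
  rewrite -{1}[l]mul1n homogX ?size_1DZX // ktrans1DZX -exprZn; congr (_ ^+ l).
  rewrite -!mul_polyC; have -> : 1 - (s2 - 1) = s2 * (s2 - 1) by rewrite mulrBr mulr1 -expr2 s2_sqr; ring.
  have -> : 1 + (s2 - 1) = s2 by ring.
  by rewrite polyCM; ring.
have h2 : ktrans e ((1 - (s2 + 1) *: 'X) ^+ e) = ((-1) ^+ e * s2 ^+ e) *: (1 - (s2 + 1) *: 'X) ^+ e.
  rewrite -{1}[e]mul1n homogX // -scaleNr ktrans1DZX -exprMn -exprZn; congr (_ ^+ e).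
  rewrite -!mul_polyC.
  have -> : 1 - - (s2 + 1) = - s2 * - (s2 + 1) by rewrite mulrNN mulrDr mulr1 -expr2 s2_sqr; ring.
  have -> : 1 + - (s2 + 1) = - s2 by ring.
  by rewrite polyCM mulN1r; ring.
rewrite /upoly homogM //; last by rewrite -[e in X in (_ <= X)%N]mul1n size_polyexp_bound.
rewrite homogM //; last by rewrite -[l in X in (_ <= X)%N]mul1n size_polyexp_bound ?size_1DZX.
rewrite ktrans_lowpart h1 h2 -scalerAl -!scalerAr !scalerA.
by rewrite -scalerAl scalerA !exprD; congr (_ *: _); ring.
Qed.

Lemma size_upoly K l e : (size (upoly K l e) <= (3 * K + l + e).+1)%N.
Proof.
have sN : (size (1 - (s2 + 1) *: 'X : {poly R})%R <= 2)%N by rewrite -scaleNr size_1DZX.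
have h := size_polyM_bound (size_polyM_bound (size_lowpart K) (size_polyexp_bound l (size_1DZX (s2 - 1))))
  (size_polyexp_bound e sN).
by rewrite !mul1n in h.
Qed.

Lemma upoly0 K l e : (upoly K l e)`_0 = 1.
Proof.
have h0 : (hpoly R K)`_0 = 1.
  rewrite -horner_coef0 horner_prod big1 // => j _.
  by rewrite !hornerD hornerZ hornerC hornerXn hornerX mulr0 expr0n !addr0.
rewrite /upoly !coef0M -!horner_coef0 !horner_exp !hornerD hornerN !hornerZ !hornerX hornerC !mulr0.
rewrite oppr0 !addr0 !expr1n !mulr1 horner_sum big_ord_recl big1 ?addr0.
  by rewrite hornerZ hornerM !horner_exp hornerM hornerD hornerX hornerC mul0r addr0 expr1n expr0 !mulr1 h0.
move=> k _; rewrite hornerZ hornerM !horner_exp !hornerM hornerX mul0r.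
by rewrite /= expr0n mulr0 mulr0.
Qed.

Lemma upoly_normc K l e (y : C) : normc (pC (upoly K l e)).[y] =
  normc (pC (lowpart R K)).[y] * normc (1 + (s2 - 1)%:C%C * y) ^+ l *
  normc (1 - (s2 + 1)%:C%C * y) ^+ e.
Proof.
rewrite !rmorphM !rmorphXn !hornerM !horner_exp !normcM !normcX rmorphD rmorphB !rmorph1 /=.
by rewrite !map_polyZ /= map_polyX !hornerD hornerN !hornerZ hornerX hornerC.
Qed.

Section Point.
Variables (a b rho : R).
Hypotheses (rho1 : 1 <= rho) (ab : a ^+ 2 + b ^+ 2 = rho ^+ 2).
Let y : C := (a +i* b)%C.

Lemma normc_1DZ t : normc (1 + t%:C%C * y) ^+ 2 = 1 + t ^+ 2 * rho ^+ 2 + 2 * t * a.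
Proof. by rewrite normc_sqr /= -ab; ring. Qed.

Lemma a_le_rho : - rho <= a <= rho.
Proof.
have r0 : 0 <= rho by apply: le_trans rho1.
have h : a ^+ 2 <= rho ^+ 2 by rewrite -ab lerDl sqr_ge0.
apply/andP; split; nra.
Qed.

Lemma normc_1DZ_le t : 0 <= t -> normc (1 + t%:C%C * y) <= 1 + t * rho.
Proof.
have r0 : 0 <= rho by apply: le_trans rho1.
move=> t0; rewrite -ler_sqr ?nnegrE ?normc_ge0 ?addr_ge0 ?mulr_ge0 // normc_1DZ.
have := ler_wpM2l t0 (_ : a <= rho) => /(_ _) h.
by have {}h : t * a <= t * rho by [apply: h; case/andP: a_le_rho]; lra.
Qed.

Lemma normc_1BZ_le t : 0 <= t -> normc (1 - t%:C%C * y) <= 1 + t * rho.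
Proof.
have r0 : 0 <= rho by apply: le_trans rho1.
move=> t0; rewrite -ler_sqr ?nnegrE ?normc_ge0 ?addr_ge0 ?mulr_ge0 //.
have -> : normc (1 - t%:C%C * y) ^+ 2 = 1 + t ^+ 2 * rho ^+ 2 - 2 * t * a.
  by rewrite normc_sqr /= -ab; ring.
by have h : t * - rho <= t * a; [rewrite ler_wpM2l //; case/andP: a_le_rho | lra].
Qed.

Lemma upoly_far K l e : (0 < K)%N -> (e <= 1)%N ->
  normc (pC (upoly K l e)).[y] <=
  (8 * K%:R + 16) * ((1 + rho) / s2) ^+ (4 * K + l + e) *
    (1 - (s2 - 1) * ((rho - 1) / (rho + 1))) ^+ l.
Proof.
move=> K0 e1; have r0 : 0 <= rho by apply: le_trans rho1.
have /andP[sl su] := s2_bounds; have sq := s2_sqr.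
have rp : 0 < rho + 1 by lra.
rewrite upoly_normc (exprD _ (4 * K + l) e) (exprD _ (4 * K) l).
set G := (1 + rho) / s2; have G0 : 0 <= G by rewrite divr_ge0 ?addr_ge0 ?sqrtr_ge0.
set d := 1 - (s2 - 1) * ((rho - 1) / (rho + 1)).
(* The damping factor falls short of (1 + rho)/sqrt 2 by the factor [d], which is below 1 for rho >
   1; its l-th power is the exponential gain for coefficients well past the centre. *)
have dE : 1 + (s2 - 1) * rho = G * d.
  have s0 : s2 != 0 by rewrite gt_eqF //; lra.
  apply: (mulIf s0); rewrite /G /d.
  have -> : (1 + rho) / s2 * (1 - (s2 - 1) * ((rho - 1) / (rho + 1))) * s2 =
     1 + rho - (s2 - 1) * (rho - 1) by field; rewrite s0 gt_eqF.
  have -> : (1 + (s2 - 1) * rho) * s2 = s2 + s2 ^+ 2 * rho - s2 * rho by ring.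
  by rewrite sq; ring.
have d0 : 0 <= d.
  have : 0 < G by rewrite divr_gt0 //; lra.
  move=> Gp; rewrite -(pmulr_rge0 _ Gp) -dE addr_ge0 // mulr_ge0 //; lra.
have h1 := lowpart_far rho1 ab K0.
have h2 : normc (1 + (s2 - 1)%:C%C * y) ^+ l <= G ^+ l * d ^+ l.
  have k0 : 0 <= s2 - 1 by lra.
  have kr : 0 <= 1 + (s2 - 1) * rho by rewrite addr_ge0 // mulr_ge0.
  by rewrite -exprMn -dE lerXn2r ?nnegrE ?normc_ge0 // normc_1DZ_le.
have h3 : normc (1 - (s2 + 1)%:C%C * y) ^+ e <= 4 * G ^+ e.
  case: e e1 => [|[|//]] _; first by rewrite !expr0; lra.
  rewrite !expr1; apply: le_trans (normc_1BZ_le _) _; first by lra.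
  have hG : (1 + rho) / (3 / 2) <= G.
    by rewrite ler_pM2l ?lef_pV2 ?posrE; lra.
  have hr := ler_wpM2r r0 su; lra.
have K1 : 0 <= 2 * K%:R + 4 :> R by rewrite addr_ge0 ?mulr_ge0.
have h12 := ler_pM (normc_ge0 _) (exprn_ge0 l (normc_ge0 _)) h1 h2.
have h123 := ler_pM (mulr_ge0 (normc_ge0 _) (exprn_ge0 l (normc_ge0 _))) (exprn_ge0 e (normc_ge0 _)) h12 h3.
apply: le_trans h123 _; rewrite -/G le_eqVlt; apply/orP; left; apply/eqP.
by move: (G ^+ (4 * K)) (G ^+ l) (d ^+ l) (G ^+ e) => x1 x2 x3 x4; ring.
Qed.

Section Near.
Variables (eps : R) (K l : nat).
Hypotheses (eps0 : 0 < eps) (eps1 : eps <= 1 / 10) (K0 : (0 < K)%N).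
Hypotheses (rhoE : rho = 1 + eps ^+ 3 / 100) (hl : 4 * K%:R * eps <= l%:R).
Let damp := expR (- (l%:R * (1 - a / rho) / 5)).

Lemma lowpart_near : normc (pC (lowpart R K)).[y] * damp <=
  (2 * K%:R + 4) * 4 ^+ K * expR (4 * K%:R * ln rho * (1 / 2 - 1 / pi + eps)).
Proof.
set E := expR (4 * K%:R * ln rho * (1 / 2 - 1 / pi + eps)).
have E1 : 1 <= E.
  rewrite -[leLHS]expR0 ler_expR !mulr_ge0 ?ln_ge0 //.
  have p2 : 1 / pi <= 1 / 2 :> R by rewrite !div1r lef_pV2 ?posrE ?pi_gt0 // pi_ge2.
  by have := eps0; lra.
have d0 : 0 <= damp by exact: expR_ge0.
have H4 : 0 <= 4 ^+ K :> R by rewrite exprn_ge0.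
have hp := high_part_near rho1 ab eps0 eps1 rhoE hl.
pose B := if normc (y * (1 - y)) <= normc (1 + y) then normc (pC (nodepoly R K)).[y] else 0.
have B0 : 0 <= B by rewrite /B; case: ifP; rewrite ?normc_ge0.
have hB : normc (y * (1 - y)) <= normc (1 + y) -> normc (pC (nodepoly R K)).[y] <= B.
  by rewrite /B => ->.
have Bd : B * damp <= 2 * 4 ^+ K * E.
  rewrite /B; case: ifP => [h|_]; last by rewrite mul0r !mulr_ge0 // (le_trans _ E1).
  exact: (nodepoly_near rho1 ab eps0 eps1 K0 rhoE hl h).
apply: le_trans (ler_wpM2r d0 (lowpart_le K0 B0 hB)) _.
rewrite mulrDl -[X in _ + X]mulrA.
have K1 : 0 <= 2 * K.+1%:R :> R by rewrite mulr_ge0.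
move: hp Bd H4; rewrite -/damp; move: (_ ^+ K * damp) (B * damp) (4 ^+ K) => z1 z2 z3 hp Bd H4.
have := ler_wpM2l K1 hp.
have : 2 * K.+1%:R * z3 <= 2 * K.+1%:R * z3 * E by rewrite ler_peMr ?mulr_ge0.
by rewrite -natr1; lra.
Qed.

Lemma normc_1DX_near : normc (1 + (s2 - 1)%:C%C * y) ^+ l <= s2 ^+ l * rho ^+ l * damp.
Proof.
have r0 : 0 < rho by apply: lt_le_trans rho1.
have /andP[sl su] := s2_bounds.
have -> : damp = expR (- ((1 - a / rho) / 5)) ^+ l by rewrite -expRM_natl /damp; congr expR; ring.
rewrite -!exprMn lerXn2r ?nnegrE ?normc_ge0 ?mulr_ge0 ?expR_ge0 ?sqrtr_ge0 ?(ltW r0) //.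
rewrite -ler_sqr ?nnegrE ?normc_ge0 ?mulr_ge0 ?expR_ge0 ?sqrtr_ge0 ?(ltW r0) //.
rewrite normc_1DZ exprMn -[expR _ ^+ 2]expRM_natl.
have [al aE] : {al : R | al = a / rho} by exists (a / rho).
have -> : a = rho * al by rewrite aE mulrC divfK // gt_eqF.
have alr : al <= 1 by rewrite aE ler_pdivrMr // mul1r; case/andP: a_le_rho.
have rE : rho <= 11 / 10.
  rewrite rhoE; have h : eps ^+ 3 <= 1 by rewrite exprn_ile1 ?(ltW eps0) //; have := eps1; lra.
  lra.
have -> : rho * al / rho = al by rewrite mulrAC divff ?gt_eqF // mul1r.
apply: (@le_trans _ _ ((s2 * rho) ^+ 2 * (1 + 2%:R * - ((1 - al) / 5)))); last first.
  by rewrite ler_wpM2l ?sqr_ge0 // expR_ge1Dx.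
have r1 := rho1.
have [t tE] : {t : R | t = (s2 - 1) * rho} by exists ((s2 - 1) * rho).
have t1 : 2 / 5 <= t by rewrite tE; nra.
have t2 : t <= 3 / 5 by rewrite tE; nra.
have h1 : (1 + t) ^+ 2 <= (s2 * rho) ^+ 2.
  rewrite lerXn2r ?nnegrE ?mulr_ge0 ?sqrtr_ge0 ?(ltW r0) ?addr_ge0 //; last by rewrite tE; lra.
  by lra.
have -> : 1 + (s2 - 1) ^+ 2 * rho ^+ 2 + 2 * (s2 - 1) * (rho * al) = 1 + t ^+ 2 + 2 * t * al.
  by rewrite tE; ring.
have al2 : -1 <= al.
  rewrite aE ler_pdivlMr // mulN1r; case/andP: a_le_rho => h _; lra.
have h2 : 0 <= 1 + 2%:R * - ((1 - al) / 5) by lra.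
have := ler_wpM2r h2 h1.
have h3 : 2 * (1 + t) ^+ 2 / 5 <= 2 * t by nra.
have : (1 - al) * (2 * (1 + t) ^+ 2 / 5) <= (1 - al) * (2 * t) by rewrite ler_wpM2l // subr_ge0.
lra.
Qed.

Lemma upoly_near e : (e <= 1)%N ->
  normc (pC (upoly K l e)).[y] <=
  (8 * K%:R + 16) * s2 ^+ (4 * K + l + e) *
    expR (ln rho * (4 * K%:R * (1 / 2 - 1 / pi + eps) + l%:R)).
Proof.
move=> e1; rewrite upoly_normc; have /andP[sl su] := s2_bounds.
have r0 : 0 < rho by apply: lt_le_trans rho1.
have h1 := lowpart_near; have h2 := normc_1DX_near.
have h3 : normc (1 - (s2 + 1)%:C%C * y) ^+ e <= 4 * s2 ^+ e.
  case: e e1 => [|[|//]] _; first by rewrite !expr0; lra.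
  rewrite !expr1; apply: le_trans (normc_1BZ_le _) _; first by lra.
  have rE : rho <= 11 / 10.
    rewrite rhoE; have h : eps ^+ 3 <= 1 by rewrite exprn_ile1 ?(ltW eps0) //; have := eps1; lra.
    lra.
  have := ler_wpM2l (_ : 0 <= s2 + 1) rE => /(_ _) h; have {}h : (s2 + 1) * rho <= (s2 + 1) * (11 / 10) by apply: h; lra.
  lra.
have d0 : 0 < damp by exact: expR_gt0.
have n1 := normc_ge0 (pC (lowpart R K)).[y].
have n2 := exprn_ge0 l (normc_ge0 (1 + (s2 - 1)%:C%C * y)).
have n3 := exprn_ge0 e (normc_ge0 (1 - (s2 + 1)%:C%C * y)).
have q0 : 0 <= s2 ^+ l * rho ^+ l by rewrite mulr_ge0 ?exprn_ge0 ?sqrtr_ge0 ?(ltW r0).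
have h12 : normc (pC (lowpart R K)).[y] * normc (1 + (s2 - 1)%:C%C * y) ^+ l <=
   (2 * K%:R + 4) * 4 ^+ K * expR (4 * K%:R * ln rho * (1 / 2 - 1 / pi + eps)) * (s2 ^+ l * rho ^+ l).
  apply: le_trans (ler_wpM2l n1 h2) _.
  by rewrite mulrCA mulrC; apply: ler_wpM2r.
have h123 := ler_pM (mulr_ge0 n1 n2) n3 h12 h3.
apply: le_trans h123 _.
have -> : ln rho * (4 * K%:R * (1 / 2 - 1 / pi + eps) + l%:R) =
  4 * K%:R * ln rho * (1 / 2 - 1 / pi + eps) + l%:R * ln rho by ring.
rewrite expRD expRM_natl lnK ?posrE // (exprD s2 (4 * K + l) e) (exprD s2 (4 * K) l) [s2 ^+ (4 * K)]exprM.
have -> : s2 ^+ 4 = 4 by rewrite (exprM _ 2 2) s2_sqr; ring.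
move: (4 ^+ K) (expR _) => z1 z2.
rewrite le_eqVlt; apply/orP; left; apply/eqP; ring.
Qed.

End Near.
End Point.
End FullPoly.

(** * Coefficients of the small eigenvector against binomial tails *)

Section CoefBounds.
Variable R : realType.
Local Notation C := R[i].
Local Notation pC p := (map_poly (real_complex R) p).
Local Notation s2 := (Num.sqrt 2 : R).

Lemma pow_exp_small (c B : R) (k : nat) : 0 < c -> 0 <= B ->
  \forall n \near \oo, B * n%:R ^+ k * expR (- (c * n%:R)) <= 1.
Proof.
move=> c0 B0; near=> n.
have n0 : (0 < n)%N by near: n; exact: nbhs_infty_gt.
have nR : 0 < n%:R :> R by rewrite ltr0n.
have k1 : 0 < k.+1%:R :> R by rewrite ltr0n.
have big : B * (k.+1%:R / c) ^+ k.+1 < n%:R by near: n; exact: nbhs_infty_gtr.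
rewrite expRN ler_pdivrMr ?expR_gt0 // mul1r.
have -> : c * n%:R = k.+1%:R * (c * n%:R / k.+1%:R) by rewrite [RHS]mulrC divfK // gt_eqF.
rewrite expRM_natl; set x := c * n%:R / k.+1%:R.
have x0 : 0 < x by rewrite divr_gt0 ?mulr_gt0.
apply: (@le_trans _ _ (x ^+ k.+1)); last first.
  rewrite lerXn2r ?nnegrE ?expR_ge0 ?(ltW x0) //.
  by apply: le_trans (expR_ge1Dx x); rewrite lerDr.
have -> : x ^+ k.+1 = n%:R * n%:R ^+ k * ((k.+1%:R / c) ^+ k.+1)^-1.
  rewrite -exprS -exprVn -exprMn invf_div /x; congr (_ ^+ _).
  by rewrite mulrAC mulrC mulrA.
rewrite ler_pdivlMr ?exprn_gt0 ?divr_gt0 // mulrAC ler_wpM2r ?exprn_ge0 ?(ltW nR) //.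
exact: ltW.
Unshelve. all: by end_near.
Qed.

Definition btail (n i : nat) : R := \sum_(i <= j < n.+1) 'C(n, j)%:R.

Lemma btail_ge0 n i : 0 <= btail n i.
Proof. exact: sumr_ge0. Qed.

Lemma btail_ge_bin n i k : (i <= k)%N -> (k <= n)%N -> 'C(n, k)%:R <= btail n i.
Proof.
move=> ik kn; rewrite /btail (big_cat_nat (n := k)) //=; last by lia.
rewrite (@big_ltn _ _ _ k) // addrCA lerDl addr_ge0 //; exact: sumr_ge0.
Qed.

(* For [x = k / (n - k)] the largest term of [(1 + x)^n] is the [k]-th one. *)
Lemma bin_peak n k (x : R) : (k < n)%N -> x * (n - k)%:R = k%:R -> 0 < x ->
  (1 + x) ^+ n <= n.+1%:R * ('C(n, k)%:R * x ^+ k).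
Proof.
move=> kn xE x0; pose f j : R := 'C(n, j)%:R * x ^+ j.
have f0 j : 0 <= f j by rewrite mulr_ge0 ?exprn_ge0 // ltW.
have step j : (j < n)%N -> j.+1%:R * f j.+1 = (n - j)%:R * x * f j.
  move=> jn; rewrite /f exprS.
  have : (j.+1 * 'C(n, j.+1))%:R = ((n - j) * 'C(n, j))%:R :> R by rewrite mul_bin_left.
  rewrite !natrM => E; have -> : j.+1%:R * ('C(n, j.+1)%:R * (x * x ^+ j)) = j.+1%:R * 'C(n, j.+1)%:R * x * x ^+ j by ring.
  rewrite E; ring.
have nk : 0 < (n - k)%:R :> R by rewrite ltr0n subn_gt0.
have up j : (j < k)%N -> f j <= f j.+1.
  move=> jk; have jn : (j < n)%N by lia.
  have j0 : 0 < j.+1%:R :> R by rewrite ltr0n.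
  rewrite -(ler_pM2l j0) step // ler_wpM2r //.
  have h1 : (n - k)%:R <= (n - j)%:R :> R by rewrite ler_nat; lia.
  have h2 := ler_wpM2r (ltW x0) h1; apply: le_trans h2.
  by rewrite mulrC xE ler_nat.
have down j : (k <= j)%N -> (j < n)%N -> f j.+1 <= f j.
  move=> kj jn; have j0 : 0 < j.+1%:R :> R by rewrite ltr0n.
  rewrite -(ler_pM2l j0) step // ler_wpM2r //.
  have h1 : (n - j)%:R <= (n - k)%:R :> R by rewrite ler_nat; lia.
  apply: le_trans (ler_wpM2r (ltW x0) h1) _.
  by rewrite mulrC xE ler_nat; lia.
have fk j : (j <= n)%N -> f j <= f k.
  move=> jn; have [jk|kj] := leqP j k.
    have : forall d, (d <= k)%N -> f (k - d)%N <= f k.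
      elim=> [|d IH] dk; first by rewrite subn0.
      apply: le_trans (IH _); last by lia.
      have := up (k - d.+1)%N; have -> : (k - d.+1).+1 = (k - d)%N by lia.
      by apply; lia.
    by move=> /(_ (k - j)%N); rewrite subKn //; apply; lia.
  have : forall d, (k + d <= n)%N -> f (k + d)%N <= f k.
    elim=> [|d IH] dk; first by rewrite addn0.
    apply: le_trans (IH _); last by lia.
    by rewrite addnS; apply: down; lia.
  by move=> /(_ (j - k)%N); rewrite subnKC; [apply; lia | lia].
have -> : n.+1%:R * ('C(n, k)%:R * x ^+ k) = \sum_(j < n.+1) f k.
  by rewrite sumr_const card_ord [LHS]mulr_natl.
rewrite exprDn; apply: ler_sum => j _.
have jn : (j <= n)%N by rewrite -ltnS.
by rewrite expr1n mul1r -[leLHS]mulr_natl; apply: fk.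
Qed.

Lemma upoly_coef_near eps K l e n i : 0 < eps -> eps <= 1 / 10 -> (0 < K)%N -> (e <= 1)%N ->
  4 * K%:R * eps <= l%:R -> n = (4 * K + l + e)%N -> l%:R <= 3 * eps * n%:R ->
  `|(upoly R K l e)`_i| <= (8 * K%:R + 16) * s2 ^+ n *
    expR (ln (1 + eps ^+ 3 / 100) * (n%:R * (1 / 2 - 1 / pi + 4 * eps) - i%:R)).
Proof.
move=> eps0 eps1 K0 e1 hl nE lle.
set rho := 1 + eps ^+ 3 / 100.
have rho1 : 1 <= rho by rewrite lerDl divr_ge0 // exprn_ge0 // ltW.
have r0 : 0 < rho by apply: lt_le_trans rho1.
have key := @coef_norm_le R (pC (upoly R K l e)) rho
  ((8 * K%:R + 16) * s2 ^+ n * expR (ln rho * (4 * K%:R * (1 / 2 - 1 / pi + eps) + l%:R))) i r0.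
rewrite coef_map normcR in key.
rewrite -(ler_pM2r (exprn_gt0 i r0)); apply: le_trans (key _) _.
  move=> -[a b] /(congr1 (fun x => x ^+ 2)); rewrite normc_sqrE => ab.
  by rewrite nE; apply: (upoly_near rho1 ab eps0 eps1 K0 erefl hl e1).
have K16 : 0 <= (8 * K%:R + 16) * s2 ^+ n.
  by rewrite mulr_ge0 ?exprn_ge0 ?sqrtr_ge0 // addr_ge0 ?mulr_ge0.
rewrite -[leRHS]mulrA; apply: ler_wpM2l => //.
have -> : rho ^+ i = expR (ln rho * i%:R) by rewrite mulrC expRM_natl lnK.
rewrite -expRD ler_expR -mulrDr ler_wpM2l ?ln_ge0 // subrK.
have h : 4 * K%:R <= n%:R :> R by rewrite -natrM ler_nat; lia.
have p2 : 0 <= 1 / 2 - 1 / pi + eps :> R.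
  have p2 : 1 / pi <= 1 / 2 :> R by rewrite !div1r lef_pV2 ?posrE ?pi_gt0 // pi_ge2.
  lra.
have := ler_wpM2r p2 h; lra.
Qed.

Lemma upoly_coef_far K l e n i (rho : R) : 1 <= rho -> (0 < K)%N -> (e <= 1)%N ->
  n = (4 * K + l + e)%N ->
  `|(upoly R K l e)`_i| * rho ^+ i <= (8 * K%:R + 16) * ((1 + rho) / s2) ^+ n *
     (1 - (s2 - 1) * ((rho - 1) / (rho + 1))) ^+ l.
Proof.
move=> rho1 K0 e1 ->; have r0 : 0 < rho by apply: lt_le_trans rho1.
rewrite -normcR -coef_map; apply: coef_norm_le => // -[a b].
move=> /(congr1 (fun x => x ^+ 2)); rewrite normc_sqrE => ab.
exact: (upoly_far rho1 ab).
Qed.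

(** Combines [bin_peak] with 1 + x >= 2 sqrt x. As x >= 1 means k >= n/2, replacing x by the larger
    [rho0] only decreases the left side. *)
Lemma bin_center n k (rho0 : R) (x := k%:R / (n - k)%:R : R) : (k < n)%N -> 1 <= x -> x <= rho0 ->
  2 ^+ n * expR (ln rho0 * (n%:R / 2 - k%:R)) <= n.+1%:R * 'C(n, k)%:R.
Proof.
move=> kn x1 xr; have x0 : 0 < x by apply: lt_le_trans x1.
have nk : 0 < (n - k)%:R :> R by rewrite ltr0n subn_gt0.
have xE : x * (n - k)%:R = k%:R by rewrite divfK // gt_eqF.
have xn : n%:R / 2 - k%:R <= 0 :> R.
  have h := ler_wpM2r (ltW nk) x1; rewrite mul1r xE ler_nat in h.
  have : n%:R <= (2 * k)%:R :> R by rewrite ler_nat; lia.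
  rewrite natrM; lra.
rewrite -(ler_pM2r (exprn_gt0 k x0)) -[leRHS]mulrA; apply: le_trans (bin_peak kn xE x0).
have -> : x ^+ k = expR (ln x * k%:R) by rewrite mulrC expRM_natl lnK.
have h1 : expR (ln rho0 * (n%:R / 2 - k%:R)) <= expR (ln x * (n%:R / 2 - k%:R)).
  by rewrite ler_expR ler_wnM2r // ler_ln ?posrE // (lt_le_trans x0).
have p2 : 0 <= 2 ^+ n :> R by rewrite exprn_ge0.
apply: le_trans (ler_wpM2r (expR_ge0 _) (ler_wpM2l p2 h1)) _.
rewrite -mulrA -expRD -mulrDr subrK.
have -> : ln x * (n%:R / 2) = n%:R * (ln x / 2) by ring.
rewrite expRM_natl -exprMn lerXn2r ?nnegrE ?mulr_ge0 ?expR_ge0 ?addr_ge0 ?(ltW x0) //.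
have : expR (ln x / 2) ^+ 2 = x.
  by rewrite -expRM_natl mulrC divfK ?pnatr_eq0 // lnK.
move: (expR _) => t <-; have := sqr_ge0 (1 - t); lra.
Qed.

(** The radius x = k/(n - k) minimises (1 + x)^n / x^k, so by [bin_peak] the Cauchy estimate at this
    radius loses only a factor n + 1 against the binomial coefficient. *)
Lemma upoly_coef_far_bin K l e n k (c : R) (x := k%:R / (n - k)%:R : R) : (k < n)%N -> 1 <= x ->
  (0 < K)%N -> (e <= 1)%N -> n = (4 * K + l + e)%N -> 0 <= c ->
  c <= (s2 - 1) * ((x - 1) / (x + 1)) ->
  `|(upoly R K l e)`_k| * s2 ^+ n <= (8 * K%:R + 16) * (n.+1%:R * 'C(n, k)%:R) * expR (- (c * l%:R)).
Proof.
move=> kn x1 K0 e1 nE c0 hc; have x0 : 0 < x by apply: lt_le_trans x1.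
have nk : 0 < (n - k)%:R :> R by rewrite ltr0n subn_gt0.
have xE : x * (n - k)%:R = k%:R by rewrite divfK // gt_eqF.
have s20 : 0 < s2 ^+ n by exact: sqrt2_gt0.
have K16 : 0 <= 8 * K%:R + 16 :> R by rewrite addr_ge0 ?mulr_ge0.
have far := upoly_coef_far k x1 K0 e1 nE.
rewrite -(ler_pM2r (exprn_gt0 k x0)) mulrAC.
apply: le_trans (ler_wpM2r (ltW s20) far) _.
have d0 : 0 <= 1 - (s2 - 1) * ((x - 1) / (x + 1)).
  have /andP[sl su] := s2_bounds R.
  have h : (x - 1) / (x + 1) <= 1 by rewrite ler_pdivrMr; lra.
  have h0 : 0 <= (x - 1) / (x + 1) by rewrite divr_ge0; lra.
  by nra.
have dl : (1 - (s2 - 1) * ((x - 1) / (x + 1))) ^+ l <= expR (- (c * l%:R)).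
  have -> : - (c * l%:R) = l%:R * - c by ring.
  rewrite expRM_natl lerXn2r ?nnegrE ?expR_ge0 //; apply: le_trans (expR_ge1Dx _); lra.
have -> : (8 * K%:R + 16) * ((1 + x) / s2) ^+ n * (1 - (s2 - 1) * ((x - 1) / (x + 1))) ^+ l * s2 ^+ n =
  (8 * K%:R + 16) * (1 + x) ^+ n * (1 - (s2 - 1) * ((x - 1) / (x + 1))) ^+ l.
  rewrite expr_div_n; move: (_ ^+ l) => z; move: (s2 ^+ n) s20 => w w0.
  by field; rewrite gt_eqF.
have hp := bin_peak kn xE x0.
have h1 := ler_pM (mulr_ge0 K16 (exprn_ge0 n (addr_ge0 ler01 (ltW x0)))) (exprn_ge0 l d0)
  (ler_wpM2l K16 hp) dl.
apply: le_trans h1 _; rewrite le_eqVlt; apply/orP; left; apply/eqP.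
by move: (x ^+ k) (expR _) => z w; ring.
Qed.

Lemma exists_parameters (eps : R) n e : 0 < eps -> eps <= 1 / 20 -> (e <= 1)%N ->
  4 < eps * n%:R -> 20 < n%:R :> R ->
  exists K l, [/\ (0 < K)%N, n = (4 * K + l + e)%N, 4 * K%:R * eps <= l%:R,
    eps * n%:R <= l%:R & l%:R <= 3 * eps * n%:R] /\ 8 * K%:R + 16 <= 20 * n%:R :> R.
Proof.
move=> eps0 eps1 e1 n4 n20.
(* [K] is the integer part of this number; about 2 eps n is left for [l], and the rounding stays
   within eps n on either side. *)
have X0 : 0 <= (1 - 2 * eps) * n%:R / 4 by rewrite divr_ge0 // mulr_ge0 //; lra.
have /andP[Kle Kgt] := truncn_itv X0.
move: (Num.truncn _) Kle Kgt => K Kle Kgt; rewrite -[K.+1%:R]natr1 in Kgt.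
have KR4 : 4 * K%:R <= (1 - 2 * eps) * n%:R by lra.
have KR5 : (1 - 2 * eps) * n%:R < 4 * K%:R + 4 by lra.
have en : eps * n%:R <= 1 / 20 * n%:R by rewrite ler_wpM2r.
have K0 : (0 < K)%N by rewrite -(ltr0n R); lra.
have eR : 0 <= (e%:R : R) <= 1 by rewrite ler0n (ler_nat R e 1).
have K4n : (4 * K + e <= n)%N.
  by rewrite -(ler_nat R) (natrD _ (4 * K)) (natrM _ 4); move: eR => /andP[_ ?]; lra.
have nE : n = (4 * K + (n - 4 * K - e) + e)%N by move: K4n; clear; lia.
have nER : n%:R = 4 * K%:R + (n - 4 * K - e)%:R + e%:R :> R by rewrite {1}nE (natrD _ (4 * K + _)) (natrD _ (4 * K)) (natrM _ 4).
exists K, (n - 4 * K - e)%N; move: (n - 4 * K - e)%N nE nER => l nE nER.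
have l_ge : eps * n%:R <= l%:R by move: eR => /andP[_ ?]; lra.
have l_le : l%:R <= 3 * eps * n%:R by move: eR => /andP[? _]; lra.
split; last lra.
split => //; apply: le_trans l_ge; rewrite mulrC ler_wpM2l ?(ltW eps0) //.
by have := mulr_ge0 (ltW eps0) (ler0n R n); lra.
Qed.

(** The exponent in the bound for [q] lies below that of the binomial coefficient by at least lam
    eps n. If k = i this comes from 1/pi >= 1/4 >= 5 eps; if k is about n/2, it comes from the
    difference between 6 eps and 4 eps, minus 1/2 for rounding. *)
Lemma small_by_center (eps lam w q B T C0 : R) (n i k : nat) :
  0 < eps -> eps <= 1 / 20 -> 0 < lam -> 0 < w -> w ^+ 2 = 2 ^+ n -> 1 <= eps * n%:R ->
  1 <= n%:R :> R -> 0 <= C0 -> C0 <= 20 * n%:R -> 0 <= q ->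
  q <= C0 * w * expR (lam * (n%:R * (1 / 2 - 1 / pi + 4 * eps) - i%:R)) ->
  2 ^+ n * expR (lam * (n%:R / 2 - k%:R)) <= n.+1%:R * B -> B <= T ->
  k = i \/ 2 * k%:R <= n%:R + 1 :> R -> n%:R * (1 / 2 - 1 / pi + 6 * eps) <= i%:R ->
  80 * n%:R ^+ 7 * expR (- (lam * eps * n%:R)) <= 1 ->
  n%:R ^+ 5 * q <= T / w.
Proof.
move=> eps0 eps1 lam0 w0 w2 en n1 C0p C0n q0 hq hB BT hk hi small.
have ip : 1 / 4 <= 1 / pi :> R.
  by rewrite !div1r lef_pV2 ?posrE ?pi_gt0 //; have := pihalf_lt2 R; lra.
have ex : n%:R * (1 / 2 - 1 / pi + 4 * eps) - i%:R - (n%:R / 2 - k%:R) <= - (eps * n%:R).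
  case: hk => [->|hk]; last by lra.
  have h : n%:R * (- (1 / pi) + 4 * eps) <= n%:R * - eps by rewrite ler_wpM2l //; lra.
  lra.
rewrite ler_pdivlMr //.
have nn : 0 < n.+1%:R :> R by rewrite ltr0n.
have n5 : 0 <= n%:R ^+ 5 :> R by rewrite exprn_ge0.
have T_ge : 2 ^+ n * expR (lam * (n%:R / 2 - k%:R)) / n.+1%:R <= T.
  by rewrite ler_pdivrMr // (le_trans hB) // mulrC ler_wpM2r // ltW.
apply: le_trans T_ge; rewrite ler_pdivlMr //.
set E2 := expR (lam * (n%:R / 2 - k%:R)).
have E2p : 0 < E2 by exact: expR_gt0.
have E1 : expR (lam * (n%:R * (1 / 2 - 1 / pi + 4 * eps) - i%:R)) <= E2 * expR (- (lam * eps * n%:R)).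
  rewrite -expRD ler_expR; have := ler_wpM2l (ltW lam0) ex; lra.
set E3 := expR (- (lam * eps * n%:R)) in E1 small; have E3p : 0 < E3 by exact: expR_gt0.
have hq2 : q <= 20 * n%:R * w * (E2 * E3).
  apply: le_trans hq _; apply: ler_pM => //; rewrite ?mulr_ge0 ?expR_ge0 ?(ltW w0) //.
  by rewrite ler_wpM2r // ltW.
have hn2 : n.+1%:R <= 2 * n%:R :> R by rewrite -natr1; lra.
have w2n : 0 <= 2 ^+ n * E2 by rewrite mulr_ge0 ?exprn_ge0 // ltW.
apply: (@le_trans _ _ (n%:R ^+ 5 * (20 * n%:R * w * (E2 * E3)) * w * (2 * n%:R))).
  apply: ler_pM => //.
  - by rewrite mulr_ge0 ?(ltW w0) // mulr_ge0.
  - by rewrite ler_wpM2r ?(ltW w0) // ler_wpM2l.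
have -> : n%:R ^+ 5 * (20 * n%:R * w * (E2 * E3)) * w * (2 * n%:R) =
   (2 ^+ n * E2) * (40 * n%:R ^+ 7 * E3) by rewrite -w2; ring.
rewrite -[leRHS]mulr1 ler_wpM2l //; apply: le_trans small.
by rewrite ler_wpM2r ?(ltW E3p) // ler_wpM2r ?exprn_ge0 // ler_nat.
Qed.

Lemma small_by_far (eps c w q B T C0 : R) (n l : nat) :
  0 < c -> 0 < w -> 1 <= n%:R :> R -> 0 <= C0 -> C0 <= 20 * n%:R ->
  eps * n%:R <= l%:R -> 0 <= B -> B <= T ->
  q * w <= C0 * (n.+1%:R * B) * expR (- (c * l%:R)) ->
  80 * n%:R ^+ 7 * expR (- (c * eps * n%:R)) <= 1 ->
  n%:R ^+ 5 * q <= T / w.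
Proof.
move=> c0 w0 n1 C0p C0n hl B0 BT hq small.
rewrite ler_pdivlMr // -mulrA; apply: le_trans BT.
have n5 : 0 <= n%:R ^+ 5 :> R by rewrite exprn_ge0.
have E1 : expR (- (c * l%:R)) <= expR (- (c * eps * n%:R)).
  by rewrite ler_expR lerN2 -mulrA ler_wpM2l // ltW.
move: (expR (- (c * eps * n%:R))) (expR_ge0 (- (c * eps * n%:R))) E1 small => E Ep E1 small.
have hn2 : n.+1%:R <= 2 * n%:R :> R by rewrite -[n.+1%:R]natr1; lra.
have h1 : C0 * (n.+1%:R * B) <= 20 * n%:R * (2 * n%:R * B).
  by apply: ler_pM; rewrite ?mulr_ge0 // ler_wpM2r.
have h2 : q * w <= 20 * n%:R * (2 * n%:R * B) * E.
  by apply: le_trans hq _; apply: ler_pM; rewrite ?mulr_ge0 ?expR_ge0.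
apply: le_trans (ler_wpM2l n5 h2) _.
have -> : n%:R ^+ 5 * (20 * n%:R * (2 * n%:R * B) * E) = B * (40 * n%:R ^+ 7 * E) by ring.
rewrite -[leRHS]mulr1 ler_wpM2l //; apply: le_trans small.
by rewrite ler_wpM2r // ler_wpM2r ?exprn_ge0 // ler_nat.
Qed.

Lemma cayley_mono (t d x : R) : 0 <= t -> 0 < d -> 1 + d < x ->
  t * (d / (2 + d)) <= t * ((x - 1) / (x + 1)).
Proof.
move=> t0 d0 dx; apply: ler_wpM2l => //.
have x1 : 0 < x + 1 by lra.
have d2 : 0 < 2 + d by lra.
rewrite ler_pdivrMr // mulrAC ler_pdivlMr //; lra.
Qed.

Lemma uphalf_ratio (dl : R) n : 0 < dl -> 4 * dl + 3 < n%:R * dl ->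
  (uphalf n)%:R <= (1 + dl) * (n - uphalf n)%:R :> R.
Proof.
move=> d0 hn; have h : (2 * uphalf n <= n.+1)%N by rewrite uphalf_half; have := odd_double_half n; lia.
have h1 : (uphalf n <= n)%N by rewrite uphalf_half; have := odd_double_half n; lia.
rewrite natrB //.
have : (2 * uphalf n)%:R <= n.+1%:R :> R by rewrite ler_nat.
rewrite natrM -[n.+1%:R]natr1; move: (uphalf n)%:R n%:R hn => u m hn hu.
have := ler_wpM2r (ltW d0) hu; lra.
Qed.

(** The factor n^5 leaves room for later operations: summing up to n coefficients, and multiplying
    by a constant term of order n^3. *)
Lemma exists_small_poly (eps : R) e : 0 < eps -> eps <= 1 / 20 -> (e <= 1)%N ->
  \forall n \near \oo, exists Q : {poly R},
    [/\ (size Q <= n.+1)%N, ktrans n Q = ((-1) ^+ e * s2 ^+ n) *: Q, Q`_0 = 1,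
        forall i, `|Q`_i| <= 20 * n%:R * s2 ^+ n &
        forall i, n%:R * (1 / 2 - 1 / pi + 6 * eps) <= i%:R ->
          n%:R ^+ 5 * `|Q`_i| <= btail n i / s2 ^+ n].
Proof.
move=> eps0 eps20 e1.
have eps1 : eps <= 1 / 10 by lra.
have /andP[sl su] := s2_bounds R.
have [dl dlE] : {dl : R | dl = eps ^+ 3 / 100} by exists (eps ^+ 3 / 100).
have dl0 : 0 < dl by rewrite dlE divr_gt0 // exprn_gt0.
have rho1 : 1 < 1 + dl by rewrite ltrDl.
have lam0 : 0 < ln (1 + dl) by rewrite ln_gt0.
pose c := (s2 - 1) * (dl / (2 + dl)).
have c0 : 0 < c by rewrite mulr_gt0 ?divr_gt0 ?subr_gt0 ?addr_gt0 // (lt_le_trans _ sl) //; lra.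
near=> n.
have n4 : 4 / eps < n%:R by near: n; exact: nbhs_infty_gtr.
have n6 : 4 + 3 / dl < n%:R by near: n; exact: nbhs_infty_gtr.
have n20 : 20 < n%:R :> R by near: n; exact: nbhs_infty_gtr.
have small1 : 80 * n%:R ^+ 7 * expR (- (ln (1 + dl) * eps * n%:R)) <= 1.
  by near: n; apply: pow_exp_small => //; rewrite mulr_gt0.
have small2 : 80 * n%:R ^+ 7 * expR (- (c * eps * n%:R)) <= 1.
  by near: n; apply: pow_exp_small => //; rewrite mulr_gt0.
have n4' : 4 < eps * n%:R by rewrite mulrC -ltr_pdivrMr.
have n6' : 4 * dl + 3 < n%:R * dl by have := n6; rewrite -(ltr_pM2r dl0) mulrDl divfK // gt_eqF.
have n1 : 1 <= n%:R :> R by apply: le_trans (ltW n20); rewrite ler1n.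
have en1 : 1 <= eps * n%:R by apply: le_trans (ltW n4'); rewrite ler1n.
have [K [l [[K0 nE hl l_ge l_le] C20]]] := exists_parameters eps0 eps20 e1 n4' n20.
have s20 : 0 < s2 ^+ n by exact: sqrt2_gt0.
have C0 : 0 <= 8 * K%:R + 16 :> R by rewrite addr_ge0 ?mulr_ge0.
have w2 : (s2 ^+ n) ^+ 2 = 2 ^+ n by rewrite -exprM mulnC exprM s2_sqr.
have KN : (3 * K + l + e = n - K)%N by move: nE; clear; lia.
exists (upoly R K l e); split.
- by apply: leq_trans (size_upoly _ _ _ _) _; rewrite KN ltnS leq_subr.
- by rewrite {1 2}nE ktrans_upoly.
- exact: upoly0.
- move=> i; have := @upoly_coef_far K l e n i 1 (lexx _) K0 e1 nE.
  rewrite subrr mul0r mulr0 subr0 !expr1n !mulr1 => h; apply: le_trans h _.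
  have -> : (1 + 1) / s2 = s2.
    have s0 : s2 != 0 by rewrite gt_eqF //; lra.
    by apply: (mulIf s0); rewrite divfK // -expr2 s2_sqr.
  by rewrite ler_wpM2r ?(ltW s20).
move=> i hi.
have [iK|iK] := ltnP (n - K) i.
  rewrite nth_default ?normr0 ?mulr0 ?divr_ge0 ?btail_ge0 ?(ltW s20) //.
  by apply: leq_trans (size_upoly _ _ _ _) _; rewrite KN.
have i_n : (i < n)%N by apply: leq_ltn_trans iK _; move: nE K0; clear; lia.
have [uh uh2] : (2 * uphalf n <= n.+1)%N /\ (n <= 2 * uphalf n)%N.
  by rewrite uphalf_half; have := odd_double_half n; clear; lia.
have n2 : (1 < n)%N by rewrite -(ltr_nat R); apply: le_lt_trans n20; rewrite ler1n.
(* The largest binomial coefficient in the tail from [i] has this index, and k >= n/2 gives the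
   ratio x = k/(n - k) >= 1. For x up to 1 + dl the fixed radius 1 + dl is used, beyond it the
   radius x itself. *)
have [k kE] : {k | k = maxn i (uphalf n)} by exists (maxn i (uphalf n)).
have kn : (k < n)%N by rewrite kE; move: i_n n2 uh; clear; lia.
have ik : (i <= k)%N by rewrite kE leq_maxl.
have nk : 0 < (n - k)%:R :> R by rewrite ltr0n subn_gt0.
have x1 : 1 <= k%:R / (n - k)%:R :> R.
  by rewrite ler_pdivlMr // mul1r ler_nat kE; move: uh2 n2 i_n; clear; lia.
have BT := @btail_ge_bin n i k ik (ltnW kn).
have [xr|xr] := leP (k%:R / (n - k)%:R) (1 + dl).
  have near := @upoly_coef_near eps K l e n i eps0 eps1 K0 e1 hl nE l_le.
  rewrite -dlE in near.
  apply: (small_by_center eps0 eps20 lam0 s20 w2 en1 n1 C0 C20 (normr_ge0 _) near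
    (bin_center kn x1 xr) BT _ hi small1).
  have [uk|uk] := leqP (uphalf n) i; [left | right].
    by rewrite kE; apply/maxn_idPl.
  have -> : k = uphalf n by rewrite kE; apply/maxn_idPr/ltnW.
  by rewrite -natrM natr1 ler_nat.
(* The ratio belonging to [uphalf n] is at most 1 + dl for large n, so here the maximum is [i]. *)
have ki : k = i.
  rewrite kE; apply/maxn_idPl; rewrite leqNgt; apply/negP => iu.
  have ku : k = uphalf n by rewrite kE; apply/maxn_idPr/ltnW.
  have := uphalf_ratio dl0 n6'; rewrite -ku => h; move: xr; rewrite ltNge ler_pdivrMr // h.
  by [].
have hc : c <= (s2 - 1) * ((k%:R / (n - k)%:R - 1) / (k%:R / (n - k)%:R + 1)).
  by apply: cayley_mono => //; rewrite subr_ge0 (le_trans _ sl) // ler_pdivlMr // mul1r ler_nat.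
have far := upoly_coef_far_bin kn x1 K0 e1 nE (ltW c0) hc.
rewrite ki in far BT.
exact: (small_by_far c0 s20 n1 C0 C20 l_ge (ler0n _ _) BT far small2).
Unshelve. all: by end_near.
Qed.

End CoefBounds.

(** * Construction of an eigenvector with late nonnegative coefficients *)

Section FinalPoly.
Variable R : realType.
Local Notation s2 := (Num.sqrt 2 : R).

Lemma coef_1DXn n k : ((1 + 'X : {poly R}) ^+ n)`_k = 'C(n, k)%:R.
Proof.
rewrite exprDn coef_sum.
have E (i : 'I_n.+1) : (1 ^+ (n - i) * 'X ^+ i *+ 'C(n, i) : {poly R})`_k = (k == i)%:R *+ 'C(n, i).
  by rewrite expr1n mul1r coefMn coefXn.
under eq_bigr do rewrite E.
have [kn|nk] := leqP k n.
  rewrite (bigD1 (Ordinal (kn : (k < n.+1)%N))) //= eqxx big1 ?addr0 // => i /eqP ni.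
  by case: eqP => [ki|_]; [case: ni; apply: val_inj | rewrite mul0rn].
rewrite bin_small // big1 // => i _; case: eqP => [ki|_]; last by rewrite mul0rn.
by have := ltn_ord i; rewrite -ki ltnS leqNgt nk.
Qed.

Lemma ktrans_1DXn n : ktrans n ((1 + 'X) ^+ n) = (2 ^+ n)%:P :> {poly R}.
Proof.
rewrite -{1}[n]mul1n homogX ?size_1DX //.
have := ktrans1DZX (1 : R); rewrite scale1r => ->.
by rewrite subrr scale0r addr0 -polyC_exp.
Qed.

Lemma horner1_ktrans n (p : {poly R}) : (size p <= n.+1)%N -> p.[1] = (ktrans n p)`_0.
Proof.
move=> sp; rewrite ktrans_coef0 (horner_coef_wide _ sp); apply: eq_bigr => i _.
by rewrite expr1n mulr1.
Qed.

(* [X (1 - X)] is an eigenvector of degree 2 with eigenvalue 2, so it may be divided out. *)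
Lemma divide_form m (N : {poly R}) (c : R) : (size N <= m.+3)%N -> N`_0 = 0 ->
  ktrans m.+2 N = (2 * c) *: N ->
  exists Y : {poly R}, [/\ (size Y <= m.+1)%N, ktrans m Y = c *: Y &
    forall i, N`_i.+2 = Y`_i - Y`_i.+1].
Proof.
move=> sN N0 EN.
have r0 : root N 0 by rewrite /root horner_coef0 N0.
have [N1 N1E] := factor_theorem _ _ r0; rewrite subr0 in N1E.
have r1 : root N1 1.
  have : N.[1] = 0 by rewrite (horner1_ktrans sN) EN coefZ N0 mulr0.
  by rewrite N1E hornerM hornerX mulr1 => h; rewrite /root h.
have [Y YE] := factor_theorem _ _ r1.
have NE : N = - (('X * (1 - 'X)) * Y) by rewrite N1E YE polyC1; ring.
have q0 : 'X * (1 - 'X) != 0 :> {poly R}.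
  rewrite mulf_neq0 ?polyX_eq0 // subr_eq0 eq_sym; apply/eqP => /(congr1 (fun p : {poly R} => p`_0)).
  by rewrite coefX coef1 /=; apply/eqP; rewrite eq_sym oner_eq0.
have sq : (size ('X * (1 - 'X) : {poly R})%R = 3)%N.
  have -> : 'X * (1 - 'X) = - ('X * ('X - 1%:P)) :> {poly R} by rewrite polyC1; ring.
  by rewrite size_polyN mulrC size_mulX ?polyXsubC_eq0 // size_XsubC.
have sY : (size Y <= m.+1)%N.
  have [->|Y0] := eqVneq Y 0; first by rewrite size_poly0.
  by move: sN; rewrite NE size_polyN size_mul // sq /=.
exists Y; split => // [|i]; last first.
  rewrite NE coefN -mulrA coefXM /= mulrBl mul1r coefB coefXM /=; ring.
have h : ktrans (2 + m) N = - (2 *: ('X * (1 - 'X)) * ktrans m Y).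
  rewrite NE linearN /= homogM ?sq //; congr (- (_ * _)).
  by have := ktrans_pq R 0 1; rewrite add0n expr0 mul1r !expr1.
rewrite add2n EN NE scalerN in h; move/oppr_inj: h.
rewrite -scalerAl -[(2 * c) *: _]scalerA => /scalerI; rewrite pnatr_eq0 => /(_ isT).
by rewrite scalerAr => /(mulfI q0).
Qed.

Lemma btail_mono n i j : (i <= j)%N -> btail R n j <= btail R n i.
Proof.
move=> ij; have [jn|nj] := leqP j n.+1; last first.
  by rewrite {1}/btail big_geq ?btail_ge0 // ltnW.
by rewrite [leRHS]/btail (big_cat_nat (n := j)) //= lerDr sumr_ge0.
Qed.

Lemma btail_shiftE m i : btail R m.+2 i.+2 = \sum_(i <= j < m.+1) 'C(m.+2, j.+2)%:R.
Proof. by rewrite /btail !big_add1. Qed.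

Lemma btail_shift m i : btail R m i <= btail R m.+2 i.+2.
Proof.
rewrite btail_shiftE; apply: ler_sum => j _; rewrite ler_nat !binS; lia.
Qed.

Lemma btail_gt0 n i : (i <= n)%N -> 0 < btail R n i.
Proof.
by move=> h; apply: lt_le_trans (@btail_ge_bin R n i n h (leqnn n)); rewrite binn.
Qed.

Lemma sum_bin n : \sum_(i < n.+1) 'C(n, i)%:R = 2 ^+ n :> R.
Proof.
rewrite -[2 in RHS]/(1 + 1) exprDn; apply: eq_bigr => i _.
by rewrite !expr1n mul1r.
Qed.

Section Construct.
Variables (m : nat) (s : R) (Q : {poly R}) (thr : nat).
Let n := m.+2.
Hypotheses (s1 : s = 1 \/ s = -1) (sQ : (size Q <= n.+1)%N) (m0 : (3 <= m)%N).
Hypotheses (EQ : ktrans n Q = (s * s2 ^+ n) *: Q) (Q0 : Q`_0 = 1).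
Hypotheses (Q_le : forall i, `|Q`_i| <= 20 * n%:R * s2 ^+ n).
Hypotheses (Q_tail : forall i, (thr <= i.+2)%N -> n%:R ^+ 5 * `|Q`_i.+2| <= btail R n i.+2 / s2 ^+ n).
Let w := s2 ^+ n.

Let w0 : 0 < w. Proof. exact: sqrt2_gt0. Qed.
Let ss : s ^+ 2 = 1. Proof. by case: s1 => ->; rewrite ?sqrrN expr1n. Qed.
Let w2 : w ^+ 2 = 2 ^+ n. Proof. by rewrite -exprM mulnC exprM s2_sqr. Qed.
Let w1 : 1 <= w.
Proof. by rewrite exprn_ege1 //; have /andP[h _] := s2_bounds R; lra. Qed.
Let ns : `|s| = 1. Proof. by case: s1 => ->; rewrite ?normrN normr1. Qed.
Let nR : 1 <= n%:R :> R. Proof. by rewrite ler1n. Qed.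

(** The transform sends 1 to (1 + X)^n and (1 + X)^n to 2^n = w^2, so 1 + (s/w)(1 + X)^n has
    eigenvalue s w like [Q]. The factor 1 + s/w makes the constant terms cancel, as division by X(1
    - X) requires. *)
Let N : {poly R} := (1 + s / w) *: Q - 1 - (s / w) *: (1 + 'X) ^+ n.

Let N_tail i : N`_i.+2 = (1 + s / w) * Q`_i.+2 - s / w * 'C(n, i.+2)%:R.
Proof. by rewrite !coefB !coefZ coef1 subr0 coef_1DXn. Qed.

Let cs : `|1 + s / w| <= 2.
Proof.
apply: le_trans (ler_normD _ _) _; rewrite normr1 normrM ns mul1r ger0_norm ?invr_ge0 ?(ltW w0) //.
have : w^-1 <= 1 by rewrite invf_le1.
lra.
Qed.

(* Dividing [N] by [X (1 - X)] turns its coefficients into tail sums; those of the binomial part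
   are positive and dominate. *)
Lemma first_solution : exists V : {poly R}, [/\ (size V <= m.+1)%N,
  ktrans m V = (s * s2 ^+ m) *: V,
  forall i, (thr <= i.+2)%N -> btail R n i.+2 / w / 2 <= V`_i &
  `|V`_0| <= 82 * n%:R ^+ 3].
Proof.
have wm : w = 2 * s2 ^+ m by rewrite /w /n !exprS mulrA -expr2 s2_sqr.
have sX : (size ((1 + 'X : {poly R}) ^+ n) <= n.+1)%N.
  by have := size_polyexp_bound n (size_1DX R); rewrite mul1n.
have sN : (size N <= m.+3)%N.
  apply: leq_trans (size_polyD _ _) _; rewrite size_polyN geq_max; apply/andP; split.
    apply: leq_trans (size_polyD _ _) _; rewrite size_polyN size_poly1 geq_max andbT.
    exact: leq_trans (size_scale_leq _ _) sQ.
  exact: leq_trans (size_scale_leq _ _) sX.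
have N0 : N`_0 = 0 by rewrite !coefB !coefZ coef1 coef_1DXn Q0 bin0 /=; ring.
have EN : ktrans m.+2 N = (2 * (s * s2 ^+ m)) *: N.
  have -> : 2 * (s * s2 ^+ m) = s * w by rewrite wm; ring.
  rewrite /N !linearB !linearZ /= EQ homog1 ktrans_1DXn -w2 -!mul_polyC.
  have ww : (s / w * w ^+ 2) = s * w by field; rewrite gt_eqF.
  have sw : s * w * (s / w) = 1 by rewrite -[RHS]ss; field; rewrite gt_eqF.
  have E1 : (s / w)%:P * (w ^+ 2)%:P = (s * w)%:P by rewrite -polyCM ww.
  have E2 : (s * w)%:P * (s / w)%:P = 1 by rewrite -polyCM sw.
  by rewrite -/w -/n !mulrN E1 (mulrA (s * w)%:P (s / w)%:P) E2; ring.
have [Y [sY EY NY]] := divide_form sN N0 EN.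
have Ym i : (m < i)%N -> Y`_i = 0 by move=> mi; rewrite nth_default // (leq_trans sY).
have YE i : (i <= m.+1)%N -> Y`_i = \sum_(i <= j < m.+1) N`_j.+2.
  move=> im; under eq_bigr do rewrite NY -opprB.
  by rewrite sumrN telescope_sumr // (Ym m.+1) // sub0r opprK.
(* The binomial part of [N] has coefficient -s/w; the factor -s makes it s^2/w = 1/w > 0. *)
exists (- s *: Y); split.
- by apply: leq_trans (size_scale_leq _ _) sY.
- by rewrite linearZ /= EY !scalerA mulrC.
- move=> i ti; have [im|mi] := leqP i m; last first.
    rewrite coefZ Ym // mulr0 {1}/btail big_geq ?mul0r //.
  rewrite coefZ YE ?leqW //.
  under eq_bigr do rewrite N_tail.
  rewrite sumrB -mulr_sumr -mulr_sumr -btail_shiftE.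
  have h1 : `|\sum_(i <= j < m.+1) Q`_j.+2| <= n%:R * (btail R n i.+2 / w / n%:R ^+ 5).
    apply: le_trans (ler_norm_sum _ _ _) _.
    apply: (@le_trans _ _ (\sum_(i <= j < m.+1) (btail R n i.+2 / w / n%:R ^+ 5))).
      rewrite !big_nat; apply: ler_sum => j /andP[ij _].
      rewrite ler_pdivlMr ?exprn_gt0 // mulrC; apply: le_trans (Q_tail _) _.
        by rewrite (leq_trans ti).
      by rewrite ler_wpM2r ?invr_ge0 ?(ltW w0) // btail_mono.
    rewrite sumr_const_nat -[leLHS]mulr_natl ler_wpM2r ?ler_nat ?divr_ge0 ?btail_ge0 ?exprn_ge0 ?(ltW w0) //.
    by rewrite /n; lia.
  move: (\sum_(i <= j < m.+1) Q`_j.+2) h1 => S h1.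
  have T0 : 0 <= btail R n i.+2 / w by rewrite divr_ge0 ?btail_ge0 // ltW.
  have gen (T : R) : - s * ((1 + s / w) * S - s / w * T) = s ^+ 2 * (T / w) - s * (1 + s / w) * S by ring.
  rewrite gen ss mul1r -/n.
  move: (btail R n i.+2 / w) T0 h1 => T T0 h1.
  have h2 : s * (1 + s / w) * S <= T / 2.
    apply: le_trans (ler_norm _) _; rewrite !normrM ns mul1r.
    apply: le_trans (ler_pM (normr_ge0 _) (normr_ge0 _) cs h1) _.
    have -> : 2 * (n%:R * (T / n%:R ^+ 5)) = T * (2 / n%:R ^+ 4).
      by field; rewrite pnatr_eq0.
    rewrite ler_wpM2l // ler_pdivrMr ?exprn_gt0 ?ltr0n //.
    have : 4 <= n%:R ^+ 4 :> R; last by lra.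
    have : (2 : R) ^+ 4 <= n%:R ^+ 4 by rewrite lerXn2r ?nnegrE // ler_nat.
    have -> : (2 : R) ^+ 4 = 16 by ring.
    lra.
  lra.
have Y_le i : `|Y`_i| <= 41 * n%:R ^+ 2 * w.
  have [im|mi] := leqP i m; last first.
    by rewrite Ym // normr0; apply: mulr_ge0; [rewrite mulr_ge0 // sqr_ge0 | exact: ltW].
  rewrite YE ?leqW //; apply: le_trans (ler_norm_sum _ _ _) _.
  apply: (@le_trans _ _ (\sum_(i <= j < m.+1) (40 * n%:R * w + 'C(n, j.+2)%:R / w))).
    apply: ler_sum => j _; rewrite N_tail; apply: le_trans (ler_normB _ _) _; apply: lerD.
      rewrite normrM; apply: le_trans (ler_pM (normr_ge0 _) (normr_ge0 _) cs (Q_le _)) _.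
      by rewrite -/w; lra.
    rewrite !normrM ns mul1r ger0_norm ?invr_ge0 ?(ltW w0) // ger0_norm // mulrC.
    by [].
  rewrite big_split /= sumr_const_nat -mulr_suml -btail_shiftE.
  have h1 : btail R n i.+2 / w <= n%:R ^+ 2 * w.
    rewrite ler_pdivrMr // -mulrA -expr2 w2.
    apply: le_trans (_ : btail R n 0 <= _); first exact: btail_mono.
    by rewrite /btail big_mkord sum_bin ler_peMl ?exprn_ge0 // exprn_ege1.
  have h2 : (m.+1 - i)%:R <= n%:R :> R by rewrite ler_nat /n; lia.
  have h3 : 0 <= 40 * n%:R * w by apply: mulr_ge0; [rewrite mulr_ge0 | exact: ltW].
  have := ler_wpM2r h3 h2; rewrite mulr_natl; move: (_ *+ _) h1; rewrite -/n => z h1 h4.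
  lra.
rewrite coefZ normrM normrN ns mul1r.
(* [Y_le] alone bounds the constant term only by something exponential. The eigenvector relation at
   1 divides the sum of all coefficients by 2^(m/2), which leaves a polynomial bound. *)
have Y1 : Y.[1] = s * s2 ^+ m * Y`_0 by rewrite (horner1_ktrans sY) EY coefZ.
have h1 : `|Y.[1]| <= n%:R * (41 * n%:R ^+ 2 * w).
  rewrite (horner_coef_wide _ sY); apply: le_trans (ler_norm_sum _ _ _) _.
  apply: (@le_trans _ _ (\sum_(j < m.+1) (41 * n%:R ^+ 2 * w))).
    by apply: ler_sum => j _; rewrite expr1n mulr1.
  have h41 : 0 <= 41 * n%:R ^+ 2 * w by apply: mulr_ge0; [rewrite mulr_ge0 // sqr_ge0 | exact: ltW].
  move: (41 * n%:R ^+ 2 * w) h41 => z z0.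
  by rewrite sumr_const card_ord -[z *+ _]mulr_natl; apply: ler_wpM2r => //; rewrite ler_nat.
have sm : 0 < s2 ^+ m by exact: sqrt2_gt0.
rewrite -(ler_pM2l sm).
have -> : s2 ^+ m * `|Y`_0| = `|Y.[1]|.
  by rewrite Y1 !normrM ns mul1r ger0_norm // ltW.
apply: le_trans h1 _; rewrite wm le_eqVlt; apply/orP; left; apply/eqP; ring.
Qed.

End Construct.
Lemma limit_bounds : 0 <= 1 / 2 - 1 / pi :> R /\ 1 / 2 - 1 / pi <= 1 / 4 :> R.
Proof.
have p2 : 1 / pi <= 1 / 2 :> R by rewrite !div1r lef_pV2 ?posrE ?pi_gt0 // pi_ge2.
have ip : 1 / 4 <= 1 / pi :> R.
  by rewrite !div1r lef_pV2 ?posrE ?pi_gt0 //; have := pihalf_lt2 R; lra.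
split; lra.
Qed.

(** Two small eigenvectors are needed: [Q] of degree m + 2, because the division in [first_solution]
    lowers the degree by 2, and [Q'] of degree m, which removes the constant term of [V]. *)
Lemma exists_competitor (eps : R) e : 0 < eps -> eps <= 1 / 20 -> (e <= 1)%N ->
  \forall m \near \oo, exists U : {poly R},
    [/\ (size U <= m.+1)%N, ktrans m U = ((-1) ^+ e * s2 ^+ m) *: U, U != 0, U`_0 = 0 &
        forall i, m%:R * (1 / 2 - 1 / pi + 6 * eps) <= i%:R -> 0 <= U`_i].
Proof.
move=> eps0 eps20 e1; have [M _ hM] := exists_small_poly eps0 eps20 e1.
near=> m.
have mM : (M <= m)%N by near: m; exact: nbhs_infty_ge.
have m100 : (100 <= m)%N by near: m; exact: nbhs_infty_ge.
have [Q [sQ EQ Q0 Q_le Q_tail]] := hM m.+2 (leq_trans mM (leqW (leqnSn m))).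
have [Q' [sQ' EQ' Q0' _ Q_tail']] := hM m mM.
set s : R := (-1) ^+ e in EQ EQ' *.
have s1 : s = 1 \/ s = -1.
  by rewrite /s; case: (e) e1 => [|[|//]] _; [left; rewrite expr0 | right; rewrite expr1].
have [r0 r1] := limit_bounds.
have [r rE] : {r : R | r = 1 / 2 - 1 / pi + 6 * eps} by exists (1 / 2 - 1 / pi + 6 * eps).
have r_ge : 0 <= r by rewrite rE addr_ge0 // mulr_ge0 // ltW.
have r_le : r <= 11 / 20 by rewrite rE; clear -r1 eps20; lra.
rewrite -rE in Q_tail Q_tail' *.
have x0 : 0 <= m.+2%:R * r by rewrite mulr_ge0.
have /andP[tr1 tr2] := truncn_itv x0.
pose thr := (Num.truncn (m.+2%:R * r)).+1.
have thr1 i : (thr <= i.+2)%N ->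
    m.+2%:R ^+ 5 * `|Q`_i.+2| <= btail R m.+2 i.+2 / s2 ^+ m.+2.
  by move=> h; apply: Q_tail; rewrite (le_trans (ltW tr2)) // ler_nat.
(* The shift of both degree and index by 2 is harmless because r < 1: (m + 2) r = m r + 2r < i +
   2. *)
have thr2 i : m%:R * r <= i%:R -> (thr <= i.+2)%N.
  move=> h; rewrite ltnS -ltnS -(ltr_nat R); apply: le_lt_trans tr1 _.
  rewrite -[m.+2]addn2 -[i.+2]addn2 !natrD mulrDl; clear -h r_le; lra.
have m3 : (3 <= m)%N by apply: leq_trans m100.
have [V [sV EV V_ge V0]] := first_solution s1 sQ m3 EQ Q0 Q_le thr1.
have U_gt i : m%:R * r <= i%:R -> (i <= m)%N -> 0 < (V - V`_0 *: Q')`_i.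
  move=> hi im; rewrite coefB coefZ subr_gt0.
  have T0 : 0 < btail R m.+2 i.+2 by rewrite btail_gt0.
  have sm : 0 < s2 ^+ m by exact: sqrt2_gt0.
  apply: lt_le_trans (V_ge i (thr2 i hi)).
  have mR : 100 <= m%:R :> R by rewrite (ler_nat R 100).
  have h1 : `|Q'`_i| <= btail R m.+2 i.+2 / s2 ^+ m / m%:R ^+ 5.
    rewrite ler_pdivlMr ?exprn_gt0 ?(lt_le_trans _ mR) // mulrC (le_trans (Q_tail' i hi)) //.
    by rewrite ler_wpM2r ?invr_ge0 ?(ltW sm) // btail_shift.
  have m50 : 0 < m%:R ^+ 5 :> R by rewrite exprn_gt0 // (lt_le_trans _ mR).
  (* The constant term of order m^3 is outweighed by the m^5 in the bound for [Q'], so the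
     correction is a fraction of order m^-2 of the tail. *)
  have h2 : V`_0 * Q'`_i <= 82 * m.+2%:R ^+ 3 * (btail R m.+2 i.+2 / s2 ^+ m / m%:R ^+ 5).
    by apply: le_trans (ler_norm _) _; rewrite normrM; apply: ler_pM.
  apply: le_lt_trans h2 _.
  have -> : s2 ^+ m.+2 = 2 * s2 ^+ m by rewrite !exprS mulrA -expr2 s2_sqr.
  have X0 : 0 < btail R m.+2 i.+2 / s2 ^+ m by rewrite divr_gt0.
  have -> : btail R m.+2 i.+2 / (2 * s2 ^+ m) / 2 = btail R m.+2 i.+2 / s2 ^+ m * (1 / 4).
    by field; rewrite gt_eqF.
  rewrite mulrCA ltr_pM2l // ltr_pdivrMr //.
  have h3 : m.+2%:R <= 2 * m%:R :> R by rewrite -natrM ler_nat; clear -m3; lia.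
  have h4 : m.+2%:R ^+ 3 <= (2 * m%:R) ^+ 3 :> R by rewrite lerXn2r ?nnegrE ?mulr_ge0.
  have h5 : 82 * m.+2%:R ^+ 3 <= 82 * (2 * m%:R) ^+ 3 :> R by rewrite ler_wpM2l.
  apply: le_lt_trans h5 _.
  have m0 : 0 < m%:R :> R by apply: lt_le_trans mR.
  have -> : 82 * (2 * m%:R) ^+ 3 = 656 * m%:R ^+ 3 :> R by ring.
  have -> : 1 / 4 * m%:R ^+ 5 = (m%:R ^+ 2 / 4) * m%:R ^+ 3 :> R by field.
  rewrite ltr_pM2r ?exprn_gt0 //.
  have : 100 * 100 <= m%:R ^+ 2 :> R by rewrite expr2; apply: ler_pM.
  clear -m0; lra.
exists (V - V`_0 *: Q'); split.
- apply: leq_trans (size_polyD _ _) _; rewrite size_polyN geq_max sV /=.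
  exact: leq_trans (size_scale_leq _ _) sQ'.
- by rewrite linearB linearZ /= EV EQ' scalerBr !scalerA [_ * V`_0]mulrC.
- apply/eqP => U0; have := U_gt m; rewrite U0 coef0 ltxx => h.
  have : false by apply: h => //; rewrite ler_piMr // (le_trans r_le) //; clear; lra.
  by [].
- by rewrite coefB coefZ Q0' mulr1 subrr.
- move=> i hi; have [im|mi] := leqP i m; first by rewrite ltW // U_gt.
  have vanish (p : {poly R}) : (size p <= m.+1)%N -> p`_i = 0.
    by move=> sp; rewrite nth_default // (leq_trans sp).
  by rewrite coefB coefZ !vanish // mulr0 subr0.
Unshelve. all: by end_near.
Qed.

End FinalPoly.

(** * Return to radial vectors and the limit *)

Section Uncertainty.
Variable R : realType.
Local Notation s2 := (Num.sqrt 2 : R).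

Lemma uncertainty_ge (eps s : R) : 0 < eps -> s ^+ 2 = 1 ->
  \forall n \near \oo, ((n%:R * (1 / 2 - 1 / pi - 2 * eps))%:E <= krawtchouk_uncertainty s n)%E.
Proof.
move=> eps0 ss; have := last_sign_lower eps0; apply: filterS => n hn.
apply: le_ereal_inf_tmp => _ [u [u0 Eu u00] <-].
rewrite /last_sign_radius; elim/big_ind: _ => [|x y hx hy|r hr]; first exact: leey.
  by rewrite le_min hx.
rewrite lee_fin; apply: (hn s (radial_poly u)) => //.
- exact: size_poly.
- exact: ((krawtchouk_eigenspaceP s u).1 Eu).
- apply: contra u0 => /eqP p0; apply/eqP/rowP => i; rewrite mxE.
  have := coef_radial u i; rewrite p0 coef0 => /esym/eqP.
  by rewrite mulf_eq0 (negPf (bin_neq0 R i)) => /eqP.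
- by have := coef_radial u ord0; rewrite u00 mulr0.
- move=> i ri; rewrite coef_poly; case: ltnP => // iN.
  rewrite mulr_ge0 //; move/forallP: hr => /(_ (inord i)).
  by rewrite inordK // ri.
- by rewrite -ltnS.
Qed.

Lemma uncertainty_le (eps : R) e : 0 < eps -> eps <= 1 / 20 -> (e <= 1)%N ->
  \forall n \near \oo, (krawtchouk_uncertainty ((-1) ^+ e : R) n <=
    (n%:R * (1 / 2 - 1 / pi + 7 * eps))%:E)%E.
Proof.
move=> eps0 eps20 e1; have hex := exists_competitor eps0 eps20 e1.
near=> n.
have [U [sU EU U0 U00 U_ge]] : exists U : {poly R},
    [/\ (size U <= n.+1)%N, ktrans n U = ((-1) ^+ e * s2 ^+ n) *: U, U != 0, U`_0 = 0 &
        forall i, n%:R * (1 / 2 - 1 / pi + 6 * eps) <= i%:R -> 0 <= U`_i].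
  by near: n.
have big : 1 / eps < n%:R by near: n; exact: nbhs_infty_gtr.
rewrite ltr_pdivrMr // in big.
have [u uE ui] := exists_radial sU.
have [r0 r1] := limit_bounds R.
have x0 : 0 <= n%:R * (1 / 2 - 1 / pi + 6 * eps).
  by rewrite mulr_ge0 // addr_ge0 // mulr_ge0 // ltW.
have /andP[tr1 tr2] := truncn_itv x0.
pose r := (Num.truncn (n%:R * (1 / 2 - 1 / pi + 6 * eps))).+1.
(* Rounding up to an integer radius costs at most 1 < eps n, hence 7 eps in place of 6 eps. *)
have r_le : r%:R <= n%:R * (1 / 2 - 1 / pi + 7 * eps) :> R by rewrite -[r%:R]natr1; lra.
have rn : (r < n.+1)%N.
  rewrite ltnS -(ler_nat R); apply: le_trans r_le _; rewrite ler_piMr //; lra.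
have hu : [forall i : 'I_n.+1, (r <= i)%N ==> (0 <= u 0 i)].
  apply/forallP => i; apply/implyP => ri; rewrite ui divr_ge0 //; apply: U_ge.
  by rewrite (le_trans (ltW tr2)) // ler_nat.
apply: (@le_trans _ _ (last_sign_radius u)).
  apply: ereal_inf_lbound; exists u => //; split.
  - by apply: contra U0 => /eqP u0; rewrite -uE u0; apply/eqP/polyP => i; rewrite coef_poly mxE mulr0 if_same coef0.
  - by apply: (krawtchouk_eigenspaceP _ u).2; rewrite uE.
  - by rewrite ui U00 mul0r.
apply: (@le_trans _ _ (r%:R%:E)); last by rewrite lee_fin.
rewrite /last_sign_radius.
pose P (k : 'I_n.+1) := [forall i : 'I_n.+1, (k <= i)%N ==> (0 <= u 0 i)].
exact: (@bigmin_le_cond _ _ _ _ (Ordinal rn) P (fun k : 'I_n.+1 => ((k : nat)%:R)%:E) hu).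
Unshelve. all: by end_near.
Qed.

End Uncertainty.

Theorem theorem1p2 (R : realType) (s : R) (hs : s = -1 \/ s = 1) :
  (krawtchouk_uncertainty s n / (n%:R)%:E)%E @[n --> \oo]
    --> ((1 / 2 - 1 / pi)%:E : \bar R).
Proof.
have ss : s ^+ 2 = 1 by case: hs => ->; rewrite ?sqrrN expr1n.
have [e e1 sE] : exists2 e, (e <= 1)%N & s = (-1) ^+ e.
  by case: hs => ->; [exists 1%N; rewrite ?expr1 | exists 0%N; rewrite ?expr0].
have bounds (eps : R) : 0 < eps -> eps <= 1 / 20 -> \forall n \near \oo,
    exists2 x : R, (krawtchouk_uncertainty s n / (n%:R)%:E)%E = x%:E &
      `|1 / 2 - 1 / pi - x| <= 7 * eps.
  move=> eps0 eps20; have lo := uncertainty_ge eps0 ss; have up := uncertainty_le eps0 eps20 e1.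
  rewrite -sE in up; near=> n.
  have n0 : 0 < n%:R :> R by rewrite ltr0n; near: n; exact: nbhs_infty_gt.
  have hlo : ((n%:R * (1 / 2 - 1 / pi - 2 * eps))%:E <= krawtchouk_uncertainty s n)%E by near: n.
  have hup : (krawtchouk_uncertainty s n <= (n%:R * (1 / 2 - 1 / pi + 7 * eps))%:E)%E by near: n.
  case: (krawtchouk_uncertainty s n) hlo hup => [x| |] //; rewrite !lee_fin => hlo hup.
  exists (x / n%:R); first by rewrite inver gt_eqF // EFinM.
  have h1 : 1 / 2 - 1 / pi - 2 * eps <= x / n%:R by rewrite ler_pdivlMr // mulrC.
  have h2 : x / n%:R <= 1 / 2 - 1 / pi + 7 * eps by rewrite ler_pdivrMr // mulrC.
  by rewrite ler_norml; apply/andP; split; lra.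
apply/fine_cvgP; split.
  have e20 : 0 < 1 / 20 :> R by [].
  by have := bounds _ e20 (lexx _); apply: filterS => n [x -> _].
apply/cvgrPdist_le => d d0.
pose eps : R := Num.min (1 / 20) (d / 7).
have eps0 : 0 < eps by rewrite lt_min !divr_gt0.
have eps20 : eps <= 1 / 20 by rewrite ge_min lexx.
have epsd : 7 * eps <= d by rewrite mulrC -ler_pdivlMr // ge_min lexx orbT.
have := bounds _ eps0 eps20; apply: filterS => n [x xE hx].
by rewrite /= xE /=; apply: le_trans hx epsd.
Unshelve. all: by end_near.
Qed.
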